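(* Let $H$ be a topological group, let $Q$ be a finite group acting on a finite set $X$, and let $H \wr_X Q = H^X \rtimes Q$ be the corresponding permutational wreath product. Then $H \wr_X Q$ is rigid if and only if $H$ is rigid. Moreover, when this is the case, we have $$ \zeta(H \wr_X Q,s) = \sum_{P \in \Pi_Q(X)} [Q : Q_P]^{-1-s}\, \zeta(Q_P,s) \sum_{\substack{P' = (P'_1,\dots,P'_\ell) \in \Pi_Q(X)\\ P' \ge P}} \mu_X(P,P')\, \zeta(H,|P'_1| s) \cdots \zeta(H,|P'_\ell| s), $$ where $P'_1,\dots,P'_\ell$ denote the blocks of $P'$.
   Context: For a group $G$, $\widehat G$ denotes the set of equivalence classes of irreducible linear representations of $G$ in finite-dimensional complex vector spaces (continuous representations if $G$ is a topological group). For $n\ge 1$, $r_n(G)\in\{0,1,2,\dots,\infty\}$ is the number of $\pi\in\widehat G$ of degree $n$. $G$ is rigid if $r_n(G)<\infty$ for all $n\ge 1$. The representation zeta function of a rigid group $G$ is the Dirichlet series $\zeta(G,s)=\zeta_G(s)=\sum_{\pi\in\widehat G}(\deg\pi)^{-s}=\sum_{n\ge1} r_n(G)n^{-s}$. Identities between such functions are understood as identities of Dirichlet series. In $H\wr_X Q = H^X\rtimes Q$, $H^X$ is the group of all maps $X\to H$ with pointwise multiplication, $Q$ acts by $(qb)(x)=b(q^{-1}x)$, and the topology is the one for which $H^X$ has the product topology and is an open subgroup. $\Pi_Q(X)$ is the lattice of all partitions of $X$ which are partitions into $S$-orbits for some subgroup $S$ of $Q$, ordered by: $P\le P'$ if every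 block of $P$ is contained in a block of $P'$. For $P=(P_1,\dots,P_\ell)\in\Pi_Q(X)$, the stability subgroup is $Q_P=\{q\in Q : q(P_1)=P_1,\dots,q(P_\ell)=P_\ell\}$. $\mu_X$ is the Möbius function of $\Pi_Q(X)$: $\mu_X(P,P'')=0$ unless $P\le P''$, $\mu_X(P,P)=1$, and $\mu_X(P,P'')=-\sum_{P'\in\Pi_Q(X),\,P\le P'<P''}\mu_X(P,P')$ if $P<P''$.
   Formalization: The equivalence ''H wr_X Q is rigid iff H is rigid'' is stated for nonempty X, since for empty X the wreath product is Q, which is always rigid, whatever H is; that H rigid implies the wreath product rigid, with the zeta formula, is stated for every finite X. *)

(* Defs.v *)
From HB Require Import structures.
From mathcomp Require Import all_boot all_order all_fingroup all_algebra.
From mathcomp Require Import finmap complex.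
From mathcomp Require Import all_classical all_reals.
From mathcomp Require Import topology normedtype.

Set Implicit Arguments.
Unset Strict Implicit.
Unset Printing Implicit Defensive.

Import Order.TTheory GRing.Theory Num.Theory.

Local Open Scope ring_scope.

(* A formal Dirichlet series is given by its coefficients: a n is the
   coefficient of n^-s for n >= 1, and the value a 0 is meaningless. *)
Definition dirichlet : Type := nat -> rat.

HB.instance Definition _ := GRing.Zmodule.copy dirichlet (nat -> rat).

Definition dirichlet_eq (a b : dirichlet) : Prop :=
  forall n, (0 < n)%N -> a n = b n.

Definition dirichlet_one : dirichlet := fun n => (n == 1%N)%:R.

Definition dirichlet_mul (a b : dirichlet) : dirichlet :=
  fun n => \sum_(d <- divisors n) a d * b (n %/ d)%N.

(* The one-term series m^(-1-s) = m^-1 * m^-s. *)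
Definition dirichlet_monom1 (m : nat) : dirichlet :=
  fun n => (n == m)%:R * m%:R^-1.

(* The substitution s |-> k * s (for k >= 1): a_m * m^(-k s) contributes to
   the coefficient of (m ^ k)^-s. *)
Definition dirichlet_subst (k : nat) (a : dirichlet) : dirichlet :=
  fun n => \sum_(1 <= m < n.+1 | (m ^ k == n)%N) a m.

Section OrbitPartitions.
Variables (gT : finGroupType) (X : finType) (to : {action gT &-> X}).
Implicit Types P : {set {set X}}.

Definition orbits_of (S : {group gT}) : {set {set X}} :=
  orbit to S @: [set: X].

Definition orbit_partitions : {set {set {set X}}} :=
  [set orbits_of S | S : {group gT}].

Definition refines P P' : bool :=
  [forall B in P, [exists B' in P', B \subset B']].

(* 'N(B | to) is the setwise stabiliser of B. *)
Definition stability P : {group gT} := 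
  [group of (\bigcap_(B in P) 'N(B | to)%g)%SET].

(* Recursion on a bound k for the length of chains; see moebiusE. *)
Fixpoint moebius_rec (k : nat) P P'' : int :=
  if k is k'.+1 then
    if ~~ refines P P'' then 0 else
    if P == P'' then 1 else
    - \sum_(P' in orbit_partitions |
        [&& refines P P', refines P' P'' & P' != P'']) moebius_rec k' P P'
  else 0.

Definition moebius P P'' : int := moebius_rec #|orbit_partitions| P P''.

Lemma orbit_partitionsP P :
  P \in orbit_partitions -> finset.partition P [set: X].
Proof.
case/imsetP=> S _ ->; apply: orbit_partition.
by apply/actsP=> a _ x; rewrite !inE.
Qed.

Lemma refines_trans : transitive refines.
Proof.
move=> P2 P1 P3 /forall_inP h12 /forall_inP h23; apply/forall_inP => B BP1.
have /exists_inP [C CP2 BC] := h12 _ BP1.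
have /exists_inP [D DP3 CD] := h23 _ CP2.
by apply/exists_inP; exists D; rewrite // (fintype.subset_trans BC).
Qed.

Let refines_sub P P' : finset.partition P [set: X] ->
  refines P P' -> refines P' P -> P \subset P'.
Proof.
move=> /and3P[_ tP nP] /forall_inP h /forall_inP h'.
apply/fintype.subsetP => B BP.
have /exists_inP [C CP' BC] := h _ BP.
have /exists_inP [D DP CD] := h' _ CP'.
have BD := fintype.subset_trans BC CD.
have /finset.set0Pn [x xB] : B != finset.set0 by apply: contraNneq nP => <-.
have eBD : B = D.
  by rewrite -(def_pblock tP BP xB) (def_pblock tP DP (fintype.subsetP BD _ xB)).
suff -> : B = C by [].
by apply/eqP; rewrite finset.eqEsubset BC {1}eBD CD.
Qed.

Lemma refines_anti P P' :
  finset.partition P [set: X] -> finset.partition P' [set: X] ->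
  refines P P' -> refines P' P -> P = P'.
Proof.
by move=> pP pP' h h'; apply/eqP; rewrite finset.eqEsubset !refines_sub.
Qed.

Let below P : {set {set {set X}}} :=
  [set P' in orbit_partitions | refines P' P && (P' != P)].

Let below_lt P' P : P \in orbit_partitions -> P' \in orbit_partitions ->
  refines P' P -> P' != P -> (#|below P'| < #|below P|)%N.
Proof.
move=> /orbit_partitionsP pP oP' le ne; apply: proper_card; apply/fintype.properP.
split; last by exists P'; rewrite !inE ?oP' ?le ?ne // eqxx !andbF.
apply/fintype.subsetP => Q; rewrite !inE => /and3P[-> leQ neQ] /=.
rewrite (refines_trans leQ le) /=; apply: contraNneq ne => eQ.
by rewrite -{}eQ in pP le *; apply/eqP/refines_anti => //;
  exact: orbit_partitionsP.
Qed.

Let moebius_rec_stable k l P P'' : P'' \in orbit_partitions ->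
  (#|below P''| < k)%N -> (#|below P''| < l)%N ->
  moebius_rec k P P'' = moebius_rec l P P''.
Proof.
elim: k l P'' => [|k IH] [|l] P'' // oP'' hk hl.
rewrite /=; case: ifP => // _; case: ifP => // _; congr (- _).
apply: eq_bigr => P' /and4P[oP' _ le ne].
have lt := below_lt oP'' oP' le ne.
by apply: IH => //; exact: leq_trans lt _.
Qed.

Lemma moebiusE P P'' : P'' \in orbit_partitions ->
  moebius P P'' =
    if ~~ refines P P'' then 0 else
    if P == P'' then 1 else
    - \sum_(P' in orbit_partitions |
        [&& refines P P', refines P' P'' & P' != P'']) moebius P P'.
Proof.
move=> oP''.
have h Q : Q \in orbit_partitions -> (#|below Q| < #|orbit_partitions|)%N.
  move=> oQ; apply: proper_card; apply/fintype.properP; split.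
    by apply/fintype.subsetP => Q'; rewrite !inE => /andP[].
  by exists Q => //; rewrite !inE eqxx !andbF.
rewrite /moebius (@moebius_rec_stable _ #|orbit_partitions|.+1) ?h //=.
exact: leqW (h _ oP'').
Qed.

End OrbitPartitions.

Local Open Scope classical_set_scope.

(* Not required to be Hausdorff. *)
HB.mixin Record isTopologicalGroup G & Topological G & monoid.Group G := {
  mulg_continuous : continuous (fun x : G * G => (x.1 * x.2)%g) ;
  invg_continuous : continuous (fun x : G => x^-1%g) ;
}.

#[short(type="topologicalGroupType")]
HB.structure Definition TopologicalGroup :=
  {G of Topological G & monoid.Group G & isTopologicalGroup G}.

Section DiscreteGroup.
Variable G : groupType.

HB.instance Definition _ := monoid.Group.copy (discrete_topology G) G.

Let mulg_cont :
  continuous (fun x : discrete_topology G * discrete_topology G =>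
    (x.1 * x.2)%g : discrete_topology G).
Proof.
move=> x; apply/discrete_cvg.
exists ([set x.1], [set x.2]) => /=; last by case=> a b /= [-> ->].
by split; exact: (@discrete_set1 (discrete_topology G)).
Qed.

Let invg_cont :
  continuous (fun x : discrete_topology G => x^-1%g : discrete_topology G).
Proof.
move=> x; apply/discrete_cvg.
have := @discrete_set1 (discrete_topology G) x.
by apply: (@filterS _ (nbhs x)) => y /= ->.
Qed.

HB.instance Definition _ :=
  isTopologicalGroup.Build (discrete_topology G) mulg_cont invg_cont.

End DiscreteGroup.

Lemma cvg_ptws (I : Type) (K T : topologicalType) (t : T)
    (f : T -> {ptws I -> K}) :
  (forall i, (fun u => f u i) @ t --> f t i) -> f @ t --> f t.
Proof.
move=> cf; apply/cvg_sup => i U [V /= [[W oW <-]]] Wft WU.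
apply: (@filterS _ (nbhs t) _ _ _ _ (cf i W _)); first by move=> u /WU.
exact: open_nbhs_nbhs.
Qed.

Lemma continuous_pair (T U V : topologicalType) (f : T -> U) (g : T -> V) t :
  {for t, continuous f} -> {for t, continuous g} ->
  {for t, continuous (fun u => (f u, g u))}.
Proof. by move=> cf cg; exact: cvg_pair. Qed.

(* The action is a phantom argument: it only enters the group law. *)
Definition wreath (H : topologicalGroupType) (gT : finGroupType) (X : finType)
    (to : {action gT &-> X}) : Type :=
  ({ptws X -> H} * discrete_topology gT)%type.

Section Wreath.
Variables (H : topologicalGroupType) (gT : finGroupType) (X : finType).
Variable to : {action gT &-> X}.

(* MathComp actions are right actions; q |-> to^~ q^-1 turns to into a left
   action, and every left action is obtained in this way.  Orbits of subgroups
   and stabilisers are the same for both. *)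
Definition left_act (q : gT) (x : X) : X := to x q^-1%g.

Lemma left_act1 x : left_act 1 x = x.
Proof. by rewrite /left_act invg1 act1. Qed.

Lemma left_actM p q x : left_act (p * q) x = left_act p (left_act q x).
Proof. by rewrite /left_act invMg actM. Qed.

Local Notation wreath := (wreath H to).

HB.instance Definition _ := Topological.copy wreath
  ({ptws X -> H} * discrete_topology gT)%type.

Definition wreath_one : wreath := (fun=> 1%g, 1%g).

Definition wreath_mul (u v : wreath) : wreath :=
  (fun x => (u.1 x * v.1 (left_act u.2^-1 x))%g, (u.2 * v.2)%g).

Definition wreath_inv (u : wreath) : wreath :=
  (fun x => (u.1 (left_act u.2 x))^-1%g, u.2^-1%g).

Let wreath_mulA : associative wreath_mul.
Proof.
move=> u v w; rewrite /wreath_mul /=; congr pair; last by rewrite mulgA.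
by apply/funext => x /=; rewrite mulgA invMg left_actM.
Qed.

Let wreath_mul1 : left_id wreath_one wreath_mul.
Proof.
move=> [b q]; rewrite /wreath_mul /=; congr pair; last by rewrite mul1g.
by apply/funext => x /=; rewrite mul1g invg1 left_act1.
Qed.

Let wreath_mulr1 : right_id wreath_one wreath_mul.
Proof.
move=> [b q]; rewrite /wreath_mul /=; congr pair; last by rewrite mulg1.
by apply/funext => x /=; rewrite mulg1.
Qed.

Let wreath_mulV : left_inverse wreath_one wreath_inv wreath_mul.
Proof.
move=> [b q]; rewrite /wreath_mul /=; congr pair; last by rewrite mulVg.
by apply/funext => x /=; rewrite invgK mulVg.
Qed.

Let wreath_mulrV : right_inverse wreath_one wreath_inv wreath_mul.
Proof.
move=> [b q]; rewrite /wreath_mul /=; congr pair; last by rewrite mulgV.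
by apply/funext => x /=; rewrite -left_actM mulgV left_act1 mulgV.
Qed.

HB.instance Definition _ := isGroup.Build wreath
  wreath_mulA wreath_mul1 wreath_mulr1 wreath_mulV wreath_mulrV.

Let snd_cont : continuous (fun u : wreath => u.2).
Proof. by move=> u; exact: (@cvg_snd _ _ (nbhs u.1) (nbhs u.2)). Qed.

Let near_snd (u : wreath) : \forall v \near u, v.2 = u.2.
Proof.
exact: (@snd_cont u [set u.2] (@discrete_set1 (discrete_topology gT) u.2)).
Qed.

Let eval_cont (x : X) : continuous (fun u : wreath => u.1 x).
Proof.
move=> u.
apply: (@continuous_comp wreath _ _ fst (fun b : {ptws X -> H} => b x)).
  exact: (@cvg_fst _ _ (nbhs u.1) (nbhs u.2)).
exact: (@proj_continuous _ (fun=> H) x u.1).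
Qed.

Let wreath_mul_cont :
  continuous (fun u : wreath * wreath => (u.1 * u.2)%g : wreath).
Proof.
have fstC : continuous (fst : wreath * wreath -> wreath).
  by case=> u v; exact: cvg_fst.
have sndC : continuous (snd : wreath * wreath -> wreath).
  by case=> u v; exact: cvg_snd.
move=> [u v].
apply: (@continuous_pair _ {ptws X -> H} (discrete_topology gT)
  (fun w : wreath * wreath => (w.1 * w.2)%g.1)
  (fun w : wreath * wreath => (w.1 * w.2)%g.2)); last first.
  apply: (@continuous_comp _ _ _ (fun w : wreath * wreath => (w.1.2, w.2.2))
    (fun q : discrete_topology gT * discrete_topology gT => (q.1 * q.2)%g)).
    apply: continuous_pair.
      by apply: (continuous_comp (fstC _)); exact: snd_cont.
    by apply: (continuous_comp (sndC _)); exact: snd_cont.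
  exact: (@mulg_continuous (discrete_topology gT) (u.2, v.2)).
apply: cvg_ptws => x /=.
have E : {near nbhs (u, v),
    (fun w : wreath * wreath => (w.1.1 x * w.2.1 (left_act u.2^-1 x))%g) =1
    (fun w : wreath * wreath => (w.1 * w.2)%g.1 x)}.
  have := fstC (u, v) _ (near_snd u).
  by apply: (@filterS _ (nbhs (u, v))) => w /= wu; rewrite /wreath_mul /= wu.
apply: (cvg_trans (near_eq_cvg E)).
pose f (w : wreath * wreath) : H * H := (w.1.1 x, w.2.1 (left_act u.2^-1 x)).
have cf : {for (u, v), continuous f}.
  apply: continuous_pair.
    exact: (continuous_comp (fstC (u, v)) (@eval_cont x u)).
  exact: (continuous_comp (sndC (u, v)) (@eval_cont (left_act u.2^-1 x) v)).
exact: (continuous_comp cf (@mulg_continuous H (f (u, v)))).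
Qed.

Let wreath_inv_cont : continuous (fun u : wreath => u^-1%g : wreath).
Proof.
move=> u.
apply: (@continuous_pair _ {ptws X -> H} (discrete_topology gT)
  (fun w : wreath => (w^-1)%g.1) (fun w : wreath => (w^-1)%g.2)); last first.
  apply: (continuous_comp (@snd_cont u)).
  exact: (@invg_continuous (discrete_topology gT) u.2).
apply: cvg_ptws => x /=.
have E : {near nbhs u,
    (fun w : wreath => (w.1 (left_act u.2 x))^-1%g) =1
    (fun w : wreath => (w^-1)%g.1 x)}.
  have := near_snd u.
  by apply: (@filterS _ (nbhs u)) => w /= wu; rewrite /wreath_inv /= wu.
apply: (cvg_trans (near_eq_cvg E)).
apply: (continuous_comp (@eval_cont (left_act u.2 x) u)).
exact: invg_continuous.
Qed.

HB.instance Definition _ :=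
  isTopologicalGroup.Build wreath wreath_mul_cont wreath_inv_cont.

End Wreath.

Section Representations.
Variables (R : realType) (G : topologicalGroupType).

(* A representation in C^n (column vectors), written in matrix form; up to
   equivalence this covers all complex vector spaces of dimension n. *)
Definition is_repr n (rho : G -> 'M[R[i]]_n) : Prop :=
  [/\ rho 1%g = 1%:M,
      (forall g h, rho (g * h)%g = rho g *m rho h) &
      continuous (fun g => rho g : 'M[R[i]^o]_n)].

Definition invariant_subspace n (rho : G -> 'M[R[i]]_n)
    (U : {vspace 'cV[R[i]]_n}) : Prop :=
  forall g u, u \in U -> rho g *m u \in U.

Definition is_irr n (rho : G -> 'M[R[i]]_n) : Prop :=
  [/\ is_repr rho, (0 < n)%N &
      forall U, invariant_subspace rho U -> U = 0%VS \/ U = fullv].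

Definition repr_equiv n (rho sigma : G -> 'M[R[i]]_n) : Prop :=
  exists2 A : 'M[R[i]]_n,
    A \in unitmx & forall g, A *m rho g = sigma g *m A.

(* repr_equiv rho, seen as a set, is the equivalence class of rho. *)
Definition irr_classes n : set (set (G -> 'M[R[i]]_n)) :=
  [set repr_equiv rho | rho in @is_irr n].

Arguments irr_classes n : clear implicits.

Definition rigid : Prop := forall n, (0 < n)%N -> finite_set (irr_classes n).

(* Meaningful only when irr_classes n is finite: fset_set sends infinite sets
   to fset0. *)
Definition irr_count n : nat := #|` fset_set (irr_classes n)|.

End Representations.

Definition zeta (R : realType) (G : topologicalGroupType) : dirichlet :=
  fun n => (irr_count R G n)%:R.

(* Main.v *)
(* Clifford theory for H^X inside H wr Q, phrased with matrix coefficients.  By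
   Schur's lemma the coefficient functions of pairwise inequivalent irreducible
   representations are linearly independent; conversely independence of the
   coefficients forces irreducibility and inequivalence.  Hence tensor products
   of irreducible representations of H are irreducible on H^X, and for a map
   kappa from X to the irreducible representations of H and an irreducible
   representation sigma of its stabiliser Q_kappa, the representation induced
   from (tensor product of the kappa x) * sigma is irreducible, of degree
   [Q : Q_kappa] (prod_x deg (kappa x)) (deg sigma).  Every irreducible
   representation of the wreath product is of this form, uniquely up to the
   action of Q on kappa.  Since Q_kappa is the stability subgroup Q_P of the
   partition P of X into Q_kappa-orbits, the zeta function is the sum over all
   kappa of [Q : Q_P]^(-1-s) zeta(Q_P, s) prod_x deg (kappa x)^(-s), and Moebius
   inversion isolates the maps kappa whose partition is exactly P from those that
   are constant on the blocks of P. *)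
Require Import Defs.
From HB Require Import structures.
From mathcomp Require Import all_boot all_order all_fingroup all_algebra.
From mathcomp Require Import finmap complex.
From mathcomp Require Import all_classical all_reals.
From mathcomp Require Import topology normedtype.

Set Implicit Arguments.
Unset Strict Implicit.
Unset Printing Implicit Defensive.

Import Order.TTheory GRing.Theory Num.Theory.

Local Open Scope ring_scope.

(** * Linear algebra and irreducible matrix representations *)

(** Nothing is assumed of [H] beyond being a topological group: there is no invariant measure and no
    complete reducibility to rely on. This is why irreducibility is a statement about coefficients
    and equivalence is detected by nonzero intertwiners. [H] may also have infinitely many
    irreducible representations, so the zeta functions are never handled whole. For each bound n, a
    finite list covers the degrees up to n; it suffices for the wreath product in those degrees
    because passing to a subgroup and to an invariant subspace never raises the degree. The identity
    is then checked in a truncation of the ring of Dirichlet series. The orbits of Q on the maps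
    kappa become a sum over all maps by dividing by the orbit size [Q : Q_P]: this is the -1 in the
    exponent -1-s, while -s comes from the degree of the induced representation. The step requires
    contributions that are constant along an orbit, where the stability subgroups are conjugate but
    not equal. *)

Section LinearAlgebra.
Variable F : fieldType.

(** A sample of maximal rank spans, since the rank is bounded by [n] and one more value cannot raise
    it. Questions about functions on an arbitrary group thereby become questions about finite
    matrices. *)
Lemma spanning_values (T : Type) n (f : T -> 'rV[F]_n) :
  exists k, exists h : 'I_k -> T,
    forall t, (f t <= \matrix_(i < k) f (h i))%MS.
Proof.
pose P (r : nat) := `[< exists k, exists h : 'I_k -> T,
  \rank (\matrix_(i < k) f (h i)) = r >].
have exP : exists r, P r.
  exists (\rank (\matrix_(i < 0) (0 : 'rV[F]_n))); apply/asboolP.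
  exists 0, (fun i : 'I_0 => let: Ordinal _ p := i in False_rect T (notF p)).
  by congr (\rank _); apply/matrixP => -[].
have bdP r : P r -> (r <= n)%N.
  by move=> /asboolP [k [h <-]]; exact: rank_leq_col.
case: (ex_maxnP exP bdP) => r /asboolP [k [h hr]] maxr.
exists k, h => t; set M := \matrix_i _ in hr *.
pose h' (i : 'I_(1 + k)) := if fintype.split i is inr j then h j else t.
have E : \matrix_i f (h' i) = col_mx (f t) M.
  apply/matrixP => i j; rewrite mxE /h' [RHS]mxE.
  by case: splitP => l _; rewrite ?ord1 ?mxE.
have leM : (M <= col_mx (f t) M)%MS by rewrite -addsmxE addsmxSr.
have /leqifP := mxrank_leqif_sup leM.
case: ifP => [le _|_]; last first.
  rewrite hr ltnNge maxr //; apply/asboolP.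
  by exists (1 + k)%N, h'; rewrite E.
by move: le; rewrite -addsmxE addsmx_sub => /andP[].
Qed.

Definition independent (A : finType) (T : Type) (f : A -> T -> F) : Prop :=
  forall c : A -> F, (forall t, \sum_a c a * f a t = 0) -> forall a, c a = 0.

(** On a spanning sample, a relation between the columns would be a relation between the functions;
    hence the sample matrix has a left inverse, whose rows are the dual functionals. *)
Lemma dual_functionals (A : finType) (T : Type) (f : A -> T -> F) :
  independent f ->
  exists k, exists h : 'I_k -> T, exists e : A -> 'I_k -> F,
    forall a b, \sum_i e a i * f b (h i) = (a == b)%:R.
Proof.
move=> indf.
pose v t := \row_(a < #|A|) f (enum_val a) t.
have [k [h hP]] := spanning_values v.
set M := \matrix_i _ in hP.
have : row_full M.
  rewrite -cokermx_eq0; apply/eqP/matrixP => i j; rewrite [RHS]mxE.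
  have := indf (fun a => cokermx M (enum_rank a) j) _ (enum_val i).
  rewrite enum_valK; apply => t.
  have : v t *m cokermx M = 0.
    by have /submxP[D ->] := hP t; rewrite -mulmxA mulmx_coker mulmx0.
  move/matrixP => /(_ 0 j); rewrite !mxE => E; rewrite -[RHS]E {E}.
  rewrite (reindex (@enum_rank A)) /=; last exact/onW_bij/enum_rank_bij.
  by apply: eq_bigr => a _; rewrite !mxE enum_rankK mulrC.
case/row_fullP => B BM.
exists k, h, (fun a i => B (enum_rank a) i) => a b.
have := congr1 (fun Z : 'M_#|A| => Z (enum_rank a) (enum_rank b)) BM.
rewrite !mxE (inj_eq enum_rank_inj) => <-.
by apply: eq_bigr => i _; rewrite !mxE enum_rankK.
Qed.

(** A subspace inside [P] of largest dimension absorbs every vector of [P]. *)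
Lemma subspace_vspace (vT : vectType F) (P : vT -> Prop) :
  P 0 -> (forall a u v, P u -> P v -> P (a *: u + v)) ->
  exists U : {vspace vT}, forall v, v \in U <-> P v.
Proof.
move=> P0 PD.
pose Q (r : nat) := `[< exists2 U : {vspace vT}, \dim U = r & forall v, v \in U -> P v >].
have exQ : exists r, Q r.
  exists 0%N; apply/asboolP; exists 0%VS; first by rewrite dimv0.
  by move=> v; rewrite memv0 => /eqP ->.
have bdQ r : Q r -> (r <= \dim (@fullv F vT))%N.
  by move=> /asboolP [U <- _]; exact: dimvS (subvf U).
case: (ex_maxnP exQ bdQ) => r /asboolP [U dU UP] maxr.
exists U => v; split=> [|Pv]; first exact: UP.
have QUv : Q (\dim (<[v]> + U)%VS).
  apply/asboolP; eexists; first by [].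
  move=> w /memv_addP[w1 /vlineP[a ->] [w2 w2U ->]].
  by apply: PD => //; exact: UP.
have /eqP eUv : (U == <[v]> + U)%VS.
  by rewrite eqEdim addvSr /= dU maxr.
by rewrite eUv; apply: (subvP (addvSl _ _)); exact: memv_line.
Qed.

End LinearAlgebra.

Section MatrixRepresentations.
Variables (F : fieldType) (G : groupType).

Definition mxhom n (rho : G -> 'M[F]_n) : Prop :=
  rho 1%g = 1%:M /\ forall g h, rho (g * h)%g = rho g *m rho h.

(* The bilinear form of irreducibility: no nonzero row vector vanishes on the
   invariant subspace generated by a nonzero column vector. *)
Definition mxirr n (rho : G -> 'M[F]_n) : Prop :=
  [/\ mxhom rho, (0 < n)%N &
      forall (r : 'rV_n) (v : 'cV_n),
        (forall g, r *m rho g *m v = 0) -> r = 0 \/ v = 0].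

Definition intertwines n m (rho : G -> 'M[F]_n) (sigma : G -> 'M[F]_m)
    (T : 'M[F]_(n, m)) : Prop := forall g, rho g *m T = T *m sigma g.

(** A pair [r], [v] with vanishing form gives the invariant subspace of all vectors killed by every
    [r *m rho g]. Conversely, a proper nonzero invariant subspace gives such a pair: a linear form
    vanishing on it and a vector inside it. *)
Lemma mxirrP n (rho : G -> 'M[F]_n) :
  mxirr rho <-> [/\ mxhom rho, (0 < n)%N &
    forall U : {vspace 'cV[F]_n},
      (forall g u, u \in U -> rho g *m u \in U) -> U = 0%VS \/ U = fullv].
Proof.
split=> -[hom n_gt0 irr]; split=> //; last first.
  move=> r v rv0.
  have [||U UP] := @subspace_vspace F 'cV[F]_n (fun w => forall g, r *m rho g *m w = 0).
  - by move=> g; rewrite mulmx0.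
  - by move=> a u w hu hw g; rewrite mulmxDr -scalemxAr hu hw scaler0 addr0.
  case: (irr U) => [g u /UP uU|U0|Uf].
  - by apply/UP => h; rewrite mulmxA -(mulmxA r) -hom.2.
  - by right; apply/eqP; rewrite -memv0 -U0; apply/UP.
  left; apply/matrixP => i j.
  have /UP /(_ 1%g) : delta_mx j 0 \in U by rewrite Uf memvf.
  rewrite hom.1 mulmx1 => /matrixP/(_ 0 0); rewrite -colE ord1 !mxE => ->; by [].
move=> U invU.
have [->|nzU] := eqVneq U 0%VS; first by left.
right; apply/eqP; rewrite eqEsubv subvf /=; apply/subvP => w _.
apply/negPn/negP => wU.
(* [f] vanishes exactly on [U]; a coordinate of it that is nonzero at [w] becomes [r]. *)
pose f : 'End('cV[F]_n) := (\1 - projv U)%VF.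
have fE v : f v = v - projv U v by rewrite add_lfunE id_lfunE opp_lfunE.
have fU v : v \in U -> f v = 0 by move=> vU; rewrite fE projv_id ?subrr.
have /cV0Pn [i fwi] : f w != 0.
  by apply: contra wU; rewrite fE subr_eq0 => /eqP ->; exact: memv_proj.
pose r := \row_k f (delta_mx k 0) i 0.
have rE v : r *m v = (f v i 0)%:M.
  apply/matrixP => a b; rewrite !ord1 !mxE eqxx mulr1n.
  have vE : v = \sum_k v k 0 *: delta_mx k 0.
    rewrite {1}(matrix_sum_delta v); apply: eq_bigr => k _.
    by rewrite big_ord1.
  rewrite {2}vE linear_sum summxE; apply: eq_bigr => k _.
  by rewrite linearZ !mxE mulrC.
case: (irr r (vpick U)) => [g|r0|u0].
- by rewrite -mulmxA rE fU ?invU ?memv_pick // [X in X%:M]mxE raddf0.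
- have := rE w; rewrite r0 mul0mx => /matrixP/(_ 0 0) /esym/eqP.
  by rewrite !mxE mulr1n (negPf fwi).
- by move: nzU; rewrite -vpick0 u0 eqxx.
Qed.

End MatrixRepresentations.

(** * Schur's lemma and linear independence of coefficients *)

Section Schur.
Variables (C : numClosedFieldType) (G : groupType).
Implicit Types n m : nat.

(** For a nonzero row [D *m T], moving [sigma g] across [T] turns its form against [v] into
    [D *m rho g *m T *m v], which vanishes. *)
Lemma intertwiner_ker_cV n m (rho : G -> 'M[C]_n) (sigma : G -> 'M[C]_m) T (v : 'cV_m) :
  mxirr sigma -> intertwines rho sigma T -> T != 0 -> T *m v = 0 -> v = 0.
Proof.
move=> [_ _ irr] hT T0 Tv0.
have /rowV0Pn [_ /submxP [D ->] DT0] := T0.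
case: (irr (D *m T) v) => // [g|DT]; last by rewrite DT eqxx in DT0.
by rewrite -(mulmxA D) -hT -!mulmxA Tv0 !mulmx0.
Qed.

Lemma intertwiner_ker_rV n m (rho : G -> 'M[C]_n) (sigma : G -> 'M[C]_m) T (r : 'rV_n) :
  mxirr rho -> intertwines rho sigma T -> T != 0 -> r *m T = 0 -> r = 0.
Proof.
move=> [_ _ irr] hT /matrix0Pn [i [j Tij]] rT0.
case: (irr r (T *m delta_mx j 0)) => // [g|/matrixP/(_ i 0)/eqP].
  by rewrite mulmxA -(mulmxA r) hT !mulmxA rT0 !mul0mx.
by rewrite -colE !mxE (negPf Tij).
Qed.

Lemma intertwiner_row_free n m (rho : G -> 'M[C]_n) (sigma : G -> 'M[C]_m) T :
  mxirr rho -> intertwines rho sigma T -> T != 0 -> row_free T.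
Proof.
by move=> ir hT T0; apply: inj_row_free => v; exact: intertwiner_ker_rV ir hT T0.
Qed.

Lemma intertwiner_dim n m (rho : G -> 'M[C]_n) (sigma : G -> 'M[C]_m) T :
  mxirr rho -> mxirr sigma -> intertwines rho sigma T -> T != 0 -> n = m.
Proof.
move=> ir ir2 hT T0; apply/eqP; rewrite eqn_leq.
have fT := intertwiner_row_free ir hT T0.
rewrite -{1}(eqP fT) rank_leq_col /=.
suff fT' : row_free T^T by rewrite -(eqP fT') rank_leq_col.
apply: inj_row_free => v vT0.
have : v^T = 0.
  by apply: intertwiner_ker_cV ir2 hT T0 _; apply: trmx_inj; rewrite trmx_mul trmxK vT0 trmx0.
by move/(congr1 trmx); rewrite trmxK trmx0.
Qed.

Lemma intertwiner_unit n (rho sigma : G -> 'M[C]_n) T :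
  mxirr rho -> intertwines rho sigma T -> T != 0 -> T \in unitmx.
Proof. by move=> ir hT T0; rewrite -row_free_unit (intertwiner_row_free ir hT). Qed.

Lemma schur_scalar n (rho : G -> 'M[C]_n) T :
  mxirr rho -> intertwines rho rho T -> exists c, T = c%:M.
Proof.
move=> ir hT; case: (ir) => _ n_gt0 _.
have [c /eigenvalueP [v vT v0]] := eigenvalue_closed T n_gt0.
exists c; apply/eqP; rewrite -subr_eq0; apply: contraNT v0 => Tc0.
apply/eqP; apply: intertwiner_ker_rV ir _ Tc0 _.
  by move=> g; rewrite mulmxBr mulmxBl hT scalar_mxC.
by rewrite mulmxBr vT mul_mx_scalar subrr.
Qed.

Section FrobeniusSchur.
Variables (J : finType) (d : J -> nat) (pi : forall j, G -> 'M[C]_(d j)).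
Hypothesis irr_pi : forall j, mxirr (pi j).
Hypothesis pi_inequiv : forall j j' (T : 'M_(d j, d j')),
  intertwines (pi j) (pi j') T -> T != 0 -> j = j'.

Let N (A : forall j, 'M[C]_(d j)) : Prop :=
  forall g, \sum_j \tr (A j *m pi j g) = 0.

(* A relation with the fewest nonzero rows: by minimality every row is obtained
   from a fixed nonzero row by an intertwiner, hence is a multiple of it by
   Schur's lemma. *)
Theorem frobenius_schur (A : forall j, 'M[C]_(d j)) :
  (forall g, \sum_j \tr (A j *m pi j g) = 0) -> forall j, A j = 0.
Proof.
move=> NA j; apply/eqP/negPn/negP => Aj0.
pose row_at (B : forall j, 'M[C]_(d j)) (p : {j & 'I_(d j)}) :=
  row (tagged p) (B (tag p)).
pose supp B := [pred p | row_at B p != 0].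
pose P (r : nat) := `[< exists2 B : forall j, 'M[C]_(d j),
   N B /\ (exists j, B j != 0) & #|supp B| = r >].
have exP : exists r, P r.
  by exists #|supp A|; apply/asboolP; exists A => //; split => //; exists j.
case: (ex_minnP exP) => r /asboolP [{NA Aj0 j}B [NB [j Bj0]] Br] minr.
(* Minimality in usable form: a relation supported on the rows of [B] that misses one of them is
   zero. *)
have minB D p : N D -> (forall p, row_at B p = 0 -> row_at D p = 0) ->
    row_at B p != 0 -> row_at D p = 0 -> forall i, D i = 0.
  move=> ND sDB Bp Dp i; apply/eqP/negPn/negP => Di0.
  have : (r <= #|supp D|)%N by apply: minr; apply/asboolP; exists D; split=> //; exists i.
  rewrite -Br leqNgt => /negP; apply; apply: proper_card.
  apply/fintype.properP; split; last by exists p; rewrite !inE ?Bp ?Dp ?eqxx.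
  apply/fintype.subsetP => q; rewrite !inE; apply: contra => /eqP Bq.
  by rewrite sDB.
have [l Bjl] : exists l : 'I_(d j), row l (B j) != 0.
  apply/existsP; rewrite -negb_forall; apply: contra Bj0 => /forallP h.
  by apply/eqP/row_matrixP => l; rewrite row0; apply/eqP.
pose p0 : {j & 'I_(d j)} := Tagged (fun j => 'I_(d j)) l.
pose r0 := row l (B j).
have [k [h hP]] := spanning_values (fun g => r0 *m pi j g).
set M := \matrix_i _ in hP.
pose c g := r0 *m pi j g *m pinvmx M.
have cM g : c g *m M = r0 *m pi j g by rewrite mulmxKpV.
(* The coefficients that expand the translate of [r0] work for every other row as well: the
   difference is a relation whose row at [p0] vanishes. *)
have BE g i : B i *m pi i g = \sum_a c g 0 a *: (B i *m pi i (h a)).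
  pose D i := B i *m pi i g - \sum_a c g 0 a *: (B i *m pi i (h a)).
  suff /(_ i)/eqP : forall i, D i = 0 by rewrite subr_eq0 => /eqP.
  have rD p : row_at D p = row_at B p *m pi (tag p) g -
      \sum_a c g 0 a *: (row_at B p *m pi (tag p) (h a)).
    rewrite /row_at linearB linear_sum /= row_mul; congr (_ - _).
    by apply: eq_bigr => a _; rewrite linearZ /= row_mul.
  apply: (minB D p0) => //.
  - move=> g'.
    transitivity (\sum_j \tr (B j *m pi j (g * g')%g) -
       \sum_a c g 0 a * \sum_j \tr (B j *m pi j (h a * g')%g)); last first.
      by rewrite NB sub0r big1 ?oppr0 // => a _; rewrite NB mulr0.
    under [X in _ - X]eq_bigr do rewrite mulr_sumr.
    rewrite exchange_big -sumrB; apply: eq_bigr => i' _.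
    have [[_ piM] _ _] := irr_pi i'.
    rewrite /D mulmxBl raddfB /= piM mulmxA; congr (_ - _).
    rewrite mulmx_suml raddf_sum; apply: eq_bigr => a _.
    by rewrite -scalemxAl /= mxtraceZ piM mulmxA.
  - move=> p Bp; rewrite rD Bp !mul0mx big1 ?subr0 // => a _.
    by rewrite mul0mx scaler0.
  - rewrite rD -[row_at B p0]/r0 /= -(cM g) mulmx_sum_row.
    apply/eqP; rewrite subr_eq0; apply/eqP; apply: eq_bigr => a _.
    by rewrite rowK.
(* By [BE], this linear map carries each translate of [r0] to the corresponding translate of row [m]
   of [B i]. *)
pose T i (m : 'I_(d i)) : 'M_(d j, d i) := pinvmx M *m \matrix_(a < k) (row m (B i) *m pi i (h a)).
have BT i (m : 'I_(d i)) g : row m (B i) *m pi i g = r0 *m pi j g *m T i m.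
  rewrite -row_mul BE linear_sum mulmxA -/(c g) mulmx_sum_row /=.
  by apply: eq_bigr => a _; rewrite rowK linearZ /= row_mul.
clearbody T.
have hT i (m : 'I_(d i)) : intertwines (pi j) (pi i) (T i m).
  move=> g; apply/eqP; rewrite -subr_eq0; apply/eqP.
  have [[_ piM] _ irr] := irr_pi j; have [[_ piM'] _ _] := irr_pi i.
  set E := (X in X = 0).
  suff colE0 b : col b E = 0.
    by apply/matrixP => a b; have /matrixP/(_ a 0) := colE0 b; rewrite !mxE.
  case: (irr r0 (col b E)) => // [g'|r00]; last by rewrite -/r0 r00 eqxx in Bjl.
  rewrite colE mulmxA; suff -> : r0 *m pi j g' *m E = 0 by rewrite mul0mx.
  by rewrite /E mulmxBr !mulmxA -(mulmxA r0) -piM -!BT piM' mulmxA subrr.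
have B0 i : i != j -> B i = 0.
  move=> ij; apply/row_matrixP => m; have [[pi1 _] _ _] := irr_pi i.
  rewrite row0 -[row m _]mulmx1 -pi1 BT.
  have [->|/(pi_inequiv (hT i m)) ji] := eqVneq (T i m) 0; first by rewrite mulmx0.
  by rewrite ji eqxx in ij.
have /boolp.choice [a aP] : forall m : 'I_(d j), exists a, T j m = a%:M.
  by move=> m; apply: schur_scalar (irr_pi j) (hT j m).
have [[pi1 _] _ irr] := irr_pi j.
(* All rows are multiples of [r0], so the relation reduces to a vanishing form between [r0] and the
   column of multipliers [a]. *)
have BjE : B j = (\col_m a m) *m r0.
  apply/row_matrixP => m; rewrite -[row m _]mulmx1 -pi1 BT pi1 mulmx1 aP.
  by rewrite mul_mx_scalar row_mul; apply/rowP => b; rewrite !mxE big_ord1 !mxE.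
case: (irr r0 (\col_m a m)) => [g|r00|a0].
- have := NB g; rewrite (bigD1 j) //= big1 ?addr0; last first.
    by move=> i ij; rewrite B0 // mul0mx mxtrace0.
  rewrite BjE -(mulmxA (\col_m a m)) mxtrace_mulC => tr0.
  by apply/matrixP => x y; rewrite !ord1 [RHS]mxE -[RHS]tr0 /mxtrace big_ord1.
- by move: Bjl; rewrite -/r0 r00 eqxx.
- by rewrite BjE a0 mul0mx eqxx in Bj0.
Qed.

End FrobeniusSchur.
End Schur.

Section IndependentCoefficients.
Variables (C : numClosedFieldType) (G : groupType).

Lemma untag_Tagged (I : eqType) (T_ : I -> Type) (A : Type) (idx : A) i
    (f : T_ i -> A) (x : T_ i) : untag idx f (Tagged T_ x) = f x.
Proof. by rewrite (untagE _ _ (erefl i : tag (Tagged T_ x) = i)). Qed.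

Definition jointly_independent (J : finType) (T : J -> finType)
    (M : forall j, G -> T j -> T j -> C) : Prop :=
  forall c : forall j, T j -> T j -> C,
    (forall g, \sum_j \sum_a \sum_b c j a b * M j g a b = 0) ->
    forall j a b, c j a b = 0.

Lemma jointly_independent_mx (J : finType) (d : J -> nat)
    (pi : forall j, G -> 'M[C]_(d j)) :
  (forall j, mxirr (pi j)) ->
  (forall j j' (T : 'M_(d j, d j')),
     intertwines (pi j) (pi j') T -> T != 0 -> j = j') ->
  jointly_independent (T := fun j => 'I_(d j)) (fun j g a b => pi j g a b).
Proof.
move=> irr ineq c hc j a b.
have /matrixP/(_ b a) : \matrix_(b < d j, a < d j) c j a b = 0.
  apply: (frobenius_schur irr ineq (A := fun j => \matrix_(b < d j, a < d j) c j a b)).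
  move=> g; rewrite -[RHS](hc g); apply: eq_bigr => i _.
  rewrite /mxtrace exchange_big; apply: eq_bigr => x _.
  by rewrite mxE; apply: eq_bigr => y _; rewrite !mxE.
by rewrite !mxE.
Qed.

(** Bases below are indexed by structured finite types; renumbering turns their coefficients into
    matrices as [mxhom] and [mxirr] expect. *)
Definition mxof (T : finType) (M : G -> T -> T -> C) (g : G) : 'M[C]_#|T| :=
  \matrix_(a, b) M g (enum_val a) (enum_val b).

Lemma mxof_hom (T : finType) (M : G -> T -> T -> C) :
  (forall a b, M 1%g a b = (a == b)%:R) ->
  (forall g h a b, M (g * h)%g a b = \sum_c M g a c * M h c b) ->
  mxhom (mxof M).
Proof.
move=> M1 MM; split=> [|g h]; apply/matrixP => a b; rewrite !mxE.
  by rewrite M1 (inj_eq enum_val_inj).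
rewrite MM (reindex (@enum_val T T)) /=; last exact/onW_bij/enum_val_bij.
by apply: eq_bigr => c _; rewrite !mxE.
Qed.

Section Family.
Variables (J : finType) (T : J -> finType) (M : forall j, G -> T j -> T j -> C).
Hypothesis indM : jointly_independent M.

(** A coefficient table at [j] seen as a family over all indices, zero elsewhere; [untag] compares
    indices without a cast. *)
Let at_index j (f : T j -> T j -> C) (i : J) (a b : T i) : C :=
  untag 0 (fun p : T j * T j => f p.1 p.2)
    (Tagged (fun i => (T i * T i)%type) (a, b)).

Let at_indexE j f a b : @at_index j f j a b = f a b.
Proof. exact: (untag_Tagged (T_ := fun i => (T i * T i)%type)). Qed.

Let at_index0 j f i a b : i != j -> @at_index j f i a b = 0.
Proof. by move=> ij; rewrite /at_index untag_dflt. Qed.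

Let at_index_sum j f g : \sum_i \sum_a \sum_b @at_index j f i a b * M g a b =
  \sum_a \sum_b f a b * M g a b.
Proof.
rewrite (bigD1 j) //= [X in _ + X]big1 ?addr0; last first.
  move=> i ij; rewrite big1 // => a _; rewrite big1 // => b _.
  by rewrite at_index0 ?mul0r.
by apply: eq_bigr => a _; apply: eq_bigr => b _; rewrite at_indexE.
Qed.

(** A vanishing form between [r] and [v] is a relation with the products [r 0 a * v b 0] as
    coefficients, so all these products are zero. *)
Lemma jointly_independent_irr j :
  mxhom (mxof (@M j)) -> (0 < #|T j|)%N -> mxirr (mxof (@M j)).
Proof.
move=> hom gt0; split=> // r v rv0.
have rv a b : r 0 a * v b 0 = 0.
  pose f (x y : T j) := r 0 (enum_rank x) * v (enum_rank y) 0.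
  rewrite -[LHS](_ : at_index f (enum_val a) (enum_val b) = _); last first.
    by rewrite at_indexE /f !enum_valK.
  apply: indM => g; rewrite at_index_sum.
  have := rv0 g; move/matrixP/(_ 0 0); rewrite [RHS]mxE => E; rewrite -[RHS]E {E}.
  rewrite mxE exchange_big /=.
  rewrite [RHS](reindex (@enum_rank (T j))) /=; last exact/onW_bij/enum_rank_bij.
  apply: eq_bigr => y _; rewrite mxE mulr_suml.
  rewrite [RHS](reindex (@enum_rank (T j))) /=; last exact/onW_bij/enum_rank_bij.
  by apply: eq_bigr => x _; rewrite !mxE !enum_rankK /f mulrAC.
have [->|/rV0Pn [a ra]] := eqVneq r 0; first by left.
right; apply/matrixP => b z; rewrite ord1 mxE.
by apply/eqP; have /eqP := rv a b; rewrite mulf_eq0 (negPf ra).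
Qed.

(** An entry of the intertwining identity relates a row of coefficients at [j] to a column at [j'].
    For distinct indices they cannot cancel, yet position [(c0, c0)] at [j] carries the nonzero
    entry [X c0 b0]. *)
Lemma jointly_independent_inequiv j j' (X : 'M_(#|T j|, #|T j'|)) :
  intertwines (mxof (@M j)) (mxof (@M j')) X -> X != 0 -> j = j'.
Proof.
move=> hX /matrix0Pn [c0 [b0 Xcb]]; apply/eqP/negPn/negP => jj'.
pose f (x y : T j) := (x == enum_val c0)%:R * X (enum_rank y) b0.
pose f' (x y : T j') := (y == enum_val b0)%:R * X c0 (enum_rank x).
have : at_index f (enum_val c0) (enum_val c0) -
       at_index f' (enum_val c0) (enum_val c0) = 0.
  apply: (indM (c := fun i a b => at_index f a b - at_index f' a b)) => g.
  transitivity (\sum_a \sum_b f a b * M g a b - \sum_a \sum_b f' a b * M g a b).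
    rewrite -!at_index_sum -sumrB; apply: eq_bigr => i _.
    rewrite -sumrB; apply: eq_bigr => a _; rewrite -sumrB; apply: eq_bigr => b _.
    by rewrite mulrBl.
  have /matrixP/(_ c0 b0)/eqP := hX g; rewrite -subr_eq0 => /eqP E.
  rewrite -[RHS]E !mxE; congr (_ - _).
    rewrite (bigD1 (enum_val c0)) //= [X in _ + X]big1 ?addr0; last first.
      move=> x xc; rewrite big1 // => y _.
      by rewrite /f (negPf xc) !mul0r.
    rewrite [RHS](reindex (@enum_rank (T j))) /=; last exact/onW_bij/enum_rank_bij.
    by apply: eq_bigr => y _; rewrite /f eqxx mul1r mxE enum_rankK mulrC.
  rewrite exchange_big /= (bigD1 (enum_val b0)) //= [X in _ + X]big1 ?addr0; last first.
    move=> x xc; rewrite big1 // => y _.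
    by rewrite /f' (negPf xc) !mul0r.
  rewrite [RHS](reindex (@enum_rank (T j'))) /=; last exact/onW_bij/enum_rank_bij.
  by apply: eq_bigr => y _; rewrite /f' eqxx mul1r mxE enum_rankK.
rewrite at_indexE at_index0 // subr0 /f eqxx mul1r enum_valK => /eqP.
by rewrite (negPf Xcb).
Qed.

End Family.
End IndependentCoefficients.

Section Subrepresentation.
Variables (C : numClosedFieldType) (G : groupType) (V : vectType C).
Variable act : G -> V -> V.
Hypothesis act1 : forall v, act 1%g v = v.
Hypothesis actM : forall g h v, act (g * h)%g v = act g (act h v).
Hypothesis actL : forall g a u v, act g (a *: u + v) = a *: act g u + act g v.

Let act0 g : act g 0 = 0.
Proof. by have := actL g 1 0 0; rewrite !scale1r addr0 -[LHS]addr0 => /addrI/esym. Qed.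

Let act_sum g n (c : 'I_n -> C) (b : 'I_n -> V) :
  act g (\sum_i c i *: b i) = \sum_i c i *: act g (b i).
Proof.
elim/big_rec2: _ => [|i y1 y2 _ <-]; first exact: act0.
exact: actL.
Qed.

(** An invariant subspace of least positive dimension works: a row and a vector with vanishing form
    cut out an invariant subspace of it, which is zero or everything. Any [vectType] is allowed so
    as to cover spaces of homomorphisms. The last clause makes the entries of [sigma] linear
    functionals of the action, which is how continuity is inherited. *)
Lemma irreducible_subspace (W : {vspace V}) :
  W != 0%VS -> (forall g v, v \in W -> act g v \in W) ->
  exists m (sigma : G -> 'M[C]_m) (S : m.-tuple V),
    [/\ mxirr sigma, free S, forall i : 'I_m, S`_i \in W,
        forall g (j : 'I_m), act g S`_j = \sum_(i < m) sigma g i j *: S`_i &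
        forall g (i j : 'I_m), sigma g i j = coord S i (act g S`_j)].
Proof.
move=> W0 invW.
pose P (r : nat) := `[< exists U : {vspace V}, [/\ (U <= W)%VS, U != 0%VS,
  forall g v, v \in U -> act g v \in U & \dim U = r] >].
have exP : exists r, P r by exists (\dim W); apply/asboolP; exists W.
case: (ex_minnP exP) => r /asboolP [U [UW U0 invU dU]] minr.
have minU (U' : {vspace V}) : (U' <= U)%VS ->
    (forall g v, v \in U' -> act g v \in U') -> U' != 0%VS -> U' = U.
  move=> U'U inv' U'0; apply/eqP; rewrite eqEdim U'U dU minr //.
  by apply/asboolP; exists U'; split=> //; exact: subv_trans U'U UW.
set m := \dim U; pose S := vbasis U.
have freeS : free S := basis_free (vbasisP U).
have SU (i : 'I_m) : S`_i \in U.
  by apply: vbasis_mem; apply: mem_nth; rewrite size_tuple.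
pose sigma g := \matrix_(i < m, j < m) coord S i (act g S`_j).
have actS g (j : 'I_m) : act g S`_j = \sum_(i < m) sigma g i j *: S`_i.
  rewrite {1}(coord_vbasis (invU g _ (SU j))).
  by apply: eq_bigr => i _; rewrite mxE.
have actc g (c : 'cV_m) : act g (\sum_j c j 0 *: S`_j) =
    \sum_i (sigma g *m c) i 0 *: S`_i.
  rewrite act_sum; under eq_bigr do rewrite actS scaler_sumr.
  rewrite exchange_big; apply: eq_bigr => i _.
  rewrite mxE scaler_suml; apply: eq_bigr => j _.
  by rewrite scalerA mulrC.
have m_gt0 : (0 < m)%N by rewrite lt0n dimv_eq0.
exists m, sigma, S; split=> //; last by move=> g i j; rewrite mxE.
  split=> //.
    split=> [|g h]; apply/matrixP => i j.
      by rewrite !mxE act1 coord_free // eq_sym.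
    rewrite !mxE actM actS.
    transitivity (coord S i (act g (\sum_k (col j (sigma h)) k 0 *: S`_k))).
      by congr (coord S i (act g _)); apply: eq_bigr => k _; rewrite [in RHS]mxE.
    rewrite actc coord_sum_free // mxE.
    by apply: eq_bigr => k _; rewrite [col _ _ _ _]mxE.
  move=> rr v rv0.
  pose phi u := \sum_i rr 0 i * coord S i u.
  have phiL a u w : phi (a *: u + w) = a * phi u + phi w.
    rewrite /phi mulr_sumr -big_split; apply: eq_bigr => i _ /=.
    by rewrite linearP /= mulrDr mulrCA.
  have [||U' U'P] := @subspace_vspace C V (fun u => u \in U /\ forall g, phi (act g u) = 0).
  - by split=> [|g]; rewrite ?mem0v // act0 /phi big1 // => i _; rewrite linear0 mulr0.
  - move=> a u w [uU hu] [wU hw]; split=> [|g]; first by rewrite memvD ?memvZ.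
    by rewrite actL phiL hu hw mulr0 addr0.
  have invU' g u : u \in U' -> act g u \in U'.
    by move=> /U'P [uU hu]; apply/U'P; split=> [|h]; rewrite ?invU // -actM.
  have U'U : (U' <= U)%VS by apply/subvP => u /U'P [].
  pose w := \sum_j v j 0 *: S`_j.
  have wU' : w \in U'.
    apply/U'P; split=> [|g].
      by apply: rpred_sum => i _; rewrite rpredZ.
    rewrite actc; have := rv0 g; rewrite -mulmxA => /matrixP/(_ 0 0).
    rewrite !mxE => E; rewrite -[RHS]E; apply: eq_bigr => i _.
    by rewrite coord_sum_free.
  have [U'0|U'n0] := eqVneq U' 0%VS; [right|left].
    move: wU'; rewrite U'0 memv0 => /eqP w0.
    apply/matrixP => i z; rewrite ord1 mxE.
    by rewrite -[LHS](coord_sum_free (fun j => v j 0) i freeS) -/w w0 linear0.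
  apply/rowP => i; rewrite mxE.
  have /U'P [_ /(_ 1%g)] : S`_i \in U' by rewrite (minU U').
  rewrite act1 /phi (bigD1 i) //= coord_free // eqxx mulr1 big1 ?addr0 // => k ki.
  by rewrite coord_free // eq_sym (negPf ki) mulr0.
by move=> i; apply: (subvP UW).
Qed.

End Subrepresentation.

(** * Tensor products on powers of a group *)

Lemma sum_Tagged (V : nmodType) (I : finType) (T : I -> finType)
    (f : {i & T i} -> V) : \sum_p f p = \sum_i \sum_(x : T i) f (Tagged T x).
Proof.
rewrite (sig_big_dep predT (fun=> predT) (fun i (x : T i) => f (Tagged T x))) /=.
by apply: eq_bigr => -[].
Qed.

Section BlockDiagonal.
Variables (C : numClosedFieldType) (H : groupType).
Variables (K : finType) (d : K -> nat) (r : forall k, H -> 'M[C]_(d k)).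

(** The direct sum of all [r k], the tag of an index naming its block. Its tensor power over [X]
    contains the tensor products for all [kappa] at once, on one index type independent of
    [kappa]. *)
Definition blockfun (h : H) (s s' : {k & 'I_(d k)}) : C :=
  if tag s == tag s' then r (tag s) h (tagged s) (tagged_as s s') else 0.

Hypothesis irr_r : forall k, mxirr (@r k).

Lemma blockfun0 h s s' : tag s != tag s' -> blockfun h s s' = 0.
Proof. by rewrite /blockfun => /negPf ->. Qed.

Lemma blockfunE h k (i j : 'I_(d k)) :
  blockfun h (Tagged (fun k => 'I_(d k)) i) (Tagged (fun k => 'I_(d k)) j) = r k h i j.
Proof. by rewrite /blockfun /= eqxx tagged_asE. Qed.

Lemma blockfun1 s s' : blockfun 1%g s s' = (s == s')%:R.
Proof.
case: s s' => [k i] [k' j]; rewrite -tag_eqE /tag_eq /= /blockfun /=.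
case: eqP => // kk'; move: j; rewrite -kk' => j.
by rewrite tagged_asE; have [[-> _] _ _] := irr_r k; rewrite mxE.
Qed.

Lemma blockfunM g h s s' :
  blockfun (g * h)%g s s' = \sum_u blockfun g s u * blockfun h u s'.
Proof.
case: s s' => [k i] [k' j].
rewrite sum_Tagged.
rewrite (bigD1 k) //= [X in _ + X]big1 ?addr0; last first.
  by move=> l lk; rewrite big1 // => u _; rewrite blockfun0 ?mul0r //= eq_sym.
have [kk'|kk'] := eqVneq k k'; last first.
  by rewrite blockfun0 // big1 // => u _; rewrite [X in _ * X]blockfun0 ?mulr0.
move: j; rewrite -kk' => j; rewrite blockfunE.
have [[_ ->] _ _] := irr_r k; rewrite mxE.
by apply: eq_bigr => u _; rewrite !blockfunE.
Qed.

Hypothesis ineq_r : forall k k' (T : 'M_(d k, d k')),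
  intertwines (@r k) (@r k') T -> T != 0 -> k = k'.

(** Entries outside the blocks vanish identically, so only positions of equal tag have dual
    functionals; these come from the joint independence of the [r k]. *)
Lemma blockfun_dual :
  exists n (h : 'I_n -> H) (e : {k & 'I_(d k)} -> {k & 'I_(d k)} -> 'I_n -> C),
    (forall s s' u u', tag s = tag s' ->
      \sum_i e s s' i * blockfun (h i) u u' = ((s == u) && (s' == u'))%:R).
Proof.
pose A : finType := {k & ('I_(d k) * 'I_(d k))%type}.
pose f (p : A) h := r (tag p) h (tagged p).1 (tagged p).2.
have indf : independent f.
  move=> c hc [k [i j]].
  have := jointly_independent_mx irr_r ineq_r.
  move=> /(_ (fun k i j => c (Tagged (fun k => ('I_(d k) * 'I_(d k))%type) (i, j)))).
  apply=> g; rewrite -[RHS](hc g).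
  rewrite sum_Tagged; apply: eq_bigr => k' _; rewrite pair_bigA.
  by apply: eq_bigr => -[].
have [n [h [e eP]]] := dual_functionals indf.
exists n, h, (fun s s' => e (Tagged (fun k => ('I_(d k) * 'I_(d k))%type)
  (tagged s, tagged_as s s'))).
move=> [k i] [k' j] [l u] [l' v] /= kk'; move: j; rewrite -kk' => j.
rewrite tagged_asE; have [ll'|ll'] := eqVneq l l'; last first.
  rewrite big1; last by move=> x _; rewrite blockfun0 ?mulr0.
  by case: andP => // -[/eqP [kl _] /eqP [kl' _]]; rewrite -kl -kl' eqxx in ll'.
move: v; rewrite -ll' => v.
transitivity (\sum_x e (Tagged (fun k => ('I_(d k) * 'I_(d k))%type) (i, j)) x *
   f (Tagged (fun k => ('I_(d k) * 'I_(d k))%type) (u, v)) (h x)).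
  by apply: eq_bigr => x _; rewrite blockfunE.
rewrite eP; congr (_%:R); have [kl|kl] := eqVneq k l; last first.
  rewrite -!tag_eqE /tag_eq /=; by rewrite (negPf kl).
move: u v; rewrite -kl => u v.
by rewrite !eq_Tagged /= xpair_eqE.
Qed.

End BlockDiagonal.

Section Tensor.
Variables (C : numClosedFieldType) (H : groupType) (X K S : finType).
Variables (tg : S -> K) (R : H -> S -> S -> C).

Definition tags (i : {ffun X -> S}) : {ffun X -> K} := [ffun x => tg (i x)].

Definition tensorfun (b : X -> H) (i j : {ffun X -> S}) : C :=
  \prod_x R (b x) (i x) (j x).

Hypothesis R0 : forall h s s', tg s != tg s' -> R h s s' = 0.
Hypothesis R1 : forall s s', R 1%g s s' = (s == s')%:R.
Hypothesis RM : forall g h s s', R (g * h)%g s s' = \sum_u R g s u * R h u s'.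

Lemma tensorfun0 b i j : tags i != tags j -> tensorfun b i j = 0.
Proof.
move=> ij; have /existsP [x nx] : [exists x, tg (i x) != tg (j x)].
  apply: contraNT ij; rewrite negb_exists => /forallP h; apply/eqP/ffunP => x.
  by rewrite !ffunE; apply/eqP/negPn.
by rewrite /tensorfun (bigD1 x) //= R0 // mul0r.
Qed.

Lemma prod_delta (Y Z : finType) (i j : {ffun Y -> Z}) :
  \prod_x ((i x == j x)%:R : C) = (i == j)%:R.
Proof.
have [->|ij] := eqVneq i j; first by rewrite big1 // => x _; rewrite eqxx.
have /existsP [x nx] : [exists x, i x != j x].
  apply: contraNT ij; rewrite negb_exists => /forallP h; apply/eqP/ffunP => x.
  by apply/eqP/negPn.
by rewrite (bigD1 x) //= (negPf nx) mul0r.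
Qed.

Lemma tensorfun1 i j : tensorfun (fun=> 1%g) i j = (i == j)%:R.
Proof. by rewrite -prod_delta; apply: eq_bigr => x _; rewrite R1. Qed.

Lemma tensorfunM b b' i j :
  tensorfun (fun x => b x * b' x)%g i j =
  \sum_l tensorfun b i l * tensorfun b' l j.
Proof.
under [RHS]eq_bigr do rewrite /tensorfun -big_split /=.
rewrite /tensorfun; under eq_bigr do rewrite RM.
by rewrite bigA_distr_bigA.
Qed.

Hypothesis R_dual : exists n (h : 'I_n -> H) (e : S -> S -> 'I_n -> C),
  forall s s' u u', tg s = tg s' ->
    \sum_i e s s' i * R (h i) u u' = ((s == u) && (s' == u'))%:R.

(** The product over [x] of dual functionals of [R] reads off a single coefficient; its sample
    points are the maps with values among the [h]. *)
Lemma tensorfun_independent (c : {ffun X -> S} -> {ffun X -> S} -> C) :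
  (forall b, \sum_i \sum_j c i j * tensorfun b i j = 0) ->
  forall i j, tags i = tags j -> c i j = 0.
Proof.
have [n [h [e eP]]] := R_dual => hc i j /ffunP ij.
transitivity (\sum_(k : {ffun X -> 'I_n}) (\prod_x e (i x) (j x) (k x)) *
  \sum_i' \sum_j' c i' j' * tensorfun (fun x => h (k x)) i' j'); last first.
  by rewrite big1 // => k _; rewrite hc mulr0.
have dual i' j' : \sum_(k : {ffun X -> 'I_n}) (\prod_x e (i x) (j x) (k x)) *
    tensorfun (fun x => h (k x)) i' j' = ((i == i') && (j == j'))%:R.
  under eq_bigr do rewrite /tensorfun -big_split /=.
  rewrite -mulnb natrM -!prod_delta -big_split /=.
  rewrite -(bigA_distr_bigA (fun x m => e (i x) (j x) m * R (h m) (i' x) (j' x))).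
  apply: eq_bigr => x _; rewrite eP -?natrM ?mulnb //.
  by have := ij x; rewrite !ffunE.
under eq_bigr do rewrite mulr_sumr; rewrite exchange_big /= (bigD1 i) //=.
rewrite [X in _ + X]big1 ?addr0 => [|i' ii'].
  under eq_bigr do rewrite mulr_sumr; rewrite exchange_big /= (bigD1 j) //=.
  rewrite [X in _ + X]big1 ?addr0 => [|j' jj'].
    under eq_bigr do rewrite mulrCA.
    by rewrite -mulr_sumr dual !eqxx mulr1.
  under eq_bigr do rewrite mulrCA.
  by rewrite -mulr_sumr dual eqxx eq_sym (negPf jj') mulr0.
under eq_bigr do rewrite mulr_sumr; rewrite exchange_big big1 //= => j' _.
under eq_bigr do rewrite mulrCA.
by rewrite -mulr_sumr dual eq_sym (negPf ii') mulr0.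
Qed.

End Tensor.

(** * Representations induced to the wreath product *)

Section LeftTranslation.
Variables (gT : finGroupType) (X : finType) (to : {action gT &-> X}).

(** Since [to x q] is [left_act to q^-1 x], this is the left action (q i)(x) = i(q^-1 x). *)
Definition ltrans (Z : finType) (q : gT) (i : {ffun X -> Z}) : {ffun X -> Z} :=
  [ffun x => i (to x q)].

Section Maps.
Variable Z : finType.
Implicit Types (i : {ffun X -> Z}) (p q : gT).

Lemma ltrans1 i : ltrans 1%g i = i.
Proof. by apply/ffunP => x; rewrite ffunE act1. Qed.

Lemma ltransM p q i : ltrans (p * q)%g i = ltrans p (ltrans q i).
Proof. by apply/ffunP => x; rewrite !ffunE actM. Qed.

Lemma ltransK q : cancel (@ltrans Z q) (ltrans q^-1%g).
Proof. by move=> i; rewrite -ltransM mulVg ltrans1. Qed.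

Lemma ltransKV q : cancel (@ltrans Z q^-1%g) (ltrans q).
Proof. by move=> i; rewrite -ltransM mulgV ltrans1. Qed.

Lemma ltrans_bij q : bijective (@ltrans Z q).
Proof. by exists (ltrans q^-1%g); [exact: ltransK | exact: ltransKV]. Qed.

Definition in_orbit (r k : {ffun X -> Z}) : bool := [exists q, ltrans q r == k].

Lemma in_orbitP r k : reflect (exists q, ltrans q r = k) (in_orbit r k).
Proof. apply: (iffP existsP) => -[q h]; exists q; exact/eqP. Qed.

Lemma in_orbit_refl r : in_orbit r r.
Proof. by apply/in_orbitP; exists 1%g; rewrite ltrans1. Qed.

Lemma in_orbit_sym r k : in_orbit r k = in_orbit k r.
Proof.
apply/in_orbitP/in_orbitP => -[q <-]; exists q^-1%g; exact: ltransK.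
Qed.

Lemma in_orbit_trans : transitive in_orbit.
Proof.
move=> k r l /in_orbitP [p <-] /in_orbitP [q <-].
by apply/in_orbitP; exists (q * p)%g; rewrite ltransM.
Qed.

Lemma in_orbit_ltrans r k q : in_orbit r (ltrans q k) = in_orbit r k.
Proof.
have h : in_orbit k (ltrans q k) by apply/in_orbitP; exists q.
apply/idP/idP => rk; last exact: in_orbit_trans rk h.
by apply: in_orbit_trans rk _; rewrite in_orbit_sym.
Qed.

Definition transporter (r k : {ffun X -> Z}) : gT :=
  odflt 1%g [pick q | ltrans q r == k].

Lemma transporterP r k : in_orbit r k -> ltrans (transporter r k) r = k.
Proof.
rewrite /transporter; case: pickP => [q /eqP //|no /in_orbitP [q /eqP]].
by rewrite no.
Qed.

(** The usual factor of an induced representation, with [transporter] as coset representatives: for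
    [k] in the orbit of [r], the element of the stabiliser of [r] through which [q] acts from the
    fibre over [k] to the fibre over [ltrans q k]. *)
Definition cocycle (r : {ffun X -> Z}) (q : gT) (k : {ffun X -> Z}) : gT :=
  ((transporter r (ltrans q k))^-1 * q * transporter r k)%g.

Lemma cocycle1 r k : cocycle r 1%g k = 1%g.
Proof. by rewrite /cocycle ltrans1 mulg1 mulVg. Qed.

Lemma cocycleM r p q k : cocycle r (p * q)%g k = (cocycle r p (ltrans q k) * cocycle r q k)%g.
Proof. by rewrite /cocycle ltransM !mulgA mulgK. Qed.

Lemma cocycle_stab r q k : in_orbit r k -> ltrans (cocycle r q k) r = r.
Proof.
move=> rk; rewrite /cocycle !ltransM transporterP //.
have rqk : in_orbit r (ltrans q k) by rewrite in_orbit_ltrans.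
by rewrite -{2}(transporterP rqk) ltransK.
Qed.

End Maps.

Lemma tags_ltrans (S K : finType) (tg : S -> K) q (i : {ffun X -> S}) :
  tags tg (ltrans q i) = ltrans q (tags tg i).
Proof. by apply/ffunP => x; rewrite !ffunE. Qed.

Lemma tensorfun_ltrans (C : numClosedFieldType) (H : groupType) (S : finType)
    (R : H -> S -> S -> C) (b : X -> H) q (i j : {ffun X -> S}) :
  tensorfun R b (ltrans q i) (ltrans q j) =
  tensorfun R (fun x => b (to x q^-1%g)) i j.
Proof.
rewrite /tensorfun [RHS](reindex (fun x => to x q)) /=; last first.
  by exists (fun x => to x q^-1%g) => x _; rewrite ?actK ?actKV.
by apply: eq_bigr => x _; rewrite !ffunE actK.
Qed.

End LeftTranslation.

Section Induced.
Variables (C : numClosedFieldType) (H : topologicalGroupType).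
Variables (gT : finGroupType) (X : finType) (to : {action gT &-> X}).
Variables (S K : finType) (tg : S -> K) (R : H -> S -> S -> C).
Hypothesis R0 : forall h s s', tg s != tg s' -> R h s s' = 0.
Hypothesis R1 : forall s s', R 1%g s s' = (s == s')%:R.
Hypothesis RM : forall g h s s', R (g * h)%g s s' = \sum_u R g s u * R h u s'.

Local Notation G := (wreath H to).
Local Notation tags := (tags tg).
Local Notation ltrans := (ltrans to).
Local Notation tensorfun := (tensorfun R).

Definition induced_index (r : {ffun X -> K}) (e : nat) : finType :=
  {p : {ffun X -> S} * 'I_e | in_orbit to r (tags p.1)}.

(* The representation of the wreath product induced from (R^{\otimes X}
   restricted to the tags r) \otimes sigma, with basis vectors indexed by the
   translates of the basis of the tensor product. *)
Definition induced_fun (r : {ffun X -> K}) (e : nat) (sigma : gT -> 'M[C]_e)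
    (u : G) (p p' : induced_index r e) : C :=
  tensorfun u.1 (val p).1 (ltrans u.2 (val p').1) *
  sigma (cocycle to r u.2 (tags (val p').1)) (val p).2 (val p').2.

(** [sigma] is defined on the whole group but multiplicative only on the stabiliser of [r], so that
    no subgroup type enters the formula for the induced representation. *)
Definition stab_hom (r : {ffun X -> K}) (e : nat) (sigma : gT -> 'M[C]_e) : Prop :=
  sigma 1%g = 1%:M /\
  forall p q, ltrans p r = r -> ltrans q r = r -> sigma (p * q)%g = sigma p *m sigma q.

Lemma sum_induced_index (V : nmodType) r e (f : {ffun X -> S} -> 'I_e -> V) :
  (forall i l, ~~ in_orbit to r (tags i) -> f i l = 0) ->
  \sum_(p : induced_index r e) f (val p).1 (val p).2 = \sum_i \sum_l f i l.
Proof.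
move=> f0; rewrite pair_bigA /=.
rewrite (bigID (fun p => in_orbit to r (tags p.1))) /= [X in _ + X]big1 ?addr0; last first.
  by move=> [i l] /f0.
pose P := [pred p : {ffun X -> S} * 'I_e | in_orbit to r (tags p.1)].
exact/esym/(@big_sub _ _ _ _ P (fun p => f p.1 p.2)).
Qed.

(** Matching tags confine the sum to the orbit. The tensor factors multiply after translating the
    summation index by [u.2], the [sigma] factors by the cocycle identity. *)
Lemma induced_hom r e (sigma : gT -> 'M[C]_e) :
  stab_hom r sigma -> mxhom (mxof (@induced_fun r e sigma)).
Proof.
move=> [s1 sM]; apply: mxof_hom => [[[i l] ip] [[j k] jp]|u v [[i l] ip] [[j k] jp]].
  rewrite /induced_fun /= cocycle1 s1 ltrans1 (tensorfun1 R1) mxE -natrM mulnb.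
  by congr (_%:R); rewrite -val_eqE.
rewrite {1}/induced_fun /=.
rewrite (@sum_induced_index _ r e (fun m n =>
  (tensorfun u.1 i (ltrans u.2 m) * sigma (cocycle to r u.2 (tags m)) l n) *
  (tensorfun v.1 m (ltrans v.2 j) * sigma (cocycle to r v.2 (tags j)) n k))); last first.
  move=> m n nm; rewrite (tensorfun0 R0 v.1) ?mul0r ?mulr0 //.
  by apply: contraNneq nm => ->; rewrite tags_ltrans in_orbit_ltrans.
have -> : tensorfun (u * v)%g.1 i (ltrans (u.2 * v.2)%g j) =
    \sum_m tensorfun u.1 i (ltrans u.2 m) * tensorfun v.1 m (ltrans v.2 j).
  rewrite ltransM (tensorfunM RM u.1 (fun x => v.1 (left_act to u.2^-1%g x))).
  rewrite (reindex_inj (bij_inj (ltrans_bij to S u.2))).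
  apply: eq_bigr => m _; congr (_ * _); rewrite tensorfun_ltrans.
  by apply: eq_bigr => x _; rewrite /left_act invgK actKV.
rewrite mulr_suml; apply: eq_bigr => m _.
have [mj|mj] := eqVneq (tags m) (tags (ltrans v.2 j)); last first.
  rewrite (tensorfun0 R0 v.1 mj) mulr0 mul0r big1 // => n _.
  by rewrite mul0r mulr0.
rewrite cocycleM sM; try exact: cocycle_stab.
  rewrite mxE mulr_sumr; apply: eq_bigr => n _.
  by rewrite mj tags_ltrans mulrACA.
by apply: cocycle_stab; rewrite in_orbit_ltrans.
Qed.

Hypothesis R_dual : exists n (h : 'I_n -> H) (e : S -> S -> 'I_n -> C),
  forall s s' u u', tg s = tg s' ->
    \sum_i e s s' i * R (h i) u u' = ((s == u) && (s' == u'))%:R.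

Section Family.
Variables (J : finType) (r : J -> {ffun X -> K}) (e : J -> nat).
Variable sigma : forall j, gT -> 'M[C]_(e j).
Hypothesis r_orbit : forall j j', in_orbit to (r j) (r j') -> r j = r j'.
Hypothesis sigma_ind : forall j0 (c : forall j, 'I_(e j) -> 'I_(e j) -> C),
  (forall q, ltrans q (r j0) = r j0 ->
     \sum_(j | r j == r j0) \sum_l \sum_k c j l k * sigma j q l k = 0) ->
  forall l k, c j0 l k = 0.

(** For fixed [q], independence over the base group isolates one pair [i], [m]. As [q] varies over
    the elements carrying the tags of [m] to those of [i], the cocycle runs through the stabiliser,
    where [sigma_ind] applies. *)
Lemma induced_independent :
  jointly_independent (T := fun j => induced_index (r j) (e j))
    (fun j => @induced_fun (r j) (e j) (@sigma j)).
Proof.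
move=> c hc.
pose cx j (p p' : {ffun X -> S} * 'I_(e j)) : C :=
  if insub p is Some a then if insub p' is Some b then c j a b else 0 else 0.
have cxE j a b : cx j (val a) (val b) = c j a b by rewrite /cx !valK.
have cx0l j p p' : ~~ in_orbit to (r j) (tags p.1) -> cx j p p' = 0.
  by move=> np; rewrite /cx insubN.
have cx0r j p p' : ~~ in_orbit to (r j) (tags p'.1) -> cx j p p' = 0.
  by move=> np; rewrite /cx; case: (insub p) => // a; rewrite insubN.
pose co j i l m k q := cx j (i, l) (m, k) * sigma j (cocycle to (r j) q (tags m)) l k.
have sumE j (u : G) : \sum_a \sum_b c j a b * induced_fun (@sigma j) u a b =
    \sum_i \sum_l \sum_m \sum_k cx j (i, l) (m, k) * (tensorfun u.1 i (ltrans u.2 m) *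
      sigma j (cocycle to (r j) u.2 (tags m)) l k).
  rewrite -(@sum_induced_index _ (r j) (e j)) /=; last first.
    move=> i l il; rewrite big1 // => m _; rewrite big1 // => k _.
    by rewrite cx0l ?mul0r.
  apply: eq_bigr => a _; rewrite -(@sum_induced_index _ (r j) (e j)) /=; last first.
    by move=> m k mk; rewrite cx0r ?mul0r.
  by apply: eq_bigr => b _; rewrite -!surjective_pairing cxE.
have hcx (b : X -> H) q : \sum_i \sum_m (\sum_j \sum_l \sum_k co j i l m k q) *
    tensorfun b i (ltrans q m) = 0.
  rewrite -[RHS](hc (b, q)); under [RHS]eq_bigr do rewrite sumE /=.
  rewrite [RHS]exchange_big; apply: eq_bigr => i _ /=.
  under [RHS]eq_bigr do rewrite exchange_big /=.
  rewrite [RHS]exchange_big; apply: eq_bigr => m _ /=.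
  rewrite mulr_suml; apply: eq_bigr => j _.
  rewrite mulr_suml; apply: eq_bigr => l _.
  rewrite mulr_suml; apply: eq_bigr => k _.
  by rewrite -mulrA [X in _ * X]mulrC.
have star q i m : tags i = ltrans q (tags m) ->
    \sum_j \sum_l \sum_k co j i l m k q = 0.
  rewrite -tags_ltrans => im.
  have := tensorfun_independent R_dual (c := fun i m =>
    \sum_j \sum_l \sum_k co j i l (ltrans q^-1%g m) k q).
  move=> /(_ _ i (ltrans q m) im); rewrite ltransK; apply => b.
  rewrite -[RHS](hcx b q); apply: eq_bigr => i' _.
  rewrite (reindex_inj (bij_inj (ltrans_bij to S q))).
  by apply: eq_bigr => m' _; rewrite ltransK.
move=> j0 a b; rewrite -cxE; case: a b => [[i l] /= ip] [[m k] /= mp].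
apply: (@sigma_ind j0 (fun j l k => cx j (i, l) (m, k))) => s sP.
pose t1 := transporter to (r j0) (tags i); pose t2 := transporter to (r j0) (tags m).
(* Solved from the cocycle formula, so that the cocycle of [q] at the tags of [m] is [s]. *)
pose q := (t1 * s * t2^-1)%g.
have im : tags i = ltrans q (tags m).
  have -> : tags m = ltrans t2 (r j0) by rewrite transporterP.
  by rewrite /q !ltransM ltransK sP transporterP.
rewrite -[RHS](star _ _ _ im) [RHS](bigID (fun j => r j == r j0)) /=.
rewrite [X in _ = _ + X]big1 ?addr0.
  apply: eq_bigr => j /eqP rj; apply: eq_bigr => l' _; apply: eq_bigr => k' _.
  rewrite /co; congr (_ * sigma j _ l' k'); rewrite rj /cocycle -im.
  by rewrite -/t1 -/t2 /q !mulgA mulVg mul1g mulgKV.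
move=> j rj; rewrite big1 // => l' _; rewrite big1 // => k' _.
rewrite /co cx0l ?mul0r //=; apply: contra rj => ri; apply/eqP/r_orbit.
by apply: in_orbit_trans ri _; rewrite in_orbit_sym.
Qed.

End Family.

Section Frobenius.
Variables (N : nat) (pi : G -> 'M[C]_N).
Hypothesis hom_pi : mxhom pi.
Variables (r : {ffun X -> K}) (e : nat) (sigma : gT -> 'M[C]_e).
Variable F : 'I_e -> {ffun X -> S} -> 'cV[C]_N.

Let base (b : X -> H) : G := (b, 1%g).
Let top (q : gT) : G := (fun=> 1%g, q).

Hypothesis F0 : forall k i, tags i != r -> F k i = 0.
Hypothesis F_base : forall b k i,
  pi (base b) *m F k i = \sum_j tensorfun b j i *: F k j.
Hypothesis F_top : forall q k i, ltrans q r = r ->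
  pi (top q) *m F k i = \sum_l sigma q l k *: F l (ltrans q i).

(** Frobenius reciprocity: [F] is a map from the block of [r] tensored with [sigma], compatible with
    the base group and the stabiliser. A basis vector over another point of the orbit is moved back
    to that block, mapped by [F], and moved forward by [pi]. *)
Definition frobenius_vec (i : {ffun X -> S}) (k : 'I_e) : 'cV[C]_N :=
  let t := transporter to r (tags i) in pi (top t) *m F k (ltrans t^-1%g i).

Definition frobenius_mx : 'M[C]_(N, #|induced_index r e|) :=
  \matrix_(a, p) frobenius_vec (val (enum_val p)).1 (val (enum_val p)).2 a 0.

Let topM p q : (top (p * q) = top p * top q)%g.
Proof. by congr pair; apply/funext => x /=; rewrite mulg1. Qed.

Let base_top b q : (base b * top q)%g = (b, q).
Proof. by congr pair; [apply/funext => x /=; rewrite mulg1 | rewrite /= mul1g]. Qed.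

Let top_base b q : (top q * base b)%g = (fun x => b (to x q), q).
Proof.
congr pair; last by rewrite /= mulg1.
by apply/funext => x /=; rewrite mul1g /left_act invgK.
Qed.

Lemma frobenius_vecP (u : G) i k : in_orbit to r (tags i) ->
  pi u *m frobenius_vec i k = \sum_j \sum_l
    (tensorfun u.1 j (ltrans u.2 i) * sigma (cocycle to r u.2 (tags i)) l k) *:
    frobenius_vec j l.
Proof.
case: u => b q ri /=; rewrite /frobenius_vec.
set t' := transporter to r (tags i).
set t := transporter to r (ltrans q (tags i)).
set s := cocycle to r q (tags i).
have sP : ltrans s r = r by exact: cocycle_stab.
have qts : (q * t' = t * s)%g by rewrite /s /cocycle -/t -/t' !mulgA mulgV mul1g.
have [_ piM] := hom_pi.
rewrite mulmxA -piM.
(* A group element times a coset representative, rewritten as representative, base element,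
   stabiliser element. *)
have -> : (((b, q) : G) * top t' = top t * base (fun x => b (to x t^-1)) * top s :> G)%g.
  rewrite -base_top -mulgA -topM qts topM mulgA base_top; congr (_ * _)%g.
  by rewrite top_base; congr pair; apply/funext => x; rewrite actK.
have sti : ltrans s (ltrans t'^-1%g i) = ltrans t^-1%g (ltrans q i).
  by rewrite -!ltransM; congr ltrans; rewrite /s /cocycle -/t -/t' !mulgK.
rewrite !piM -!mulmxA F_top // sti !mulmx_sumr exchange_big /=.
apply: eq_bigr => l _; rewrite -!scalemxAr F_base mulmx_sumr scaler_sumr.
rewrite (reindex_inj (bij_inj (ltrans_bij to S t^-1%g))) /=.
apply: eq_bigr => j _; rewrite tensorfun_ltrans invgK -scalemxAr scalerA mulrC.
have -> : tensorfun (fun x => b (to (to x t) t^-1%g)) j (ltrans q i) =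
   tensorfun b j (ltrans q i).
  by apply: eq_bigr => x _; rewrite actK.
have [ji|ji] := eqVneq (tags j) (tags (ltrans q i)); last first.
  by rewrite (tensorfun0 R0 b ji) !mul0r !scale0r.
by rewrite ji tags_ltrans.
Qed.

Lemma frobenius_intertwines :
  intertwines pi (mxof (@induced_fun r e sigma)) frobenius_mx.
Proof.
move=> u; apply/matrixP => a p; rewrite !mxE.
transitivity ((pi u *m frobenius_vec (val (enum_val p)).1 (val (enum_val p)).2) a 0).
  by rewrite mxE; apply: eq_bigr => c _; rewrite mxE.
rewrite frobenius_vecP; last exact: (valP (enum_val p)).
rewrite summxE.
rewrite [RHS](reindex (@enum_rank (induced_index r e))) /=; last exact/onW_bij/enum_rank_bij.
transitivity (\sum_(x : induced_index r e) frobenius_vec (val x).1 (val x).2 a 0 *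
   (tensorfun u.1 (val x).1 (ltrans u.2 (val (enum_val p)).1) *
  sigma (cocycle to r u.2 (tags (val (enum_val p)).1)) (val x).2 (val (enum_val p)).2)).
  rewrite (@sum_induced_index _ r e (fun j l => frobenius_vec j l a 0 *
   (tensorfun u.1 j (ltrans u.2 (val (enum_val p)).1) *
  sigma (cocycle to r u.2 (tags (val (enum_val p)).1)) l (val (enum_val p)).2))); last first.
    move=> j l jr; rewrite (tensorfun0 R0 u.1) ?mul0r ?mulr0 //.
    apply: contraNneq jr => ->; rewrite tags_ltrans in_orbit_ltrans.
    exact: valP (enum_val p).
  apply: eq_bigr => j _; rewrite summxE; apply: eq_bigr => l _.
  by rewrite mxE mulrC.
by apply: eq_bigr => x _; rewrite !mxE !enum_rankK.
Qed.

Lemma frobenius_mx_neq0 : (exists k i, F k i != 0) -> frobenius_mx != 0.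
Proof.
case=> k [i Fki].
have ri : tags i = r by apply/eqP; apply: contraNT Fki => /F0 ->.
(* The choice in [transporter] is arbitrary: [t] fixes [r] but need not be the identity, hence the
   test index [ltrans t i]. *)
pose t := transporter to r r.
have tr : ltrans t r = r by apply: transporterP; exact: in_orbit_refl.
have ti : in_orbit to r (tags (ltrans t i)).
  by rewrite tags_ltrans ri tr in_orbit_refl.
pose p : induced_index r e := Sub (ltrans t i, k) ti.
apply: contraNneq Fki => f0.
have v0 : frobenius_vec (ltrans t i) k = 0.
  apply/matrixP => a z; have /matrixP/(_ a (enum_rank p)) := f0.
  by rewrite ord1 !mxE enum_rankK.
have [pi1 piM] := hom_pi.
move: v0; rewrite /frobenius_vec tags_ltrans ri tr -/t ltransK.
move=> /(congr1 (mulmx (pi (top t^-1%g)))).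
rewrite mulmxA -piM -topM mulVg mulmx0.
by rewrite (_ : top 1%g = 1%g) // pi1 mul1mx => ->.
Qed.

End Frobenius.
End Induced.

(** * Continuity of matrix coefficients *)

Section ContinuousFunctions.
Variables (R : realType) (T : topologicalType).
Implicit Types f g : T -> R[i].

Definition cont (f : T -> R[i]) : Prop := continuous (f : T -> R[i]^o).

Lemma cont_cst (c : R[i]) : cont (fun=> c).
Proof. by move=> x; exact: cvg_cst. Qed.

Lemma contD f g : cont f -> cont g -> cont (fun x => f x + g x).
Proof. by move=> cf cg x; exact: (@cvgD _ R[i]^o _ _ _ f g _ _ (cf x) (cg x)). Qed.

Lemma contM f g : cont f -> cont g -> cont (fun x => f x * g x).
Proof. by move=> cf cg x; exact: (cvgM (cf x) (cg x)). Qed.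

Lemma cont_sum (I : Type) (r : seq I) (P : pred I) (F : I -> T -> R[i]) :
  (forall i, P i -> cont (F i)) -> cont (fun x => \sum_(i <- r | P i) F i x).
Proof.
move=> cF; elim: r => [|i r IH].
  rewrite (_ : (fun x => _) = fun=> 0); first exact: cont_cst.
  by apply/funext => x; rewrite big_nil.
have [Pi|Pi] := boolP (P i).
  rewrite (_ : (fun x => _) = fun x => F i x + \sum_(i <- r | P i) F i x).
    by apply: contD; [exact: cF | exact: IH].
  by apply/funext => x; rewrite big_cons Pi.
rewrite (_ : (fun x => _) = fun x => \sum_(i <- r | P i) F i x) //.
by apply/funext => x; rewrite big_cons (negPf Pi).
Qed.

Lemma cont_prod (I : Type) (r : seq I) (P : pred I) (F : I -> T -> R[i]) :
  (forall i, P i -> cont (F i)) -> cont (fun x => \prod_(i <- r | P i) F i x).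
Proof.
move=> cF; elim: r => [|i r IH].
  rewrite (_ : (fun x => _) = fun=> 1); first exact: cont_cst.
  by apply/funext => x; rewrite big_nil.
have [Pi|Pi] := boolP (P i).
  rewrite (_ : (fun x => _) = fun x => F i x * \prod_(i <- r | P i) F i x).
    by apply: contM; [exact: cF | exact: IH].
  by apply/funext => x; rewrite big_cons Pi.
rewrite (_ : (fun x => _) = fun x => \prod_(i <- r | P i) F i x) //.
by apply/funext => x; rewrite big_cons (negPf Pi).
Qed.

Lemma cont_mx m n (M : T -> 'M[R[i]]_(m, n)) :
  continuous (fun x => M x : 'M[R[i]^o]_(m, n)) <->
  forall i j, cont (fun x => M x i j).
Proof.
split=> [cM i j x|cM x].
  apply: (@continuous_comp _ _ _ (fun x => M x : 'M[R[i]^o]_(m, n)) (fun A => A i j : R[i]^o)).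
    exact: cM.
  exact: coord_continuous.
move=> A [P Mx PA]; have h i j := cM i j x _ (Mx i j).
have : \forall y \near x, forall i j, P i j (M y i j).
  apply: filter_forall => i; apply: filter_forall => j; exact: h.
by apply: filterS => y hy; apply: PA => i j; exact: hy.
Qed.

End ContinuousFunctions.

Section ReprsAsMatrices.
Variables (R : realType) (G : topologicalGroupType).

Lemma is_reprP n (rho : G -> 'M[R[i]]_n) :
  is_repr rho <-> mxhom rho /\ forall i j, cont (fun g => rho g i j).
Proof.
split=> [[h1 hM /cont_mx hc]|[[h1 hM] hc]]; first by [].
by split=> //; apply/cont_mx.
Qed.

Lemma is_irrP n (rho : G -> 'M[R[i]]_n) :
  is_irr rho <-> mxirr rho /\ forall i j, cont (fun g => rho g i j).
Proof.
split=> [[/is_reprP [hom hc] n0 irr]|[/mxirrP [hom n0 irr] hc]].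
  by split=> //; apply/mxirrP.
by split=> //; apply/is_reprP.
Qed.

End ReprsAsMatrices.

(** * Irreducible representations of a power of a group *)

Section PowerGroup.
Variables (C : numClosedFieldType) (H : groupType) (X : finType).
Variables (K : finType) (d : K -> nat) (r : forall k, H -> 'M[C]_(d k)).
Hypothesis irr_r : forall k, mxirr (@r k).
Hypothesis ineq_r : forall k k' (T : 'M_(d k, d k')),
  intertwines (@r k) (@r k') T -> T != 0 -> k = k'.

Local Notation S := {k & 'I_(d k)}.
Local Notation tags := (tags (fun s : S => tag s)).
Local Notation tensorfun := (tensorfun (blockfun r)).

Definition inj_at (x : X) (h : H) : {ffun X -> H} :=
  [ffun y => if y == x then h else 1%g].

Lemma inj_atM x g h : inj_at x (g * h)%g = (inj_at x g * inj_at x h)%g.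
Proof. by apply/ffunP => y; rewrite !ffunE; case: eqP; rewrite ?mulg1. Qed.

Lemma inj_at_conj x h (b : {ffun X -> H}) :
  (inj_at x h * b = b * inj_at x ((b x)^-1 * h * b x))%g.
Proof.
apply/ffunP => y; rewrite !ffunE; case: eqP => [->|_]; last by rewrite mul1g mulg1.
by rewrite !mulgA mulgV mul1g.
Qed.

Variables (m : nat) (tau : {ffun X -> H} -> 'M[C]_m).
Hypothesis irr_tau : mxirr tau.
Variables (kappa : {ffun X -> K}) (f : forall x, 'M[C]_(m, d (kappa x))).
Arguments f : clear implicits.
Hypothesis f_neq0 : forall x, f x != 0.
Hypothesis f_int : forall x h, tau (inj_at x h) *m f x = f x *m r (kappa x) h.

(* The subspace annihilated by all relations holding in r (kappa x) is invariant
   under the whole group and contains the image of f x. *)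
Lemma isotypic x (I : finType) (c : I -> C) (h : I -> H) :
  \sum_i c i *: r (kappa x) (h i) = 0 -> \sum_i c i *: tau (inj_at x (h i)) = 0.
Proof.
pose rel n (c : 'I_n -> C) (h : 'I_n -> H) :=
  \sum_i c i *: r (kappa x) (h i) = 0.
pose P (v : 'cV[C]_m) := forall n (c : 'I_n -> C) (h : 'I_n -> H), rel n c h ->
  (\sum_i c i *: tau (inj_at x (h i))) *m v = 0.
have [[tau1 tauM] m_gt0 /= _] := irr_tau.
have [[_ rM] _ _] := irr_r (kappa x).
have [||U UP] := @subspace_vspace C 'cV[C]_m P.
- by move=> n c' h' _; rewrite mulmx0.
- move=> a u v Pu Pv n c' h' hr.
  by rewrite mulmxDr -scalemxAr (Pu _ _ _ hr) (Pv _ _ _ hr) scaler0 addr0.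
have U1 : U = fullv.
  have [_ _ irr] := (mxirrP tau).1 irr_tau.
  case: (irr U) => // [b v /UP vU|U0].
    apply/UP => n c' h' hr.
    (* Conjugation by [b] acts on the factor at [x] as conjugation by [b x], under which the
       relations of [r (kappa x)] are stable. *)
    pose h'' i := ((b x)^-1 * h' i * b x)%g.
    transitivity (tau b *m ((\sum_i c' i *: tau (inj_at x (h'' i))) *m v)).
      rewrite !mulmxA; congr (_ *m v); rewrite mulmx_suml mulmx_sumr.
      apply: eq_bigr => i _; rewrite -scalemxAl -scalemxAr; congr (_ *: _).
      by rewrite -!tauM inj_at_conj.
    rewrite vU ?mulmx0 // /rel.
    transitivity (r (kappa x) (b x)^-1%g *m
      (\sum_i c' i *: r (kappa x) (h' i)) *m r (kappa x) (b x)).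
      rewrite mulmx_sumr mulmx_suml; apply: eq_bigr => i _.
      by rewrite /h'' !rM -scalemxAr -scalemxAl.
    by rewrite hr mulmx0 mul0mx.
  have /matrix0Pn [i [j fij]] := f_neq0 x.
  have : col j (f x) \in U.
    apply/UP => n c' h' hr.
    rewrite colE mulmxA mulmx_suml.
    under eq_bigr do rewrite -scalemxAl f_int scalemxAr.
    by rewrite -mulmx_sumr hr mulmx0 mul0mx.
  rewrite U0 memv0 => /eqP/matrixP/(_ i 0); rewrite !mxE => fij0.
  by rewrite fij0 eqxx in fij.
move=> hr.
have hr' : rel #|I| (fun i => c (enum_val i)) (fun i => h (enum_val i)).
  rewrite /rel -[RHS]hr (reindex (@enum_rank I)) /=; last exact/onW_bij/enum_rank_bij.
  by apply: eq_bigr => i _; rewrite enum_rankK.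
apply/matrixP => i j.
have /UP /(_ _ _ _ hr') /matrixP /(_ i 0) : delta_mx j 0 \in U by rewrite U1 memvf.
rewrite -colE !mxE => E; rewrite -[RHS]E; congr (fun_of_matrix _ i j).
rewrite [RHS](reindex (@enum_rank I)) /=; last exact/onW_bij/enum_rank_bij.
by apply: eq_bigr => k _; rewrite enum_rankK.
Qed.

(** Dual functionals write [r (kappa x) h] as a combination of values at sample points; by
    [isotypic] the same combination holds for [tau] on the factor at [x]. [E s s'] collects the
    sample values belonging to one entry. *)
Lemma isotypic_span x : exists E : S -> S -> 'M[C]_m,
  (forall s s', (tag s != kappa x) || (tag s' != kappa x) -> E s s' = 0) /\
  forall h, tau (inj_at x h) = \sum_s \sum_s' blockfun r h s s' *: E s s'.
Proof.
have [n [h0 [e eP]]] := blockfun_dual irr_r ineq_r.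
pose on (s s' : S) := (tag s == kappa x) && (tag s' == kappa x).
exists (fun s s' => if on s s' then \sum_i e s s' i *: tau (inj_at x (h0 i)) else 0).
split=> [s s'|h]; first by rewrite -negb_and /on => /negPf ->.
apply/eqP; rewrite -subr_eq0; apply/eqP.
(* That relation as one family: [inl] carries [h] with coefficient 1, [inr] the sample points with
   opposite coefficients. *)
pose c (p : unit + (S * S * 'I_n)) : C :=
  match p with inl _ => 1 | inr (s, s', i) =>
    if on s s' then - (blockfun r h s s' * e s s' i) else 0 end.
pose h1 (p : unit + (S * S * 'I_n)) : H :=
  match p with inl _ => h | inr (_, i) => h0 i end.
have sumE (V : lmodType C) (t : H -> V) : \sum_p c p *: t (h1 p) =
    t h - \sum_s \sum_s' blockfun r h s s' *:
      (if on s s' then \sum_i e s s' i *: t (h0 i) else 0).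
  rewrite big_sumType /= (bigD1 tt) //= [X in _ + X + _]big1 ?addr0; last by case.
  rewrite scale1r; congr (_ + _).
  rewrite pair_bigA /= -sumrN.
  transitivity (\sum_(p : S * S) \sum_i c (inr (p, i)) *: t (h0 i)).
    by rewrite pair_bigA; apply: eq_bigr => -[].
  apply: eq_bigr => -[s s'] _ /=; case: ifP => _; last first.
    by rewrite scaler0 oppr0 big1 // => i _; rewrite scale0r.
  by rewrite scaler_sumr -sumrN; apply: eq_bigr => i _; rewrite scalerA scaleNr.
rewrite -(sumE _ (fun h => tau (inj_at x h))); apply: isotypic.
rewrite sumE; apply/matrixP => u v; rewrite !mxE summxE.
pose su : S := Tagged (fun k => 'I_(d k)) u; pose sv : S := Tagged (fun k => 'I_(d k)) v.
rewrite (bigD1 su) //= [X in _ - (_ + X)]big1 ?addr0.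
  rewrite summxE (bigD1 sv) //= [X in _ - (_ + X)]big1 ?addr0.
    rewrite /on /= !eqxx /= !mxE summxE.
    under eq_bigr do rewrite mxE -(blockfunE r).
    by rewrite eP // !eqxx mulr1 blockfunE subrr.
  move=> s' ns'; rewrite mxE /on /=; case: ifP; last by rewrite mxE mulr0.
  move=> /andP[_ /eqP s'x]; rewrite summxE.
  under eq_bigr do rewrite mxE -(blockfunE r).
  by rewrite eP //= (negPf ns') andbF mulr0.
move=> s ns; rewrite summxE big1 // => s' _; rewrite mxE /on.
case: ifP => [/andP[/eqP sx /eqP s'x]|_]; last by rewrite mxE mulr0.
rewrite summxE; under eq_bigr do rewrite mxE -(blockfunE r).
by rewrite eP ?sx ?s'x // (negPf ns) mulr0.
Qed.

(** An element of the power is the product of its components, so the expansions over the factors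
    multiply out. The matrices [E] are multiplied in the order of enumeration of [X], which avoids
    any appeal to commutation. *)
Lemma isotypic_coef : exists P : {ffun X -> S} -> {ffun X -> S} -> 'M[C]_m,
  (forall i j, (tags i != kappa) || (tags j != kappa) -> P i j = 0) /\
  forall b : {ffun X -> H}, tau b = \sum_i \sum_j tensorfun b i j *: P i j.
Proof.
have /boolp.choice [E EP] := isotypic_span.
have [[tau1 tauM] _ _] := irr_tau.
have prod0 (F : X -> 'M[C]_m) x : F x = 0 -> \prod_x F x = 0.
  move=> Fx; have : x \in index_enum X by rewrite mem_index_enum.
  by case/splitPr => s1 s2; rewrite big_cat big_cons /= Fx mul0r mulr0.
have prodE (b : {ffun X -> H}) : tau b = \prod_x tau (inj_at x (b x)).
  have gen (s : seq X) : uniq s ->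
      tau [ffun y => if y \in s then b y else 1%g] = \prod_(x <- s) tau (inj_at x (b x)).
    elim: s => [_|x s IH /andP[xs us]].
      by rewrite big_nil -[RHS]tau1; congr tau; apply/ffunP => y; rewrite !ffunE.
    rewrite big_cons -IH // -[RHS]tauM; congr tau; apply/ffunP => y.
    rewrite !ffunE inE; case: eqP => [->|_] /=; last by rewrite mul1g.
    by rewrite (negPf xs) mulg1.
  rewrite -gen ?index_enum_uniq //; congr tau; apply/ffunP => y.
  by rewrite ffunE mem_index_enum.
exists (fun i j => \prod_x E x (i x) (j x)); split=> [i j|b].
  rewrite -negb_and => nij.
  have /existsP [x nx] : [exists x, (tag (i x) != kappa x) || (tag (j x) != kappa x)].
    apply: contraNT nij; rewrite negb_exists => /forallP h.
    apply/andP; split; apply/eqP/ffunP => x; have := h x; rewrite negb_or !negbK ffunE;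
      by case/andP => /eqP ? /eqP.
  by apply: (prod0 _ x); apply: (EP x).1.
rewrite prodE; under eq_bigr do rewrite (EP _).2 pair_bigA /=.
rewrite (bigA_distr_bigA (fun x (p : S * S) =>
  blockfun r (b x) p.1 p.2 *: E x p.1 p.2)) /= pair_bigA /=.
rewrite (reindex (fun p : {ffun X -> S} * {ffun X -> S} =>
  [ffun x => (p.1 x, p.2 x)])) /=; last first.
  exists (fun g => ([ffun x => (g x).1], [ffun x => (g x).2])) => [[i j]|g] _ /=.
    by congr pair; apply/ffunP => x; rewrite !ffunE.
  by apply/ffunP => x; rewrite !ffunE; case: (g x).
apply: eq_bigr => -[i j] _ /=.
under eq_bigr do rewrite ffunE /=.
rewrite /tensorfun; elim/big_rec3: _ => [|x y1 y2 y3 _ ->]; first by rewrite scale1r.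
by rewrite -[LHS]/(_ *m _) -scalemxAl -scalemxAr scalerA.
Qed.

End PowerGroup.

Section TwoIrreducibles.
Variables (C : numClosedFieldType) (G : groupType).

Lemma intertwiner_sym n m (rho : G -> 'M[C]_n) (sigma : G -> 'M[C]_m) T :
  mxirr rho -> mxirr sigma -> intertwines rho sigma T -> T != 0 ->
  exists2 T' : 'M_(m, n), intertwines sigma rho T' & T' != 0.
Proof.
move=> irr irs hT T0; have nm := intertwiner_dim irr irs hT T0.
subst m; have uT := intertwiner_unit irr hT T0.
exists (invmx T).
  by move=> g; rewrite -[RHS](mulmxK uT) -(mulmxA (invmx T)) hT mulKmx.
by apply: contraNneq T0 => iT0; rewrite -[T]mulmx1 -(mulmxV uT) iT0 !mulmx0.
Qed.

Lemma intertwiner_trans n m p (rho : G -> 'M[C]_n) (sigma : G -> 'M[C]_m)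
    (tau : G -> 'M[C]_p) : mxirr rho -> mxirr sigma ->
  (exists2 T, intertwines rho sigma T & T != 0) ->
  (exists2 T, intertwines sigma tau T & T != 0) ->
  exists2 T, intertwines rho tau T & T != 0.
Proof.
move=> irr irs [T hT T0] [T' hT' T'0]; exists (T *m T').
  by move=> g; rewrite mulmxA hT -mulmxA hT' mulmxA.
have nm := intertwiner_dim irr irs hT T0; subst m.
by apply: contraNneq T'0 => TT'; rewrite -(mulKmx (intertwiner_unit irr hT T0) T') TT' mulmx0.
Qed.

Lemma inequiv_independent n m (rho : G -> 'M[C]_n) (sigma : G -> 'M[C]_m) A B :
  mxirr rho -> mxirr sigma ->
  (forall T : 'M_(n, m), intertwines rho sigma T -> T = 0) ->
  (forall g, \tr (A *m rho g) + \tr (B *m sigma g) = 0) -> A = 0.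
Proof.
move=> irr irs ineq hAB.
pose d (b : bool) := if b then n else m.
pose pi (b : bool) : G -> 'M[C]_(d b) :=
  match b return G -> 'M[C]_(d b) with true => rho | false => sigma end.
pose AB (b : bool) : 'M[C]_(d b) :=
  match b return 'M[C]_(d b) with true => A | false => B end.
apply: (@frobenius_schur _ _ _ d pi _ _ AB _ true); first by case.
- case=> -[] // T hT T0; last have [T' hT' T'0] := intertwiner_sym irs irr hT T0.
    by rewrite (ineq T hT) eqxx in T0.
  by rewrite (ineq T' hT') eqxx in T'0.
- by move=> g; rewrite big_bool /= hAB.
Qed.

End TwoIrreducibles.

Section PowerTensor.
Variables (C : numClosedFieldType) (H : groupType) (X : finType).
Variables (K : finType) (d : K -> nat) (r : forall k, H -> 'M[C]_(d k)).
Hypothesis irr_r : forall k, mxirr (@r k).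
Hypothesis ineq_r : forall k k' (T : 'M_(d k, d k')),
  intertwines (@r k) (@r k') T -> T != 0 -> k = k'.

Local Notation S := {k & 'I_(d k)}.
Local Notation tags := (tags (fun s : S => tag s)).
Local Notation tensorfun := (tensorfun (blockfun r)).

Definition tensor_index (kappa : {ffun X -> K}) : finType :=
  {i : {ffun X -> S} | tags i == kappa}.

Definition tensor_pow (kappa : {ffun X -> K}) (b : {ffun X -> H})
    (i j : tensor_index kappa) : C := tensorfun b (val i) (val j).

Lemma sum_tensor_index (V : nmodType) kappa (f : {ffun X -> S} -> V) :
  (forall i, tags i != kappa -> f i = 0) ->
  \sum_(p : tensor_index kappa) f (val p) = \sum_i f i.
Proof.
move=> f0; rewrite (bigID (fun i => tags i == kappa)) /= [X in _ + X]big1 ?addr0 //.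
pose P := [pred i : {ffun X -> S} | tags i == kappa].
exact/esym/(@big_sub _ _ _ _ P f).
Qed.

Lemma tensor_pow_irr kappa : mxirr (mxof (@tensor_pow kappa)).
Proof.
have R0 := blockfun0 r; have R1 := blockfun1 irr_r; have RM := blockfunM irr_r.
have ind : jointly_independent (J := unit) (T := fun=> tensor_index kappa)
    (fun=> @tensor_pow kappa).
  move=> c hc [] a b.
  pose cx (i j : {ffun X -> S}) := if insub i is Some p then
    if insub j is Some q then c tt p q else 0 else 0.
  have cx0l i j : tags i != kappa -> cx i j = 0 by move=> ni; rewrite /cx insubN.
  have cx0r i j : tags j != kappa -> cx i j = 0.
    by move=> nj; rewrite /cx; case: (insub i) => // p; rewrite insubN.
  suff: cx (val a) (val b) = 0 by rewrite /cx !valK.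
  apply: (tensorfun_independent (blockfun_dual irr_r ineq_r) (c := cx)) => [b'|].
    rewrite -[RHS](hc [ffun x => b' x]) (big_pred1 tt) /=; last by case.
    rewrite -(@sum_tensor_index _ kappa); last first.
      by move=> i ni; rewrite big1 // => j _; rewrite cx0l ?mul0r.
    apply: eq_bigr => p _; rewrite -(@sum_tensor_index _ kappa); last first.
      by move=> j nj; rewrite cx0r ?mul0r.
    apply: eq_bigr => q _; rewrite /cx !valK; congr (_ * _).
    by apply: eq_bigr => x _; rewrite ffunE.
  by rewrite (eqP (valP a)) (eqP (valP b)).
have := @jointly_independent_irr _ _ _ _ (fun=> @tensor_pow kappa) ind tt.
apply.
  apply: mxof_hom => [a b|g h a b].
    rewrite -val_eqE -(tensorfun1 R1); apply: eq_bigr => x _.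
    by rewrite ffunE.
  rewrite /tensor_pow (@sum_tensor_index _ kappa (fun l =>
    tensorfun g (val a) l * tensorfun h l (val b))); last first.
    move=> l nl; rewrite (tensorfun0 R0) ?mulr0 ?mul0r //.
    by apply: contraNneq nl => <-; exact: valP a.
  rewrite -(tensorfunM RM); apply: eq_bigr => x _.
  by rewrite ffunE.
have d_gt0 k : (0 < d k)%N by case: (irr_r k).
pose i0 : {ffun X -> S} := [ffun x => Tagged (fun k => 'I_(d k)) (Ordinal (d_gt0 (kappa x)))].
have i0P : tags i0 == kappa by apply/eqP/ffunP => x; rewrite !ffunE.
by apply/card_gt0P; exists (Sub i0 i0P : tensor_index kappa).
Qed.

(** Without a nonzero intertwiner the two representations would have independent coefficients,
    whereas by [isotypic_coef] every coefficient of [tau] is a combination of those of the tensor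
    product. *)
Lemma tensor_pow_exhaustive (m : nat) (tau : {ffun X -> H} -> 'M[C]_m)
    (kappa : {ffun X -> K}) (f : forall x, 'M[C]_(m, d (kappa x))) :
  mxirr tau -> (forall x, f x != 0) ->
  (forall x h, tau (inj_at x h) *m f x = f x *m r (kappa x) h) ->
  exists2 T : 'M_(m, #|tensor_index kappa|),
    intertwines tau (mxof (@tensor_pow kappa)) T & T != 0.
Proof.
move=> irr_tau f0 fh.
have [P [P0 PE]] := isotypic_coef irr_r ineq_r irr_tau f0 fh.
apply: contrapT => no.
have [_ m_gt0 _] := irr_tau; pose a0 := Ordinal m_gt0.
suff /matrixP/(_ a0 a0)/eqP : delta_mx a0 a0 = 0 :> 'M[C]_m by rewrite !mxE !eqxx oner_eq0.
apply: (@inequiv_independent _ _ _ _ tau (mxof (@tensor_pow kappa)) _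
  (\matrix_(j, i) - P (val (enum_val i)) (val (enum_val j)) a0 a0)) => //.
- exact: tensor_pow_irr.
- by move=> T hT; apply: contrapT => /eqP T0; apply: no; exists T.
move=> b; rewrite [X in X + _](_ : _ = tau b a0 a0); last first.
  rewrite /mxtrace (bigD1 a0) //= mxE (bigD1 a0) //= mxE !eqxx mul1r.
  rewrite big1 ?addr0 => [|i ia]; last by rewrite mxE eqxx (negPf ia) mul0r.
  rewrite big1 ?addr0 // => i ia; rewrite mxE big1 // => j _.
  by rewrite mxE (negPf ia) mul0r.
apply/eqP; rewrite addr_eq0; apply/eqP.
rewrite PE summxE -(@sum_tensor_index _ kappa); last first.
  by move=> i ni; rewrite summxE big1 // => j _; rewrite P0 ?ni // scaler0 mxE.
transitivity (\sum_(p : tensor_index kappa) \sum_(q : tensor_index kappa)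
    tensorfun b (val p) (val q) * P (val p) (val q) a0 a0).
  apply: eq_bigr => p _; rewrite summxE -(@sum_tensor_index _ kappa); last first.
    by move=> j nj; rewrite P0 ?nj ?orbT // scaler0 mxE.
  by apply: eq_bigr => q _; rewrite mxE.
rewrite exchange_big /mxtrace -sumrN /=.
rewrite [RHS](reindex (@enum_rank (tensor_index kappa))) /=; last exact/onW_bij/enum_rank_bij.
apply: eq_bigr => q _; rewrite mxE -sumrN.
rewrite [RHS](reindex (@enum_rank (tensor_index kappa))) /=; last exact/onW_bij/enum_rank_bij.
by apply: eq_bigr => p _; rewrite !mxE !enum_rankK mulNr opprK mulrC.
Qed.

End PowerTensor.

(** * Every irreducible representation of the wreath product is induced *)

Section Exhaustion.
Variables (R : realType) (H : topologicalGroupType).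
Variables (gT : finGroupType) (X : finType) (to : {action gT &-> X}).
Local Notation C := R[i].
Local Notation G := (wreath H to).

Definition wbase (b : X -> H) : G := (b, 1%g).
Definition wtop (q : gT) : G := (fun=> 1%g, q).

Lemma wbaseM (b b' : X -> H) : wbase (fun x => b x * b' x)%g = (wbase b * wbase b')%g.
Proof.
congr pair; last by rewrite /= mulg1.
by apply/funext => x /=; rewrite invg1 left_act1.
Qed.

Lemma wtopM p q : wtop (p * q)%g = (wtop p * wtop q)%g.
Proof. by congr pair; apply/funext => x /=; rewrite mulg1. Qed.

Lemma wbase_top b q : (wbase b * wtop q = wtop q * wbase (fun x => b (to x q^-1)))%g.
Proof.
congr pair; last by rewrite /= mul1g mulg1.
by apply/funext => x /=; rewrite mulg1 mul1g /left_act invgK actK.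
Qed.

Lemma cont_wbase_inj_at x : continuous (fun h : H => wbase (inj_at x h)).
Proof.
move=> h; apply: (@continuous_pair _ {ptws X -> H} (discrete_topology gT)
  (fun h : H => inj_at x h : X -> H) (fun=> 1%g)); last exact: cvg_cst.
apply: cvg_ptws => y; rewrite /inj_at.
under eq_fun do rewrite ffunE; rewrite ffunE.
by case: (y == x); [exact: cvg_id | exact: cvg_cst].
Qed.

Lemma cont_linear_mulmx (T : topologicalType) n (M : T -> 'M[C]_n)
    (phi : {scalar 'cV[C]_n}) (v : 'cV[C]_n) :
  (forall i j, cont (fun t => M t i j)) -> cont (fun t => phi (M t *m v)).
Proof.
move=> cM; rewrite (_ : (fun t => _) =
  fun t => \sum_i (\sum_j M t i j * v j 0) * phi (delta_mx i 0)).
  apply: cont_sum => i _; apply: contM; last exact: cont_cst.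
  apply: cont_sum => j _; apply: contM; [exact: cM | exact: cont_cst].
apply/funext => t; rewrite {1}(matrix_sum_delta (M t *m v)) linear_sum.
by apply: eq_bigr => i _; rewrite big_ord1 linearZ /= mxE.
Qed.

Variables (K : finType) (d : K -> nat) (r : forall k, H -> 'M[C]_(d k)).
Hypothesis irr_r : forall k, mxirr (@r k).
Hypothesis ineq_r : forall k k' (T : 'M_(d k, d k')),
  intertwines (@r k) (@r k') T -> T != 0 -> k = k'.
Variable n : nat.
Hypothesis comp_r : forall m (sigma : H -> 'M[C]_m), (m <= n)%N ->
  mxirr sigma -> (forall i j, cont (fun h => sigma h i j)) ->
  exists k, exists2 T : 'M_(m, d k), intertwines sigma (@r k) T & T != 0.

Local Notation S := {k & 'I_(d k)}.
Local Notation tags := (tags (fun s : S => tag s)).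
Local Notation tensorfun := (tensorfun (blockfun r)).
Local Notation ltrans := (ltrans to).

Variables (N : nat) (pi : G -> 'M[C]_N).
Hypothesis N_le : (N <= n)%N.
Hypothesis irr_pi : mxirr pi.
Hypothesis cont_pi : forall i j, cont (fun g => pi g i j).

Local Notation V := {ffun {ffun X -> S} -> 'cV[C]_N}.

(** A homomorphism for the base group from the tensor product of [kappa] to the space of [pi], given
    on basis vectors and extended by zero so that all [kappa] share the type [V]. *)
Definition equivariant (kappa : {ffun X -> K}) (F : V) : Prop :=
  (forall i, tags i != kappa -> F i = 0) /\
  (forall (b : X -> H) i, pi (wbase b) *m F i = \sum_j tensorfun b j i *: F j).

Definition vtrans (q : gT) (F : V) : V :=
  [ffun i => pi (wtop q) *m F (ltrans q^-1%g i)].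

Let mx_of_tuple m p (v : p.-tuple 'cV[C]_m) : 'M[C]_(m, p) :=
  \matrix_(a, j) v`_j a 0.

Let mx_of_tupleE m p (v : p.-tuple 'cV[C]_m) (c : 'cV[C]_p) :
  mx_of_tuple v *m c = \sum_j c j 0 *: v`_j.
Proof.
apply/matrixP => a z; rewrite ord1 mxE summxE; apply: eq_bigr => j _.
by rewrite !mxE mulrC.
Qed.

Let mx_of_tuple_inj m p q (v : p.-tuple 'cV[C]_m) (T : 'M[C]_(p, q)) :
  free v -> mx_of_tuple v *m T = 0 -> T = 0.
Proof.
move=> fv vT; apply/matrixP => j l; rewrite mxE.
have : mx_of_tuple v *m col l T = 0 by rewrite colE mulmxA vT mul0mx.
rewrite mx_of_tupleE => /(congr1 (coord v j)).
by rewrite coord_sum_free // linear0 mxE.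
Qed.

Let mx_of_tuple_intertwines (T : Type) m p (v : p.-tuple 'cV[C]_m)
    (A : T -> 'M[C]_m) (sigma : T -> 'M[C]_p) :
  (forall t (j : 'I_p), A t *m v`_j = \sum_(i < p) sigma t i j *: v`_i) ->
  forall t, A t *m mx_of_tuple v = mx_of_tuple v *m sigma t.
Proof.
move=> Av t; apply/matrixP => a j.
have /matrixP/(_ a 0) := Av t j; rewrite summxE !mxE => E.
transitivity (\sum_k A t a k * v`_j k 0); first by apply: eq_bigr => k _; rewrite mxE.
by rewrite E; apply: eq_bigr => k _; rewrite !mxE mulrC.
Qed.

Let free_le m p (v : p.-tuple 'cV[C]_m) : free v -> (p <= m)%N.
Proof.
move=> /eqP; rewrite size_tuple => <-.
by apply: leq_trans (dimvS (subvf _)) _; rewrite dimvf /dim /= muln1.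
Qed.

(** An irreducible subspace for the base group is chosen in [pi], and in it one for each factor [H].
    Its degree is at most [N], so [comp_r] identifies it with some [r k], and
    [tensor_pow_exhaustive] assembles the factors. *)
Lemma equivariant_exists :
  exists kappa, exists2 F : V, equivariant kappa F & F != 0.
Proof.
have [[pi1 piM] N_gt0 _] := irr_pi.
have [|||||m [tau [v [irr_tau fv _ vE tauE]]]] := @irreducible_subspace C
  {ffun X -> H} 'cV[C]_N (fun b v => pi (wbase b) *m v) _ _ _ fullv.
- move=> v; rewrite -[RHS]mul1mx -pi1; congr (pi _ *m v).
  by congr pair; apply/funext => x; rewrite ffunE.
- move=> g h v; rewrite mulmxA -piM -wbaseM; congr (pi (wbase _) *m v).
  by apply/funext => x; rewrite ffunE.
- by move=> g a u v; rewrite mulmxDr scalemxAr.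
- by rewrite -dimv_eq0 dimvf /dim /= muln1 -lt0n.
- by move=> *; exact: memvf.
have m_le := free_le fv.
have [[tau1 tauM] m_gt0 _] := irr_tau.
(* Entries of [tau] are linear functionals of the action of [pi], hence continuous along each
   factor. *)
have cont_tau x i j : cont (fun h => tau (inj_at x h) i j).
  under eq_fun do rewrite tauE.
  apply: (@cont_linear_mulmx _ _ (fun h => pi (wbase (inj_at x h))) (coord v i)) => a b h.
  apply: (@continuous_comp _ _ _ (fun h : H => wbase (inj_at x h)) (fun g => pi g a b : C^o)).
    exact: cont_wbase_inj_at.
  exact: cont_pi.
have at_x x : exists k, exists2 f : 'M_(m, d k), f != 0 &
    forall h, tau (inj_at x h) *m f = f *m r k h.
  have [|||||m' [sigma [w [irr_s fw _ wE sE]]]] := @irreducible_subspace C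
    H 'cV[C]_m (fun h v => tau (inj_at x h) *m v) _ _ _ fullv.
  - move=> u; rewrite -[RHS]mul1mx -tau1; congr (tau _ *m u).
    by apply/ffunP => y; rewrite !ffunE if_same.
  - by move=> g h u; rewrite inj_atM tauM mulmxA.
  - by move=> g a u u'; rewrite mulmxDr scalemxAr.
  - by rewrite -dimv_eq0 dimvf /dim /= muln1 -lt0n.
  - by move=> *; exact: memvf.
  have cont_s i j : cont (fun h => sigma h i j).
    under eq_fun do rewrite sE.
    exact: (@cont_linear_mulmx _ _ (fun h => tau (inj_at x h)) (coord w i) _ (cont_tau x)).
  have m'_le : (m' <= n)%N by rewrite (leq_trans (free_le fw)) // (leq_trans m_le).
  have [k [T hT T0]] := comp_r m'_le irr_s cont_s.
  exists k, (mx_of_tuple w *m T).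
    by apply: contraNneq T0 => /(mx_of_tuple_inj fw) ->.
  move=> h; rewrite mulmxA.
  rewrite (mx_of_tuple_intertwines (A := fun h => tau (inj_at x h)) wE).
  by rewrite -mulmxA hT mulmxA.
have /boolp.choice [k0 at_k0] := at_x.
pose kappa : {ffun X -> K} := [ffun x => k0 x].
have at_kappa x : exists f : 'M_(m, d (kappa x)), f != 0 /\
    forall h, tau (inj_at x h) *m f = f *m r (kappa x) h.
  by rewrite /kappa ffunE; have [f f0 fh] := at_k0 x; exists f.
pose f x := projT1 (cid (at_kappa x)).
have f0 x : f x != 0 := (projT2 (cid (at_kappa x))).1.
have fh x := (projT2 (cid (at_kappa x))).2.
have [T hT T0] := tensor_pow_exhaustive irr_r ineq_r irr_tau f0 fh.
pose M := mx_of_tuple v *m T.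
have M0 : M != 0 by apply: contraNneq T0 => /(mx_of_tuple_inj fv) ->.
have hM (b : {ffun X -> H}) : pi (wbase b) *m M = M *m mxof (@tensor_pow _ _ _ _ _ r kappa) b.
  rewrite mulmxA (mx_of_tuple_intertwines (A := fun b : {ffun X -> H} => pi (wbase b)) vE).
  by rewrite -mulmxA hT mulmxA.
pose F : V := [ffun i =>
  if insub i is Some p then col (enum_rank (p : tensor_index d kappa)) M else 0].
have F0 i : tags i != kappa -> F i = 0 by move=> ni; rewrite ffunE insubN.
have FE (p : tensor_index d kappa) : F (val p) = col (enum_rank p) M.
  by rewrite ffunE valK.
exists kappa, F; last first.
  have /matrix0Pn [a [p Map]] := M0.
  apply: contraNneq Map => Fz; have := FE (enum_val p); rewrite Fz ffunE enum_valK.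
  by move=> /matrixP/(_ a 0); rewrite !mxE => <-.
split=> // b i.
have [ki|ki] := eqVneq (tags i) kappa; last first.
  rewrite F0 // mulmx0 big1 // => j _.
  have [kj|kj] := eqVneq (tags j) kappa; last by rewrite F0 // scaler0.
  by rewrite (tensorfun0 (blockfun0 r)) ?scale0r // kj eq_sym.
rewrite -(@sum_tensor_index X K d _ kappa (fun j => tensorfun b j i *: F j)); last first.
  by move=> j nj; rewrite F0 // scaler0.
pose p : tensor_index d kappa := Sub i (introT eqP ki).
rewrite (_ : i = val p) // FE colE mulmxA.
have -> : wbase b = wbase [ffun x => b x] by congr pair; apply/funext => x; rewrite ffunE.
rewrite hM -colE; apply/matrixP => a z; rewrite ord1 !mxE summxE.
rewrite [LHS](reindex (@enum_rank (tensor_index d kappa))) /=; last exact/onW_bij/enum_rank_bij.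
apply: eq_bigr => q _; rewrite FE !mxE !enum_rankK mulrC; congr (_ * _).
by apply: eq_bigr => x _; rewrite ffunE.
Qed.

Lemma vtrans_equivariant kappa q F :
  equivariant kappa F -> equivariant (ltrans q kappa) (vtrans q F).
Proof.
move=> [F0 Fb]; have [[pi1 piM] _ _] := irr_pi.
split=> [i ni|b i]; rewrite ffunE.
  rewrite F0 ?mulmx0 //; apply: contra ni => /eqP <-.
  by rewrite -tags_ltrans ltransKV.
rewrite mulmxA -piM wbase_top piM -mulmxA Fb mulmx_sumr.
rewrite [RHS](reindex_inj (bij_inj (ltrans_bij to S q))) /=.
apply: eq_bigr => j _; rewrite ffunE ltransK -scalemxAr; congr (_ *: _).
by rewrite -{2}(ltransKV to q i) tensorfun_ltrans.
Qed.

Lemma vtrans1 F : vtrans 1%g F = F.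
Proof.
apply/ffunP => i; rewrite ffunE invg1 ltrans1.
by have [[pi1 _] _ _] := irr_pi; rewrite -[RHS]mul1mx -pi1.
Qed.

Lemma vtransM p q F : vtrans (p * q)%g F = vtrans p (vtrans q F).
Proof.
apply/ffunP => i; rewrite !ffunE wtopM.
by have [[_ ->] _ _] := irr_pi; rewrite mulmxA invMg ltransM.
Qed.

Lemma vtransL q a u v : vtrans q (a *: u + v) = a *: vtrans q u + vtrans q v.
Proof. by apply/ffunP => i; rewrite !ffunE mulmxDr scalemxAr. Qed.

(** [sigma] is an irreducible subrepresentation of the space of homomorphisms from the tensor
    product of [kappa0] to [pi], on which [A] acts by [vtrans]. Every point [kappa0] of the orbit is
    allowed, so that a prescribed orbit representative can be used. *)
Lemma exhaustion : exists kappa : {ffun X -> K},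
  forall kappa0 (A : {group gT}), in_orbit to kappa kappa0 ->
  (forall q, q \in A -> ltrans q kappa0 = kappa0) ->
  exists e (sigma : discrete_topology [subg A] -> 'M[C]_e) (F : e.-tuple V),
  [/\ mxirr sigma, free F, forall k : 'I_e, equivariant kappa0 F`_k &
      forall (s : [subg A]) (k : 'I_e),
        vtrans (sgval s) F`_k = \sum_(l < e) sigma s l k *: F`_l].
Proof.
have [kappa [F1 F1e F1n0]] := equivariant_exists.
exists kappa => kappa0 A /in_orbitP [t tk] stabA.
have [||W WP] := @subspace_vspace C V (equivariant kappa0).
- split=> [i _|b i]; first by rewrite ffunE.
  by rewrite ffunE mulmx0 big1 // => j _; rewrite ffunE scaler0.
- move=> a u v [u0 ub] [v0 vb]; split=> [i ni|b i].
    by rewrite !ffunE u0 // v0 // scaler0 addr0.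
  rewrite !ffunE mulmxDr -scalemxAr ub vb scaler_sumr -big_split.
  by apply: eq_bigr => j _; rewrite !ffunE scalerDr !scalerA mulrC.
have W0 : W != 0%VS.
  apply: contraNneq F1n0 => W0.
  have /WP : equivariant kappa0 (vtrans t F1) by rewrite -tk; exact: vtrans_equivariant.
  rewrite W0 memv0 => /eqP tF.
  rewrite -(vtrans1 F1) -(mulVg t) vtransM tF.
  by apply/eqP/ffunP => i; rewrite !ffunE mulmx0.
have [||||e [sigma [F [irr_s fF FW FE _]]]] := @irreducible_subspace C
  (discrete_topology [subg A]) V (fun s F => vtrans (sgval s) F) _ _ _ W W0.
- by move=> F; exact: vtrans1.
- by move=> g h F; rewrite -vtransM.
- by move=> g a u v; exact: vtransL.
- move=> s F /WP Fe; apply/WP.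
  by rewrite -(stabA (sgval s) (subgP s)); exact: vtrans_equivariant.
by exists e, sigma, F; split=> // k; apply/WP; exact: FW.
Qed.

End Exhaustion.

(** * Counting irreducible representations *)

Section CountingIrreducibles.
Variable R : realType.
Local Notation C := R[i].

Section Classes.
Variable G : topologicalGroupType.

(** The matrix in [repr_equiv] intertwines in the opposite direction; between irreducible
    representations a nonzero intertwiner is invertible, so direction does not matter. *)
Lemma repr_equivP n (rho sigma : G -> 'M[C]_n) : mxirr rho -> mxirr sigma ->
  repr_equiv rho sigma <-> exists2 T, intertwines rho sigma T & T != 0.
Proof.
move=> irr irs; have [_ n_gt0 _] := irr; split=> [[A uA hA]|[T hT T0]].
  apply: (@intertwiner_sym _ _ _ _ sigma rho A) => //.
  apply/eqP => A0; have /matrixP/(_ (Ordinal n_gt0) (Ordinal n_gt0)) := mulmxV uA.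
  by rewrite A0 mul0mx !mxE eqxx => /esym/eqP; rewrite oner_eq0.
have [T' hT' T'0] := intertwiner_sym irr irs hT T0.
by exists T'; [exact: intertwiner_unit irs hT' T'0|].
Qed.

Lemma repr_equiv_refl n (rho : G -> 'M[C]_n) : repr_equiv rho rho.
Proof. by exists 1%:M => [|g]; rewrite ?unitmx1 // mul1mx mulmx1. Qed.

Lemma repr_equiv_sym n (rho sigma : G -> 'M[C]_n) :
  repr_equiv rho sigma -> repr_equiv sigma rho.
Proof.
case=> A uA hA; exists (invmx A) => [|g]; first by rewrite unitmx_inv.
by rewrite -[LHS](mulmxK uA) -(mulmxA (invmx A)) -hA mulKmx.
Qed.

Lemma repr_equiv_trans n (rho sigma tau : G -> 'M[C]_n) :
  repr_equiv rho sigma -> repr_equiv sigma tau -> repr_equiv rho tau.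
Proof.
case=> A uA hA [B uB hB]; exists (B *m A) => [|g].
  by rewrite unitmx_mul uB.
by rewrite -mulmxA hA mulmxA hB mulmxA.
Qed.

Lemma repr_equiv_class n (rho sigma : G -> 'M[C]_n) :
  repr_equiv rho sigma -> repr_equiv rho = repr_equiv sigma.
Proof.
move=> e; apply/funext => tau; apply/propext; split.
  by apply: repr_equiv_trans; exact: repr_equiv_sym.
exact: repr_equiv_trans.
Qed.

Lemma irr_class_representatives n : finite_set (@irr_classes R G n) ->
  exists rho : 'I_(irr_count R G n) -> G -> 'M[C]_n,
  [/\ forall j, is_irr (rho j),
      forall j j', repr_equiv (rho j) (rho j') -> j = j' &
      forall sigma, is_irr sigma -> exists j, repr_equiv (rho j) sigma].
Proof.
move=> fin; set s := fset_set (@irr_classes R G n).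
have sP A : (A \in s) = (A \in @irr_classes R G n) by rewrite in_fset_set.
have h (j : 'I_#|` s|) : exists2 rho : G -> 'M[C]_n, is_irr rho &
    repr_equiv rho = nth set0 s j.
  have : nth set0 s j \in s by rewrite mem_nth.
  by rewrite sP inE => -[rho]; exists rho.
exists (fun j => s2val (cid2 (h j))).
split=> [j|j j'|sigma irr].
- by case: cid2.
- case: cid2 => rho /= _ e; case: cid2 => rho' /= _ e' /repr_equiv_class.
  rewrite e e' => /eqP; rewrite nth_uniq ?fset_uniq //.
  by move/eqP; exact: val_inj.
have : repr_equiv sigma \in s by rewrite sP inE; exists sigma.
move=> sig; pose j : 'I_#|` s| := Ordinal (etrans (index_mem _ _) sig).
exists j; case: cid2 => rho /= _; rewrite nth_index // => ->.
exact: repr_equiv_refl.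
Qed.

Lemma irr_count_representatives n (J : finType) (rho : J -> G -> 'M[C]_n) :
  (forall j, is_irr (rho j)) ->
  (forall j j', repr_equiv (rho j) (rho j') -> j = j') ->
  (forall sigma, is_irr sigma -> exists j, repr_equiv (rho j) sigma) ->
  finite_set (@irr_classes R G n) /\ irr_count R G n = #|J|.
Proof.
move=> irr ineq comp; pose f j := repr_equiv (rho j).
have E : @irr_classes R G n = [set` [fset f j | j in J]%fset]%classic.
  apply/seteqP; split=> A /=.
    move=> [sigma /comp [j e] <-]; apply/imfsetP; exists j => //=.
    by rewrite /f (repr_equiv_class e).
  by move/imfsetP => [j _ ->]; exists (rho j).
split; first by rewrite E; exact: finite_fset.
rewrite /irr_count E set_fsetK card_imfset /= -?cardE // => j j' fj.
by apply: ineq; rewrite -/(f j) fj; exact: repr_equiv_refl.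
Qed.

(* Representatives of all the irreducible representations of degree at most n,
   possibly together with further ones. *)
Definition irr_system (n : nat) (K : finType) (d : K -> nat)
    (r : forall k, G -> 'M[C]_(d k)) : Prop :=
  [/\ forall k, mxirr (r k),
      forall k i j, cont (fun g => r k g i j),
      forall k k' (T : 'M_(d k, d k')), intertwines (r k) (r k') T -> T != 0 -> k = k' &
      forall m (sigma : G -> 'M[C]_m), (m <= n)%N -> mxirr sigma ->
        (forall i j, cont (fun g => sigma g i j)) ->
        exists k, exists2 T : 'M_(m, d k), intertwines sigma (r k) T & T != 0].

Lemma irr_system_exists n :
  (forall m, (0 < m)%N -> finite_set (@irr_classes R G m)) ->
  exists (K : finType) (d : K -> nat) (r : forall k, G -> 'M[C]_(d k)),
    irr_system n r /\ forall k, (d k <= n)%N.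
Proof.
move=> fin.
have fin' m : exists rho : 'I_(irr_count R G m) -> G -> 'M[C]_m, (0 < m)%N ->
    [/\ forall j, is_irr (rho j),
      forall j j', repr_equiv (rho j) (rho j') -> j = j' &
      forall sigma, is_irr sigma -> exists j, repr_equiv (rho j) sigma].
  (* A dummy in degree 0, where nothing is claimed. *)
  have [->|m_gt0] := posnP m; first by exists (fun _ _ => 0).
  by have [rho rhoP] := irr_class_representatives (fin m m_gt0); exists rho.
pose rho m := projT1 (cid (fin' m)).
have rhoP m : (0 < m)%N ->
    [/\ forall j, is_irr (rho m j),
      forall j j', repr_equiv (rho m j) (rho m j') -> j = j' &
      forall sigma, is_irr sigma -> exists j, repr_equiv (rho m j) sigma].
  exact: projT2 (cid (fin' m)).
clearbody rho.
(* The ordinal [m] stands for the degree [m.+1]. *)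
pose K : finType := {m : 'I_n & 'I_(irr_count R G m.+1)}.
exists K, (fun k : K => (tag k : 'I_n).+1), (fun k : K => rho (tag k : 'I_n).+1 (tagged k)).
have irr (k : K) : is_irr (rho (tag k : 'I_n).+1 (tagged k))
  by case: (rhoP (tag k : 'I_n).+1 isT) => irr _ _; exact: irr.
split; last by move=> k; exact: ltn_ord.
split.
- by move=> k; case/is_irrP: (irr k).
- by move=> k; case/is_irrP: (irr k).
- move=> k k' T hT T0.
  have [irk _] := (is_irrP _).1 (irr k); have [irk' _] := (is_irrP _).1 (irr k').
  have [kk'] := intertwiner_dim irk irk' hT T0.
  case: k k' irk irk' T hT T0 kk' => [m j] [m' j'] /= irk irk' T hT T0 kk'.
  have mm' : m = m' by exact: val_inj.
  subst m'; congr (Tagged _ _); have [_ ineq _] := rhoP m.+1 isT.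
  by apply: ineq; apply/repr_equivP => //; exists T.
move=> [|m] sigma mn irs cs; first by case: irs.
have [_ _ comp] := rhoP m.+1 isT.
have isig : is_irr sigma by apply/is_irrP.
have [j /repr_equiv_sym e] := comp sigma isig.
pose k : K := Tagged (fun m : 'I_n => 'I_(irr_count R G m.+1))
  (j : 'I_(irr_count R G (Ordinal mn).+1)).
exists k; apply/repr_equivP => //.
by have [] := (is_irrP _).1 (irr k).
Qed.

(** Completeness and inequivalence make the members of degree [m] a set of class representatives;
    exhibiting a system is thus a way to count. *)
Lemma irr_system_count n (K : finType) (d : K -> nat)
    (r : forall k, G -> 'M[C]_(d k)) m :
  irr_system n r -> (0 < m <= n)%N ->
  finite_set (@irr_classes R G m) /\ irr_count R G m = #|[pred k | d k == m]|.
Proof.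
move=> [irr cr ineq comp] /andP[m_gt0 mn].
pose J : finType := {k : K | d k == m}.
(* An equivalent representation by matrices of size literally [m], avoiding casts along
   [d k = m]. *)
have h (j : J) : exists rho : G -> 'M[C]_m, is_irr rho /\
    exists2 T, intertwines (r (val j)) rho T & T != 0.
  case: j => k /= /eqP <-; exists (r k); split.
    by apply/is_irrP.
  by apply/repr_equivP => //; exact: repr_equiv_refl.
pose rho j := projT1 (cid (h j)).
have irho j : is_irr (rho j) := (projT2 (cid (h j))).1.
have rT j : exists2 T, intertwines (r (val j)) (rho j) T & T != 0 := (projT2 (cid (h j))).2.
have mirr j : mxirr (rho j) by have [] := (is_irrP _).1 (irho j).
have int_sym p q (a : G -> 'M[C]_p) (b : G -> 'M[C]_q) :
    mxirr a -> mxirr b -> (exists2 T, intertwines a b T & T != 0) ->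
    exists2 T, intertwines b a T & T != 0.
  by move=> ia ib [T hT T0]; exact: intertwiner_sym ia ib hT T0.
have [||fin ->] := @irr_count_representatives m J rho irho.
- move=> j j' /(repr_equivP (mirr j) (mirr j')) e; apply: val_inj.
  have [T hT T0] : exists2 T, intertwines (r (val j)) (r (val j')) T & T != 0.
    apply: (intertwiner_trans (sigma := rho j) _ _ (rT j)) => //.
    apply: (intertwiner_trans (sigma := rho j') _ _ e) => //.
    exact: (int_sym _ _ _ _ _ _ (rT j')).
  exact: ineq hT T0.
- move=> sigma /is_irrP [irs cs]; have [k skE] := comp m sigma mn irs cs.
  have dk : d k == m by case: skE => T hT T0; rewrite (intertwiner_dim irs (irr k) hT T0).
  pose j : J := Sub k dk; exists j; apply/repr_equivP => //.
  apply: (intertwiner_trans (sigma := r k) _ _ (int_sym _ _ _ _ (irr k) (mirr j) (rT j))) => //.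
  exact: (int_sym _ _ _ _ irs (irr k) skE).
by split=> //; rewrite card_sub.
Qed.

Lemma irr_count_ge n (J : finType) (d : J -> nat) (r : forall j, G -> 'M[C]_(d j)) :
  (forall j, d j = n) -> (forall j, mxirr (r j)) ->
  (forall j a b, cont (fun g => r j g a b)) ->
  (forall j j' (T : 'M_(d j, d j')), intertwines (r j) (r j') T -> T != 0 -> j = j') ->
  finite_set (@irr_classes R G n) -> (#|J| <= irr_count R G n)%N.
Proof.
move=> dn irr cr ineq /irr_class_representatives [rho [irho _ comp]].
have mirr i : mxirr (rho i) by have [] := (is_irrP _).1 (irho i).
have h j : exists i, exists2 T, intertwines (r j) (rho i) T & T != 0.
  have gen m (s : G -> 'M[C]_m) : m = n -> mxirr s ->
      (forall a b, cont (fun g => s g a b)) ->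
      exists i, exists2 T, intertwines s (rho i) T & T != 0.
    move=> mn irs cs; subst m; have isig : is_irr s by apply/is_irrP.
    have [i /repr_equiv_sym e] := comp s isig.
    by exists i; apply/repr_equivP.
  exact: (gen _ (r j) (dn j) (irr j) (cr j)).
have [f fP] := boolp.choice h.
rewrite -[leqRHS]card_ord; apply: (@leq_card _ _ f) => j j' ff.
have [T hT T0] : exists2 T, intertwines (r j) (r j') T & T != 0.
  apply: (intertwiner_trans (sigma := rho (f j)) _ _ (fP j)) => //.
  have [T hT T0] := fP j'; rewrite ff.
  exact: intertwiner_sym hT T0.
exact: ineq hT T0.
Qed.

Lemma infinite_irr_family m c : ~ finite_set (@irr_classes R G m) ->
  exists (J : finType) (rho : J -> G -> 'M[C]_m),
  [/\ (c < #|J|)%N, forall j, mxirr (rho j),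
      forall j a b, cont (fun g => rho j g a b) &
      forall j j' (T : 'M_m), intertwines (rho j) (rho j') T -> T != 0 -> j = j'].
Proof.
move=> inf; have [B BA cB] := infinite_set_fset c.+1 inf.
have h (A : B) : exists2 rho : G -> 'M[C]_m, is_irr rho & repr_equiv rho = val A.
  by have [rho] := BA (val A) (valP A); exists rho.
pose rho A := s2val (cid2 (h A)).
have irho A : is_irr (rho A) by rewrite /rho; case: cid2.
have rhoE A : repr_equiv (rho A) = val A by rewrite /rho; case: cid2.
have mirr A : mxirr (rho A) by have [] := (is_irrP _).1 (irho A).
exists B, rho; split=> //; first by rewrite cardfE in cB.
- by move=> A; have [] := (is_irrP _).1 (irho A).
move=> A A' T hT T0; apply: val_inj; rewrite -!rhoE; apply: repr_equiv_class.
by apply/repr_equivP => //; exists T.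
Qed.

End Classes.

(** One diagonal coefficient from each of more than [#|gT|] inequivalent representations would give
    too many independent functions on the finite set [gT]. *)
Lemma finite_group_rigid (gT : finGroupType) : rigid R (discrete_topology gT).
Proof.
move=> m m_gt0; apply: contrapT => inf.
have [B [rho [cB mirr _ ineq]]] := infinite_irr_family #|gT| inf.
have ind := jointly_independent_mx mirr ineq.
pose a0 := Ordinal m_gt0.
pose M := \matrix_(A < #|B|, g < #|gT|) rho (enum_val A) (enum_val g) a0 a0.
have : kermx M != 0.
  rewrite kermx_eq0 /row_free neq_ltn; apply/orP; left.
  exact: leq_ltn_trans (rank_leq_col _) cB.
case/rowV0Pn => c /sub_kermxP cM /rV0Pn [A cA].
have := ind (fun A i j => c 0 (enum_rank A) * ((i == a0) && (j == a0))%:R) _ (enum_val A) a0 a0.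
rewrite enum_valK !eqxx mulr1 => c0; rewrite c0 ?eqxx // in cA => g.
have /matrixP/(_ 0 (enum_rank (g : gT))) := cM; rewrite !mxE => E; rewrite -[RHS]E.
rewrite [RHS](reindex (@enum_rank B)) /=; last exact/onW_bij/enum_rank_bij.
apply: eq_bigr => A' _; rewrite (bigD1 a0) //= [X in _ + X]big1 ?addr0.
  rewrite (bigD1 a0) //= [X in _ + X]big1 ?addr0.
    by rewrite ?eqxx ?mulr1 mxE !enum_rankK.
  by move=> j nj; rewrite (negPf nj) ?andbF mulr0 mul0r.
by move=> i ni; rewrite big1 // => j _; rewrite (negPf ni) mulr0 mul0r.
Qed.

End CountingIrreducibles.

(** * Stabilisers and orbits of maps *)

Section OrbitStabilizers.
Variables (gT : finGroupType) (X K : finType) (to : {action gT &-> X}).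
Implicit Types kappa : {ffun X -> K}.

Lemma ltrans_stab_group_set kappa : group_set [set q | ltrans to q kappa == kappa].
Proof.
apply/group_setP; split=> [|p q]; first by rewrite inE ltrans1.
by rewrite !inE ltransM => /eqP pk /eqP ->; rewrite pk.
Qed.

Definition map_stab kappa : {group gT} := Group (ltrans_stab_group_set kappa).

Lemma map_stabP kappa q : (q \in map_stab kappa) = (ltrans to q kappa == kappa).
Proof. by rewrite inE. Qed.

Definition map_part kappa : {set {set X}} := orbits_of to (map_stab kappa).

Lemma map_part_orbit kappa : map_part kappa \in orbit_partitions to.
Proof. by apply/imsetP; exists (map_stab kappa). Qed.

Lemma const_on_orbits kappa (A : {group gT}) :
  (A \subset map_stab kappa) =
  [forall x, forall y in orbit to A x, kappa y == kappa x].
Proof.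
apply/fintype.subsetP/forallP => [sA x|h q qA].
  apply/forall_inP => y /orbitP [q /sA]; rewrite map_stabP => /eqP/ffunP/(_ x).
  by rewrite ffunE => e <-; apply/eqP.
rewrite map_stabP; apply/eqP/ffunP => x; rewrite ffunE.
by apply/eqP; apply: (forall_inP (h x)); exact: mem_orbit.
Qed.

(** A stabiliser preserves its own orbits; conversely [kappa] is constant on them, so whatever
    preserves each of them fixes [kappa]. *)
Lemma stability_map_part kappa q :
  (q \in stability to (map_part kappa)) = (ltrans to q kappa == kappa).
Proof.
apply/idP/idP => [/bigcapP h|qk].
  apply/eqP/ffunP => x; rewrite ffunE.
  have /h : orbit to (map_stab kappa) x \in map_part kappa by exact: imset_f.
  move=> qN; have := orbit_refl to (map_stab kappa) x; rewrite -(astabs_act x qN) => xq.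
  have := const_on_orbits kappa (map_stab kappa).
  rewrite fintype.subxx => /esym/forallP/(_ x)/forall_inP.
  by move=> /(_ _ xq)/eqP.
apply/bigcapP => B /imsetP [x _ ->].
have /fintype.subsetP := atrans_acts (atrans_orbit to (map_stab kappa) x).
by apply; rewrite map_stabP.
Qed.

(** [pick] depends only on the set it picks from, so a whole orbit receives the same
    representative. *)
Definition orbit_rep kappa : {ffun X -> K} :=
  odflt kappa [pick k | in_orbit to kappa k].

Lemma orbit_repP kappa : in_orbit to kappa (orbit_rep kappa).
Proof. by rewrite /orbit_rep; case: pickP => //= _; exact: in_orbit_refl. Qed.

Lemma eq_orbit_rep kappa kappa' :
  in_orbit to kappa kappa' -> orbit_rep kappa = orbit_rep kappa'.
Proof.
move=> kk'; rewrite /orbit_rep; have /eq_pick -> : in_orbit to kappa =1 in_orbit to kappa'.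
  move=> l; apply/idP/idP; last exact: in_orbit_trans.
  by apply: in_orbit_trans; rewrite in_orbit_sym.
by case: pickP => // /(_ kappa'); rewrite in_orbit_refl.
Qed.

Lemma orbit_rep_idem kappa : orbit_rep (orbit_rep kappa) = orbit_rep kappa.
Proof. by apply/esym/eq_orbit_rep/orbit_repP. Qed.

End OrbitStabilizers.

Lemma cont_discrete (R : realType) (G : groupType)
    (f : discrete_topology G -> R[i]) : cont f.
Proof.
move=> x; apply: cvg_near_cst; have := @discrete_set1 (discrete_topology G) x.
by apply: (@filterS _ (nbhs x)) => y /= ->.
Qed.

(** By irreducibility the translates of one nonzero row span all rows, and there are at most [#|gT|]
    of them. *)
Lemma finite_irr_degree (C : numClosedFieldType) (gT : finGroupType) e
    (sigma : gT -> 'M[C]_e) : mxirr sigma -> (e <= #|gT|)%N.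
Proof.
move=> [_ e_gt0 irr]; pose r0 : 'rV[C]_e := delta_mx 0 (Ordinal e_gt0).
pose M := \matrix_(g < #|gT|) (r0 *m sigma (enum_val g)).
suff /eqP <- : row_free M^T by rewrite rank_leq_col.
apply: inj_row_free => v vM; have [|r00|v0] := irr r0 v^T.
- move=> g; have : row (enum_rank g) (M *m v^T) = 0.
    by rewrite -[M]trmxK -trmx_mul vM trmx0 row0.
  by rewrite row_mul rowK enum_rankK.
- by have /matrixP/(_ 0 (Ordinal e_gt0))/eqP := r00; rewrite !mxE !eqxx oner_eq0.
- by rewrite -[v]trmxK v0 trmx0.
Qed.

Section InducedContinuity.
Variables (R : realType) (H : topologicalGroupType).
Variables (gT : finGroupType) (X : finType) (to : {action gT &-> X}).
Local Notation C := R[i].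
Local Notation G := (wreath H to).

Lemma cont_discrete_comp (f : gT -> C) : cont (fun u : G => f u.2).
Proof.
move=> u; apply: (@continuous_comp G (discrete_topology gT) C^o snd f).
  exact: (@cvg_snd _ _ (nbhs u.1) (nbhs u.2)).
exact: cont_discrete.
Qed.

Lemma cont_eval (f : H -> C) x : cont f -> cont (fun u : G => f (u.1 x)).
Proof.
move=> cf u; apply: (@continuous_comp G H C^o (fun u : G => u.1 x) f); last exact: cf.
apply: (@continuous_comp G _ _ fst (fun b : {ptws X -> H} => b x)).
  exact: (@cvg_fst _ _ (nbhs u.1) (nbhs u.2)).
exact: (@proj_continuous _ (fun=> H) x u.1).
Qed.

(** The second component lies in a finite discrete group, so the coefficient is a finite sum of
    indicators of [q] times functions continuous in the first component. *)
Lemma induced_cont (K : finType) (d : K -> nat) (r : forall k, H -> 'M[C]_(d k))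
    (kappa : {ffun X -> K}) e (sigma : gT -> 'M[C]_e) a b :
  (forall k i j, cont (fun h => r k h i j)) ->
  cont (fun u : G => mxof (@induced_fun _ H _ _ to _ _ (fun s : {k & 'I_(d k)} => tag s)
    (blockfun r) kappa e sigma) u a b).
Proof.
move=> cont_r.
have cont_R s s' : cont (fun h => blockfun r h s s').
  rewrite /blockfun; case: eqP => _; last exact: cont_cst.
  exact: cont_r.
set p := enum_val a; set p' := enum_val b.
pose t q := sigma (cocycle to kappa q (tags (fun s : {k & 'I_(d k)} => tag s) (val p').1))
  (val p).2 (val p').2.
rewrite (_ : (fun u => _) = fun u : G => \sum_(q : gT) ((u.2 : gT) == q)%:R *
  (tensorfun (blockfun r) u.1 (val p).1 (ltrans to q (val p').1) * t q)).
  apply: cont_sum => q _; apply: contM.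
    exact: (@cont_discrete_comp (fun q' : gT => (q' == q)%:R)).
  apply: contM; last exact: (@cont_cst _ _ (t q)).
  apply: cont_prod => x _.
  exact: (@cont_eval (fun h => blockfun r h _ _) x (cont_R _ _)).
apply/funext => u; rewrite mxE (bigD1 u.2) //= eqxx mul1r big1 ?addr0 // => q nq.
by rewrite eq_sym (negPf nq) mul0r.
Qed.

End InducedContinuity.

(** * The list of irreducible representations of the wreath product *)

Section WreathSystem.
Variables (R : realType) (H : topologicalGroupType).
Variables (gT : finGroupType) (X : finType) (to : {action gT &-> X}).
Local Notation C := R[i].
Local Notation G := (wreath H to).
Local Notation Q P := (discrete_topology [subg stability to P]).

Variable n : nat.
Variables (K : finType) (d : K -> nat) (r : forall k, H -> 'M[C]_(d k)).
Hypothesis sys_r : irr_system n r.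

Variable n2 : nat.
Hypothesis n2_ge : (#|gT| <= n2)%N.
Variables (K2 : {set {set X}} -> finType) (d2 : forall P, K2 P -> nat).
Variable r2 : forall P (k : K2 P), Q P -> 'M[C]_(d2 k).
Hypothesis sys_r2 : forall P, irr_system n2 (@r2 P).

Local Notation S := {k & 'I_(d k)}.
Local Notation tg := (fun s : S => tag s).

Definition wreath_index : finType :=
  {kappa : {kappa : {ffun X -> K} | orbit_rep to kappa == kappa} &
     K2 (map_part to (val kappa))}.

Definition wi_map (j : wreath_index) : {ffun X -> K} := val (tag j).

Definition wi_sub (j : wreath_index) : K2 (map_part to (wi_map j)) := tagged j.

(** Outside the stability subgroup [subg] returns a default element, which is harmless since
    [stab_hom] constrains [sigma] on the stabiliser only. *)
Definition wi_sigma (j : wreath_index) (q : gT) : 'M[C]_(d2 (wi_sub j)) :=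
  r2 (wi_sub j) (subg (stability to (map_part to (wi_map j))) q).

Definition wi_basis (j : wreath_index) : finType :=
  @induced_index _ _ to _ _ tg (wi_map j) (d2 (wi_sub j)).

Definition wi_fun (j : wreath_index) : G -> wi_basis j -> wi_basis j -> C :=
  @induced_fun _ H _ _ to _ _ tg (blockfun r) (wi_map j) (d2 (wi_sub j)) (wi_sigma j).

Let irr_r : forall k, mxirr (r k). Proof. by case: sys_r. Qed.
Let ineq_r : forall k k' (T : 'M_(d k, d k')),
  intertwines (r k) (r k') T -> T != 0 -> k = k'.
Proof. by case: sys_r. Qed.

Let R0 := blockfun0 r.
Let R1 := blockfun1 irr_r.
Let RM := blockfunM irr_r.
Let Rd := blockfun_dual irr_r ineq_r.

(** Different representatives lie in different orbits; over one representative, the listed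
    representations of its stability subgroup have independent coefficients. *)
Lemma wi_fun_independent : jointly_independent wi_fun.
Proof.
apply: (@induced_independent _ H _ _ to _ _ tg (blockfun r) Rd wreath_index wi_map
  (fun j => d2 (wi_sub j)) wi_sigma).
- move=> [[kappa /= kr] k] [[kappa' /= kr'] k']; rewrite /wi_map /= => /eq_orbit_rep.
  by rewrite (eqP kr) (eqP kr').
move=> [kappa0 k0] c hc.
have [irr2 _ ineq2 _] := sys_r2 (map_part to (val kappa0)).
have ind := jointly_independent_mx irr2 ineq2.
apply: (ind (fun k => c (Tagged (fun kappa => K2 (map_part to (val kappa))) k))) => s.
have sP : ltrans to (sgval s) (val kappa0) = val kappa0.
  by apply/eqP; rewrite -stability_map_part; exact: subgP.
rewrite -[RHS](hc (sgval s) sP) [RHS]big_mkcond.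
rewrite [RHS](@sum_Tagged _ {kappa : {ffun X -> K} | orbit_rep to kappa == kappa}
  (fun kappa => K2 (map_part to (val kappa)))) /= [RHS](bigD1 kappa0) //=.
rewrite [X in _ = _ + X]big1 ?addr0; last first.
  move=> kappa nk; rewrite big1 // => k _; rewrite /wi_map /= val_eqE.
  by rewrite (negPf nk).
apply: eq_bigr => k _; rewrite /wi_map /= eqxx.
by apply: eq_bigr => a _; apply: eq_bigr => b _; rewrite /wi_sigma /= sgvalK.
Qed.

Lemma wi_sigma_hom j : stab_hom to (wi_map j) (wi_sigma j).
Proof.
have [irr2 _ _ _] := sys_r2 (map_part to (wi_map j)).
have [[s1 sM] _ _] := irr2 (wi_sub j).
split=> [|p q pk qk]; rewrite /wi_sigma.
  by rewrite -[RHS]s1; congr r2; apply: val_inj; rewrite /= subgK ?group1.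
rewrite -sM subgM //; rewrite stability_map_part; exact/eqP.
Qed.

Lemma wi_fun_irr j : mxirr (mxof (@wi_fun j)).
Proof.
apply: (jointly_independent_irr wi_fun_independent).
  exact: (induced_hom R0 R1 RM (wi_sigma_hom j)).
have d_gt0 k : (0 < d k)%N by case: (irr_r k).
have [irr2 _ _ _] := sys_r2 (map_part to (wi_map j)).
have [_ d2_gt0 _] := irr2 (wi_sub j).
pose i0 : {ffun X -> S} := [ffun x => Tagged (fun k => 'I_(d k)) (Ordinal (d_gt0 (wi_map j x)))].
have i0P : in_orbit to (wi_map j) (tags tg i0).
  suff -> : tags tg i0 = wi_map j by exact: in_orbit_refl.
  by apply/ffunP => x; rewrite !ffunE.
by apply/card_gt0P; exists (exist _ (i0, Ordinal d2_gt0) i0P).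
Qed.

Lemma wi_fun_cont j a b : cont (fun u => mxof (@wi_fun j) u a b).
Proof. by apply: induced_cont; case: sys_r. Qed.

(** Completeness is [exhaustion] followed by Frobenius reciprocity. The bound [n] limits what is
    needed from [H], while [n2_ge] makes the lists for the stability subgroups complete. *)
Lemma wreath_system : irr_system n (fun j => mxof (@wi_fun j)).
Proof.
split.
- exact: wi_fun_irr.
- exact: wi_fun_cont.
- by move=> j j' T; exact: (jointly_independent_inequiv wi_fun_independent).
move=> m pi mn irr_pi cont_pi.
have [_ _ _ comp_r] := sys_r.
have [kappa ex] := exhaustion irr_r ineq_r comp_r mn irr_pi cont_pi.
pose kappa0 := orbit_rep to kappa.
have [||e [sigma [F [irr_s fF Feq Ftop]]]] := ex kappa0 (stability to (map_part to kappa0)).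
- exact: orbit_repP.
- by move=> q; rewrite stability_map_part => /eqP.
have [irr2 _ _ comp2] := sys_r2 (map_part to kappa0).
have e_le : (e <= n2)%N.
  apply: leq_trans n2_ge; apply: leq_trans (finite_irr_degree irr_s) _.
  by rewrite card_sub; exact: max_card.
have cont_s i j : cont (fun g => sigma g i j).
  exact: cont_discrete.
have [k [T hT T0]] := comp2 e sigma e_le irr_s cont_s.
have kr : orbit_rep to kappa0 == kappa0 by rewrite orbit_rep_idem.
pose kappa1 : {kappa : {ffun X -> K} | orbit_rep to kappa == kappa} := exist _ kappa0 kr.
pose j : wreath_index :=
  Tagged (fun kappa : {kappa : {ffun X -> K} | orbit_rep to kappa == kappa} =>
     K2 (map_part to (val kappa))) (k : K2 (map_part to (val kappa1))).
(* [F] recombined along [T], from [sigma] to the equivalent listed representation. *)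
pose F' (a : 'I_(d2 k)) (i : {ffun X -> S}) : 'cV[C]_m := \sum_(l < e) T l a *: F`_l i.
exists j, (frobenius_mx tg pi kappa0 F').
  apply: (frobenius_intertwines R0) => //.
  - by case: irr_pi.
  - move=> b a i; rewrite mulmx_sumr.
    transitivity (\sum_l T l a *: (pi (wbase to b) *m F`_l i)).
      by apply: eq_bigr => l _; rewrite scalemxAr.
    under eq_bigr do rewrite (Feq _).2 scaler_sumr.
    rewrite exchange_big; apply: eq_bigr => i' _; rewrite scaler_sumr.
    by apply: eq_bigr => l _; rewrite !scalerA mulrC.
  - move=> q a i qk; rewrite mulmx_sumr.
    pose s := subg (stability to (map_part to kappa0)) q.
    have qs : q = sgval s by rewrite subgK // stability_map_part; apply/eqP.
    have Fq (l : 'I_e) : pi (wtop H to q) *m F`_l i =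
        \sum_(l' < e) sigma s l' l *: F`_l' (ltrans to q i).
      have := Ftop s l; rewrite -qs => /ffunP/(_ (ltrans to q i)).
      rewrite ffunE ltransK => ->; rewrite sum_ffunE.
      by apply: eq_bigr => l' _; rewrite ffunE.
    transitivity (\sum_l T l a *: \sum_(l' < e) sigma s l' l *: F`_l' (ltrans to q i)).
      by apply: eq_bigr => l _; rewrite -Fq scalemxAr.
    transitivity (\sum_(l' < e) (sigma s *m T) l' a *: F`_l' (ltrans to q i)).
      under eq_bigr do rewrite scaler_sumr.
      rewrite exchange_big; apply: eq_bigr => l' _; rewrite mxE scaler_suml.
      by apply: eq_bigr => l _; rewrite scalerA mulrC.
    rewrite hT; under [RHS]eq_bigr do rewrite scaler_sumr.
    rewrite [RHS]exchange_big; apply: eq_bigr => l' _; rewrite mxE scaler_suml.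
    by apply: eq_bigr => b _; rewrite scalerA mulrC.
apply: frobenius_mx_neq0.
- by case: irr_pi.
- move=> a i ni; rewrite /F' big1 // => l _.
  by rewrite (Feq l).1 // scaler0.
(* If [F'] vanished, a nonzero column of [T] would be a relation in the free family [F]. *)
have /matrix0Pn [l [a Tla]] := T0.
exists a; apply: contrapT => no.
have Fz : \sum_l T l a *: F`_l = 0.
  apply/ffunP => i; rewrite sum_ffunE [RHS]ffunE.
  transitivity (F' a i); first by apply: eq_bigr => l' _; rewrite ffunE.
  by apply: contrapT => /eqP nz; apply: no; exists i.
have := coord_sum_free (fun l => T l a) l fF.
by rewrite Fz linear0 => /esym/eqP; rewrite (negPf Tla).
Qed.

End WreathSystem.

(** * Orbit sizes and degrees *)

Section OrbitSizes.
Variables (gT : finGroupType) (X K : finType) (to : {action gT &-> X}).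
Implicit Types kappa : {ffun X -> K}.
Local Notation index kappa := #|[set: gT] : stability to (map_part to kappa)|%g.

Let rtrans kappa (q : gT) : {ffun X -> K} := ltrans to q^-1%g kappa.

Let rtrans1 : rtrans^~ 1%g =1 id.
Proof. by move=> k; rewrite /rtrans invg1 ltrans1. Qed.

Let rtransM k : act_morph rtrans k.
Proof. by move=> p q; rewrite /rtrans invMg ltransM. Qed.

Lemma card_in_orbit kappa : #|[pred k | in_orbit to kappa k]| = index kappa.
Proof.
pose toK := TotalAction rtrans1 rtransM.
transitivity #|orbit toK [set: gT] kappa|.
  apply: eq_card => k; rewrite inE; apply/in_orbitP/orbitP => [[q <-]|[q _ <-]].
    by exists q^-1%g; rewrite ?inE //= /rtrans invgK.
  by exists q^-1%g.
rewrite card_orbit; congr #|_ : _|%g.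
apply/setP => q; rewrite stability_map_part finset.in_setI finset.in_setT /=.
apply/astab1P/eqP => /= h; last by rewrite /rtrans -{1}h ltransK.
by rewrite -{1}h /rtrans ltransKV.
Qed.

Lemma index_ltrans kappa q : index (ltrans to q kappa) = index kappa.
Proof.
rewrite -!card_in_orbit; apply: eq_card => k; rewrite !inE.
by rewrite in_orbit_sym in_orbit_ltrans in_orbit_sym.
Qed.

(** The orbit of [kappa] has [index kappa] elements, so the weights on each orbit add up to one. *)
Lemma sum_orbit_reps (V : lmodType rat) (f : {ffun X -> K} -> V) :
  (forall kappa q, f (ltrans to q kappa) = f kappa) ->
  \sum_(kappa | orbit_rep to kappa == kappa) f kappa =
  \sum_kappa (index kappa)%:R^-1 *: f kappa.
Proof.
move=> f_inv.
rewrite [RHS](partition_big (orbit_rep to) (fun k => orbit_rep to k == k)); last first.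
  by move=> k _; rewrite orbit_rep_idem.
apply: eq_bigr => k0 /eqP k0r.
transitivity (\sum_(k | in_orbit to k0 k) (index k0)%:R^-1 *: f k0).
  rewrite sumr_const card_in_orbit scalerMnl -(mulr_natr _^-1) mulVf ?scale1r //.
  by rewrite pnatr_eq0 -lt0n indexg_gt0.
apply: eq_big => [k|k /in_orbitP [q <-]]; last by rewrite index_ltrans f_inv.
apply/idP/eqP => [/eq_orbit_rep <-|<-]; first by [].
by rewrite in_orbit_sym orbit_repP.
Qed.

End OrbitSizes.

Section Degrees.
Variables (gT : finGroupType) (X K : finType) (to : {action gT &-> X}).
Variable d : K -> nat.
Implicit Types kappa : {ffun X -> K}.
Local Notation S := {k & 'I_(d k)}.
Local Notation tags := (tags (fun s : S => tag s)).

Lemma prod_ltrans kappa q : \prod_x d (ltrans to q kappa x) = \prod_x d (kappa x).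
Proof.
rewrite [RHS](reindex (fun x => to x q)) /=; last first.
  by exists (fun x => to x q^-1%g) => x _; rewrite ?actK ?actKV.
by apply: eq_bigr => x _; rewrite ffunE.
Qed.

Lemma card_tags kappa : #|[pred i : {ffun X -> S} | tags i == kappa]| = (\prod_x d (kappa x))%N.
Proof.
transitivity (\sum_(i : {ffun X -> S}) \prod_x (tag (i x) == kappa x))%N.
  rewrite -sum1_card big_mkcond; apply: eq_bigr => i _ /=.
  rewrite inE; have [<-|ik] := eqVneq (tags i) kappa.
    by rewrite big1 // => x _; rewrite ffunE eqxx.
  have /existsP [x nx] : [exists x, tag (i x) != kappa x].
    apply: contraNT ik; rewrite negb_exists => /forallP h; apply/eqP/ffunP => x.
    by rewrite ffunE; apply/eqP/negPn.
  by rewrite (bigD1 x) //= (negPf nx).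
rewrite -(bigA_distr_bigA (fun x (s : S) => tag s == kappa x : nat)).
apply: eq_bigr => x _; rewrite sum_Tagged (bigD1 (kappa x)) //= [X in _ + X]big1 ?addr0.
  by rewrite eqxx sum_nat_const card_ord muln1.
by move=> k nk; rewrite big1 // => j _; rewrite (negPf nk).
Qed.

Lemma card_induced_index kappa e :
  #|induced_index to (fun s : S => tag s) kappa e| =
  (#|[set: gT] : stability to (map_part to kappa)|%g * (\prod_x d (kappa x)) * e)%N.
Proof.
rewrite card_sig -sum1_card.
transitivity (\sum_(i | in_orbit to kappa (tags i)) \sum_(l < e) 1)%N.
  by rewrite pair_big; apply: eq_bigl => p; rewrite inE andbT.
under eq_bigr do rewrite sum_nat_const card_ord muln1.
rewrite (partition_big tags (in_orbit to kappa)) //=.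
transitivity (\sum_(k | in_orbit to kappa k) (\prod_x d (kappa x)) * e)%N.
  apply: eq_bigr => k /in_orbitP [q <-].
  rewrite -(prod_ltrans kappa q) -card_tags -sum_nat_const.
  apply: eq_bigl => i; rewrite inE; apply: andb_idl => /eqP ->.
  by apply/in_orbitP; exists q.
by rewrite sum_nat_const card_in_orbit mulnA.
Qed.

End Degrees.

(** * Invariance under isomorphism of groups *)

Section Transport.
Variable R : realType.

Lemma irr_system_transport (G G' : topologicalGroupType) (f : G -> G') (g : G' -> G)
    n (K : finType) (d : K -> nat) (r : forall k, G -> 'M[R[i]]_(d k)) :
  cancel f g -> cancel g f ->
  (forall x y, g (x * y)%g = (g x * g y)%g) -> (forall x y, f (x * y)%g = (f x * f y)%g) ->
  continuous f -> continuous g ->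
  irr_system n r -> irr_system n (fun k (x : G') => r k (g x)).
Proof.
move=> fK gK gM fM cf cg [irr cr ineq comp].
have morph1 (A B : groupType) (h : A -> B) :
    (forall x y, h (x * y)%g = (h x * h y)%g) -> h 1%g = 1%g.
  by move=> hM; have := hM 1%g 1%g; rewrite mulg1 => h1; rewrite -(mulVg (h 1%g)) {3}h1 mulKg.
have pull (A B : groupType) (h : A -> B) m (s : B -> 'M[R[i]]_m) :
    (forall x y, h (x * y)%g = (h x * h y)%g) -> (forall y, exists x, h x = y) ->
    mxirr s -> mxirr (fun x => s (h x)).
  move=> hM sur [[s1 sM] m_gt0 irs]; split=> //.
    by split=> [|x y]; rewrite ?morph1 // hM sM.
  by move=> rr v rv; apply: irs => y; have [x <-] := sur y; exact: rv.
split.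
- by move=> k; apply: pull => // y; exists (f y).
- move=> k i j x; apply: (@continuous_comp _ _ _ g (fun y => r k y i j : R[i]^o)) => //.
    exact: cg.
  exact: (cr k i j (g x)).
- move=> k k' T hT; apply: ineq => x; have := hT (f x); by rewrite fK.
move=> m s mn irs cs.
have [||k [T hT T0]] := comp m (fun x => s (f x)) mn.
- by apply: pull => // y; exists (g y).
- move=> i j x; apply: (@continuous_comp _ _ _ f (fun y => s y i j : R[i]^o)) => //.
    exact: cf.
  exact: (cs i j (f x)).
by exists k, T => // x; have := hT (g x); rewrite gK.
Qed.

Lemma irr_count_transport (G G' : topologicalGroupType) (f : G -> G') (g : G' -> G) m :
  cancel f g -> cancel g f ->
  (forall x y, g (x * y)%g = (g x * g y)%g) -> (forall x y, f (x * y)%g = (f x * f y)%g) ->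
  continuous f -> continuous g -> rigid R G ->
  (0 < m)%N -> irr_count R G m = irr_count R G' m.
Proof.
move=> fK gK gM fM cf cg rig m_gt0.
have [K [d [r [sys _]]]] := irr_system_exists m rig.
have sys' := irr_system_transport fK gK gM fM cf cg sys.
have m0 : (0 < m <= m)%N by rewrite m_gt0 leqnn.
by rewrite (irr_system_count sys m0).2 (irr_system_count sys' m0).2.
Qed.

Lemma discrete_continuous (G G' : groupType)
    (f : discrete_topology G -> discrete_topology G') : continuous f.
Proof.
move=> x; apply: cvg_near_cst; have := @discrete_set1 (discrete_topology G) x.
by apply: (@filterS _ (nbhs x)) => y /= ->.
Qed.

(** Maps in one orbit have conjugate stability subgroups; equality of these counts makes their
    contributions equal, as the averaging over orbits requires. *)
Lemma irr_count_conjugate (gT : finGroupType) (A B : {group gT}) q m :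
  (B :=: A :^ q)%g -> (0 < m)%N ->
  irr_count R (discrete_topology [subg A]) m = irr_count R (discrete_topology [subg B]) m.
Proof.
move=> BA; have AB : (A :=: B :^ q^-1)%g by rewrite BA conjsgK.
pose f (x : [subg A]) : [subg B] := subg B (sgval x ^ q)%g.
pose g (x : [subg B]) : [subg A] := subg A (sgval x ^ q^-1)%g.
have fE x : sgval (f x) = (sgval x ^ q)%g by rewrite subgK // BA memJ_conjg subgP.
have gE x : sgval (g x) = (sgval x ^ q^-1)%g by rewrite subgK // AB memJ_conjg subgP.
apply: (@irr_count_transport _ _ (f : discrete_topology [subg A] -> discrete_topology [subg B]) g).
- by move=> x; apply: val_inj; rewrite /= gE fE conjgK.
- by move=> x; apply: val_inj; rewrite /= fE gE conjgKV.
- by move=> x y; apply: val_inj; rewrite /= !gE conjMg.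
- by move=> x y; apply: val_inj; rewrite /= !fE conjMg.
- exact: discrete_continuous.
- exact: discrete_continuous.
- exact: finite_group_rigid.
Qed.

End Transport.

(** * Dirichlet series as matrices *)

Section DirichletMatrices.
Variable n : nat.
Local Notation N := n.+1.

(* Truncation of Dirichlet series at n+1, turning Dirichlet multiplication into
   matrix multiplication: rows and columns are indexed by 1, ..., n+1. *)
Definition dmx (a : dirichlet) : 'M[rat]_N :=
  \matrix_(i, j) (if (i.+1 %| j.+1)%N then a (j.+1 %/ i.+1)%N else 0).

(** The first row of the matrix consists of the coefficients themselves. *)
Lemma dmxP a b : dmx a = dmx b <-> forall m, (0 < m <= N)%N -> a m = b m.
Proof.
split=> [/matrixP ab [|m] // mn|ab].
  by have := ab ord0 (Ordinal (mn : (m < N)%N)); rewrite !mxE dvd1n divn1.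
apply/matrixP => i j; rewrite !mxE; case: ifP => // ij.
apply: ab; rewrite divn_gt0 // dvdn_leq //=.
by apply: leq_trans (leq_div _ _) (ltn_ord j).
Qed.

Lemma dmx_is_additive : zmod_morphism dmx.
Proof.
move=> a b; apply/matrixP => i j; rewrite !mxE; case: ifP => _; last by rewrite subr0.
by [].
Qed.

HB.instance Definition _ := GRing.isZmodMorphism.Build dirichlet 'M[rat]_N dmx dmx_is_additive.

Lemma dmx_one : dmx dirichlet_one = 1.
Proof.
apply/matrixP => i j; rewrite !mxE /dirichlet_one.
case: ifP => [/dvdnP [k E]|nij].
  rewrite E mulnK // -val_eqE /= -[in RHS](inj_eq succn_inj) E.
  by rewrite -{1}[i.+1]mul1n eqn_mul2r /= eq_sym.
by case: eqP nij => // ->; rewrite dvdnn.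
Qed.

(** Indices [k] with [i.+1 %| k.+1 %| j.+1] correspond to the divisors [k.+1 %/ i.+1] of the
    quotient. Truncation loses nothing, as divisors of [j.+1] are at most [j.+1]. *)
Lemma dmx_mul a b : dmx (dirichlet_mul a b) = dmx a * dmx b.
Proof.
apply/matrixP => i j; rewrite [RHS]mxE !mxE.
pose P (k : 'I_N) := (i.+1 %| k.+1)%N && (k.+1 %| j.+1)%N.
transitivity (\sum_(k | P k) a (k.+1 %/ i.+1)%N * b (j.+1 %/ k.+1)%N); last first.
  rewrite [RHS](bigID P) /= [X in _ = _ + X]big1 ?addr0.
    by apply: eq_bigr => k /andP[ik kj]; rewrite !mxE ik kj.
  move=> k; rewrite !mxE negb_and => /orP[] /negPf ->; first by rewrite mul0r.
  by rewrite mulr0.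
case: ifP => [ij|nij]; last first.
  by rewrite big1 // => k /andP[ik kj]; rewrite (dvdn_trans ik kj) in nij.
have [m jm] := dvdnP ij; have m_gt0 : (0 < m)%N by case: m jm.
rewrite /dirichlet_mul jm mulnK //.
have pe : perm_eq (divisors m) [seq (k.+1 %/ i.+1)%N |
    k : 'I_N <- [seq k <- index_enum ('I_N : finType) | P k]].
  apply: uniq_perm; first exact: divisors_uniq.
    rewrite map_inj_in_uniq ?filter_uniq ?index_enum_uniq //.
    move=> k l; rewrite !mem_filter => /andP[/andP[ik _] _] /andP[/andP[il _] _] e.
    by apply: val_inj; apply: succn_inj; rewrite -(divnK ik) e divnK.
  move=> e; rewrite -dvdn_divisors //; apply/idP/mapP => [em|[k]].
    have e_gt0 : (0 < e)%N by apply: dvdn_gt0 em.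
    have kN : ((e * i.+1).-1 < N)%N.
      rewrite prednK ?muln_gt0 ?e_gt0 //; apply: leq_trans (ltn_ord j).
      by rewrite jm leq_mul2r dvdn_leq ?orbT.
    have kE : (Ordinal kN).+1 = (e * i.+1)%N by rewrite /= prednK // muln_gt0 e_gt0.
    exists (Ordinal kN); last by rewrite kE mulnK.
    rewrite mem_filter mem_index_enum /P kE dvdn_mull //= jm.
    by rewrite dvdn_mul.
  rewrite mem_filter => /andP[/andP[ik kj] _] ->.
  by rewrite -(@dvdn_pmul2r i.+1) // divnK // -jm.
rewrite (perm_big _ pe) big_map big_filter; apply: eq_bigr => k /andP[ik kj].
by congr (_ * b _); rewrite -[X in _ = (_ %/ X)%N](divnK ik) divnMr.
Qed.

(** The truncation of m^-s, which is zero once [m] exceeds [N]. *)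
Definition dpow (m : nat) : 'M[rat]_N := dmx (fun k => (k == m)%:R).

Lemma dpowE m i j : (0 < m)%N -> dpow m i j = ((i.+1 * m)%N == j.+1)%:R.
Proof.
move=> m_gt0; rewrite !mxE; case: ifP => [/dvdnP [k E]|nij].
  by rewrite E mulnK // mulnC eqn_mul2r /= eq_sym.
by case: eqP nij => // <-; rewrite dvdn_mulr.
Qed.

Lemma dpowM m m' : (0 < m)%N -> (0 < m')%N -> dpow (m * m') = dpow m * dpow m'.
Proof.
move=> m_gt0 m'_gt0; apply/matrixP => i j; rewrite dpowE ?muln_gt0 ?m_gt0 // mxE.
have [im|im] := leqP (i.+1 * m) N.
  have i_gt0 : (0 < i.+1 * m)%N by rewrite muln_gt0.
  have kN : ((i.+1 * m).-1 < N)%N by rewrite prednK.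
  rewrite (bigD1 (Ordinal kN)) //= [X in _ + X]big1 ?addr0.
    by rewrite !dpowE //= prednK // eqxx mul1r mulnA.
  move=> k nk; rewrite dpowE //; case: eqP => [e|_]; last by rewrite mul0r.
  by case/eqP: nk; apply: val_inj; rewrite /= e.
(* Both sides vanish when [i.+1 * m] passes the truncation bound. *)
rewrite big1 => [|k _].
  case: eqP => // e; have := ltn_ord j; rewrite -ltnS -e ltnNge.
  by rewrite mulnA (leq_trans im) // leq_pmulr.
rewrite dpowE //; case: eqP => [e|_]; last by rewrite mul0r.
by move: im; rewrite e ltnNge (ltn_ord k).
Qed.

Lemma dpow1 : dpow 1 = 1. Proof. exact: dmx_one. Qed.

Lemma dpow_prod (I : finType) (P : pred I) (f : I -> nat) :
  (forall i, P i -> 0 < f i)%N ->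
  dpow (\prod_(i | P i) f i) = \prod_(i | P i) dpow (f i).
Proof.
move=> f_gt0.
suff [] : (0 < \prod_(i | P i) f i)%N /\
    dpow (\prod_(i | P i) f i) = \prod_(i | P i) dpow (f i) by [].
elim/big_rec2: _ => [|i y x Pi [x_gt0 <-]]; first by rewrite dpow1.
by rewrite muln_gt0 f_gt0 // x_gt0 dpowM // f_gt0.
Qed.

Lemma dmx_monom1 m : (0 < m)%N -> dmx (dirichlet_monom1 m) = m%:R^-1 *: dpow m.
Proof.
move=> m_gt0; apply/matrixP => i j; rewrite !mxE /dirichlet_monom1.
by case: ifP => _; rewrite ?mulr0 // mulrC.
Qed.

Lemma dmx_prod (I : finType) (P : pred I) (a : I -> dirichlet) :
  dmx (\big[dirichlet_mul/dirichlet_one]_(i | P i) a i) = \prod_(i | P i) dmx (a i).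
Proof. exact: (big_morph dmx dmx_mul dmx_one). Qed.

Lemma dmx_count (K : finType) (f : K -> nat) (a : dirichlet) :
  (forall m, (0 < m <= N)%N -> a m = #|[pred k | f k == m]|%:R) ->
  dmx a = \sum_k dpow (f k).
Proof.
move=> aE; rewrite -raddf_sum; apply/dmxP => m mN; rewrite aE //.
rewrite -sum1_card natr_sum big_mkcond.
rewrite (_ : (\sum_k (fun l => (l == f k)%:R) : dirichlet) m = \sum_k (m == f k)%:R).
  by apply: eq_bigr => k _; rewrite inE eq_sym; case: eqP.
by elim/big_rec2: _ => // k y x _ <-.
Qed.

End DirichletMatrices.

(** * Moebius inversion over orbit partitions *)

Section Moebius.
Variables (gT : finGroupType) (X : finType) (to : {action gT &-> X}).
Local Notation OP := (orbit_partitions to).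

Lemma refines_refl (P : {set {set X}}) : refines P P.
Proof. by apply/forall_inP => B BP; apply/exists_inP; exists B. Qed.

(** The recursion for the Moebius function with its top term moved across; antisymmetry of [refines]
    settles the diagonal case. *)
Lemma sum_moebius P P'' : P \in OP -> P'' \in OP ->
  \sum_(P' in OP | refines P P' && refines P' P'') moebius to P P' = (P == P'')%:R.
Proof.
move=> oP oP''; have [PP''|nPP''] := boolP (refines P P''); last first.
  rewrite big1 => [|P' /and3P[_ h h']]; last by rewrite (refines_trans h h') in nPP''.
  by case: eqP nPP'' => // ->; rewrite refines_refl.
rewrite (bigD1 P'') /=; last by rewrite oP'' PP'' refines_refl.
rewrite {1}(moebiusE _ oP'') PP'' /=; case: eqP => [<-|_].
  rewrite big1 ?addr0 // => P' /andP[/andP[oP' /andP[h h']] nP].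
  case/eqP: nP.
  exact: refines_anti (orbit_partitionsP oP') (orbit_partitionsP oP) h' h.
rewrite [X in _ + X](eq_bigl (fun P' => (P' \in OP) &&
    [&& refines P P', refines P' P'' & P' != P''])) ?addNr // => P'.
by rewrite !andbA.
Qed.

(** Here it matters that [P] consists of the orbits of a subgroup [A]: constancy on the blocks means
    that [A] fixes [kappa], so each block lies in an orbit of the full stabiliser. *)
Lemma refines_map_part (K : finType) (kappa : {ffun X -> K}) P : P \in OP ->
  reflect (forall B x y, B \in P -> x \in B -> y \in B -> kappa x = kappa y)
    (refines P (map_part to kappa)).
Proof.
move=> oP; apply: (iffP idP); move: oP => /imsetP [A _ ->].
  move=> /forall_inP h B x y BA xB yB.
  have /exists_inP [B' /imsetP [z _ ->] /fintype.subsetP sB] := h B BA.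
  have := const_on_orbits to kappa (map_stab to kappa).
  rewrite fintype.subxx => /esym/forallP/(_ z)/forall_inP hz.
  by rewrite (eqP (hz x (sB x xB))) (eqP (hz y (sB y yB))).
move=> h; have sA : A \subset map_stab to kappa.
  rewrite (const_on_orbits to); apply/forallP => x; apply/forall_inP => y yx.
  apply/eqP; apply: (h (orbit to A x)) => //; first exact: imset_f.
  exact: orbit_refl.
apply/forall_inP => B /imsetP [x _ ->].
apply/exists_inP; exists (orbit to (map_stab to kappa) x); first exact: imset_f.
exact: imsetS.
Qed.

End Moebius.

Section BlockFunctions.
Variables (gT : finGroupType) (X K : finType) (to : {action gT &-> X}).
Variables (d : K -> nat) (n : nat).
Hypothesis d_gt0 : forall k, (0 < d k)%N.
Local Notation dpow := (dpow n).

(** Expanding the product chooses a [k] for every block, that is, a map constant on blocks; a block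
    of size b with value k contributes d(k)^b to the degree. *)
Lemma prod_blocks P : P \in orbit_partitions to ->
  \prod_(B in P) \sum_k dpow (d k ^ #|B|) =
  \sum_(kappa : {ffun X -> K} | refines P (map_part to kappa))
    dpow (\prod_x d (kappa x)).
Proof.
move=> oP; have pP := orbit_partitionsP oP.
have [/eqP covP tP nP] := and3P pP.
pose s := [seq B <- index_enum ({set X} : finType) | B \in P].
have sP B : (B \in s) = (B \in P) by rewrite mem_filter mem_index_enum andbT.
have us : uniq s by rewrite filter_uniq ?index_enum_uniq.
(* Blocks are numbered in their order of enumeration, so that the product runs over a whole type
   without permuting factors in a matrix ring. *)
pose Bl := 'I_(size s); pose vl (B : Bl) : {set X} := nth finset.set0 s B.
have vlP B : vl B \in P by rewrite -sP mem_nth.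
have blP x : finset.pblock P x \in P by rewrite finset.pblock_mem // covP finset.in_setT.
have xbl x : x \in finset.pblock P x by rewrite finset.mem_pblock covP finset.in_setT.
have bl_lt x : (index (finset.pblock P x) s < size s)%N by rewrite index_mem sP.
pose bl x : Bl := Ordinal (bl_lt x).
have vl_bl x : vl (bl x) = finset.pblock P x by rewrite /vl nth_index ?sP.
have vl_inj : injective vl.
  by move=> B B' /eqP; rewrite nth_uniq // => /eqP; exact: val_inj.
have blE (B : Bl) x : (x \in vl B) = (bl x == B).
  apply/idP/eqP => [xB|<-]; last by rewrite vl_bl.
  by apply: vl_inj; rewrite vl_bl; exact: finset.def_pblock tP (vlP B) xB.
have ex_pt (B : Bl) : exists x, x \in vl B.
  by apply/finset.set0Pn; apply: contraNneq nP => <-.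
pose pt B := projT1 (cid (ex_pt B)).
have ptP B : bl (pt B) = B by apply/eqP; rewrite -blE; exact: (projT2 (cid (ex_pt B))).
rewrite -big_filter -/s (big_nth finset.set0) big_mkord.
rewrite (bigA_distr_bigA (fun (B : Bl) k => dpow (d k ^ #|vl B|))) /=.
rewrite [RHS](reindex_onto (fun f : {ffun Bl -> K} => [ffun x => f (bl x)])
  (fun kappa => [ffun B => kappa (pt B)])) /=; last first.
  move=> kappa /(refines_map_part kappa oP) h; apply/ffunP => x; rewrite !ffunE.
  apply: (h _ _ _ (blP x)); last exact: xbl.
  by rewrite -vl_bl blE ptP.
apply: eq_big => [f|f _].
  apply/esym/andP; split.
    apply/(refines_map_part _ oP) => B x y BP xB yB; rewrite !ffunE.
    have B_lt : (index B s < size s)%N by rewrite index_mem sP.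
    have vB : vl (Ordinal B_lt) = B by rewrite /vl nth_index ?sP.
    by have := xB; have := yB; rewrite -vB !blE => /eqP -> /eqP ->.
  by apply/eqP/ffunP => B; rewrite !ffunE ptP.
rewrite -dpow_prod => [|B _]; last by rewrite expn_gt0 d_gt0.
congr dpow; rewrite [RHS](partition_big bl predT) //=.
apply: eq_bigr => B _.
transitivity (\prod_(x in vl B) d (f B))%N; first by rewrite prod_nat_const.
by apply: eq_big => [x|x]; rewrite blE // => /eqP e; rewrite ffunE e.
Qed.

(** After exchanging the sums, [kappa] receives the sum of [moebius to P P'] over the [P'] between
    [P] and its own partition: 1 if these agree, 0 otherwise. *)
Lemma moebius_inversion P : P \in orbit_partitions to ->
  \sum_(P' in orbit_partitions to | refines P P')
     (\prod_(B in P') \sum_k dpow (d k ^ #|B|)) *~ moebius to P P' =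
  \sum_(kappa : {ffun X -> K} | map_part to kappa == P) dpow (\prod_x d (kappa x)).
Proof.
move=> oP.
transitivity (\sum_(P' in orbit_partitions to | refines P P')
   \sum_(kappa : {ffun X -> K} | refines P' (map_part to kappa))
    dpow (\prod_x d (kappa x)) *~ moebius to P P').
  by apply: eq_bigr => P' /andP[oP' _]; rewrite prod_blocks // mulrz_suml.
rewrite (exchange_big_dep predT) //= [RHS]big_mkcond; apply: eq_bigr => kappa _ /=.
under eq_bigl do rewrite -andbA.
rewrite -mulrz_sumr sum_moebius ?map_part_orbit // eq_sym.
by case: eqP.
Qed.

Lemma dmx_subst (a : dirichlet) b :
  (forall m, (0 < m <= n.+1)%N -> a m = #|[pred k | d k == m]|%:R) -> (0 < b)%N ->
  dmx n (dirichlet_subst b a) = \sum_k dpow (d k ^ b).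
Proof.
move=> aE b_gt0; apply: dmx_count => m /andP[m_gt0 mn].
rewrite /dirichlet_subst.
transitivity (\sum_(1 <= l < m.+1 | (l ^ b == m)%N) \sum_k (d k == l)%:R : rat).
  rewrite [LHS]big_seq_cond [RHS]big_seq_cond; apply: eq_bigr => l.
  rewrite mem_index_iota => /andP[/andP[l_gt0 lm] _].
  rewrite aE ?l_gt0 ?(leq_trans _ mn) // -sum1_card natr_sum big_mkcond.
  by apply: eq_bigr => k _; rewrite inE; case: eqP.
rewrite exchange_big -sum1_card natr_sum [RHS]big_mkcond; apply: eq_bigr => k _ /=.
rewrite inE; case: eqP => [dkm|dkm]; last first.
  by rewrite big1 // => l /eqP lm; case: eqP => // dkl; case: dkm; rewrite dkl.
(* [d k] is in the summation range because [d k <= d k ^ b = m]. *)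
rewrite big_mkcond (bigD1_seq (d k)) ?iota_uniq //=; last first.
  rewrite mem_index_iota d_gt0 ltnS -dkm -{1}(expn1 (d k)).
  by rewrite leq_pexp2l.
rewrite dkm !eqxx big1 ?addr0 // => l; rewrite eq_sym => /negPf ->.
by case: ifP.
Qed.

End BlockFunctions.

(** * Rigidity and zeta function of the wreath product *)

Section Main.
Variables (R : realType) (H : topologicalGroupType).
Variables (gT : finGroupType) (X : finType) (to : {action gT &-> X}).
Local Notation C := R[i].
Local Notation Q P := (discrete_topology [subg stability to P]).
Local Notation index P := #|[set: gT] : stability to P|%g.

Lemma dmx_zeta (G : topologicalGroupType) b n (K : finType) (d : K -> nat)
    (r : forall k, G -> 'M[C]_(d k)) :
  irr_system b r -> (n < b)%N -> dmx n (zeta R G) = \sum_k dpow n (d k).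
Proof.
move=> sys nb; apply: dmx_count => m /andP[m_gt0 mn].
have mb : (0 < m <= b)%N by rewrite m_gt0 (leq_trans mn).
by rewrite /zeta (irr_system_count sys mb).2.
Qed.

Lemma finite_irr_systems b : exists (K2 : {set {set X}} -> finType)
    (d2 : forall P, K2 P -> nat) (r2 : forall P (k : K2 P), Q P -> 'M[C]_(d2 P k)),
  forall P, irr_system b (r2 P).
Proof.
have ex P : exists (K : finType) (d : K -> nat) (r : forall k, Q P -> 'M[C]_(d k)),
    irr_system b r.
  have [K [d [r [sys _]]]] := irr_system_exists b (@finite_group_rigid R [subg stability to P]).
  by exists K, d, r.
pose K2 P := projT1 (cid (ex P)); have exd P := projT2 (cid (ex P)).
pose d2 P := projT1 (cid (exd P)); have exr P := projT2 (cid (exd P)).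
exists K2, d2, (fun P => projT1 (cid (exr P))) => P.
exact: projT2 (cid (exr P)).
Qed.

Lemma rigid_wreath : rigid R H -> rigid R (wreath H to).
Proof.
move=> rigH m m_gt0.
have [K [d [r [sys _]]]] := irr_system_exists m rigH.
have [K2 [d2 [r2 sys2]]] := finite_irr_systems #|gT|.
have sysW := wreath_system (to := to) sys (leqnn _) sys2.
have mm : (0 < m <= m)%N by rewrite m_gt0 leqnn.
exact: (irr_system_count sysW mm).1.
Qed.

Lemma stability_ltrans (K : finType) (kappa : {ffun X -> K}) q :
  (stability to (map_part to (ltrans to q kappa)) :=:
   stability to (map_part to kappa) :^ q^-1)%g.
Proof.
apply/setP => p; rewrite mem_conjg !stability_map_part conjgE !invgK !ltransM.
by rewrite -[LHS](inj_eq (can_inj (ltransKV to q))) ltransK.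
Qed.

Lemma dmx_zeta_wreath n : rigid R H ->
  dmx n (zeta R (wreath H to)) = dmx n
      (\sum_(P in orbit_partitions to)
        dirichlet_mul
          (dirichlet_mul
            (dirichlet_monom1 (index P))
            (zeta R (Q P)))
          (\sum_(P' in orbit_partitions to | refines P P')
            (\big[dirichlet_mul/dirichlet_one]_(B in P')
              dirichlet_subst #|B| (zeta R H)) *~ moebius to P P')).
Proof.
move=> rigH.
have [K [d [r [sys _]]]] := irr_system_exists n.+1 rigH.
(* [n.+1] makes the zeta functions of the stability subgroups exact up to the truncation, [#|gT|]
   makes their lists complete. *)
pose n2 := maxn n.+1 #|gT|.
have [K2 [d2 [r2 sys2]]] := finite_irr_systems n2.
have sysW := wreath_system (to := to) sys (leq_maxr _ _) sys2.
have d_gt0 k : (0 < d k)%N by have [/(_ k) []] := sys.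
have d2_gt0 P k : (0 < d2 P k)%N by have [/(_ k) []] := sys2 P.
have prod_gt0 (kappa : {ffun X -> K}) : (0 < \prod_x d (kappa x))%N.
  by apply: prodn_cond_gt0 => x _.
have zetaQ P : dmx n (zeta R (Q P)) = \sum_k dpow n (d2 P k).
  by apply: dmx_zeta (sys2 P) _; exact: leq_maxl.
(* The joint contribution of all representations lying over [kappa]. *)
pose Phi (kappa : {ffun X -> K}) := dpow n (index (map_part to kappa)) *
  dmx n (zeta R (Q (map_part to kappa))) * dpow n (\prod_x d (kappa x)).
have PhiE kappa : Phi kappa = \sum_k dpow n (index (map_part to kappa) *
    (\prod_x d (kappa x)) * d2 (map_part to kappa) k).
  rewrite /Phi zetaQ mulr_sumr mulr_suml; apply: eq_bigr => k _.
  by rewrite -!dpowM ?muln_gt0 ?indexg_gt0 ?d2_gt0 ?prod_gt0 // mulnAC.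
have Phi_inv kappa q : Phi (ltrans to q kappa) = Phi kappa.
  rewrite /Phi index_ltrans (prod_ltrans to d); congr (_ * _ * _).
  apply/dmxP => m /andP[m_gt0 _]; rewrite /zeta; congr _%:R.
  apply/esym/irr_count_conjugate; last exact: m_gt0.
  exact: stability_ltrans.
transitivity (\sum_(kappa | orbit_rep to kappa == kappa) Phi kappa).
  rewrite (dmx_zeta sysW) // sum_Tagged /=.
  transitivity (\sum_(kappa : {kappa : {ffun X -> K} | orbit_rep to kappa == kappa})
    Phi (val kappa)).
    apply: eq_bigr => kappa _; rewrite PhiE; apply: eq_bigr => k _.
    by rewrite card_induced_index.
  exact/esym/(@big_sub _ _ _ _ [pred kappa : {ffun X -> K} | orbit_rep to kappa == kappa] Phi).
(* The sum passes from orbit representatives to all maps, which are then sorted by their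
   partition. *)
rewrite sum_orbit_reps // raddf_sum.
rewrite [LHS](partition_big (map_part to) (mem (orbit_partitions to))) /=; last first.
  by move=> kappa _; exact: map_part_orbit.
apply: eq_bigr => P oP; rewrite !dmx_mul dmx_monom1 ?indexg_gt0 // raddf_sum.
transitivity ((index P)%:R^-1 *: dpow n (index P) * dmx n (zeta R (Q P)) *
    \sum_(kappa : {ffun X -> K} | map_part to kappa == P) dpow n (\prod_x d (kappa x))).
  rewrite mulr_sumr; apply: eq_bigr => kappa /eqP <-.
  by rewrite /Phi -!scalerAl.
congr (_ * _); rewrite -(moebius_inversion _ d_gt0) //.
apply: eq_bigr => P' /andP[oP' _]; rewrite raddfMz /=; congr (_ *~ _).
rewrite dmx_prod; apply: eq_bigr => B BP'.
rewrite -(dmx_subst (a := zeta R H) d_gt0) //.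
  by move=> m mn; rewrite /zeta (irr_system_count sys mn).2.
(* Blocks are nonempty, so the substituted exponent is positive. *)
have /and3P[_ _ nP'] := orbit_partitionsP oP'.
by rewrite card_gt0; apply: contraNneq nP' => <-.
Qed.

(** A constant map is fixed by Q, so each irreducible representation of [H] of degree [m] gives, by
    its tensor power and the trivial character of Q, one of degree [m ^ #|X|]; infinitely many
    exceed any finite count. For empty [X] the constant maps coincide and the wreath product is
    finite, hence the hypothesis. *)
Lemma rigid_base : (0 < #|X|)%N -> rigid R (wreath H to) -> rigid R H.
Proof.
move=> X_gt0 rigW m m_gt0; apply: contrapT => inf.
have [x0 _] := card_gt0P X_gt0.
pose D := (m ^ #|X|)%N.
have [B [rho [cB mirr crho ineq]]] :=
  infinite_irr_family (irr_count R (wreath H to) D) inf.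
have R0 := blockfun0 rho; have R1 := blockfun1 mirr; have RM := blockfunM mirr.
have Rd := blockfun_dual mirr ineq.
pose cst (A : B) : {ffun X -> B} := [ffun=> A].
have ltrans_cst q A : ltrans to q (cst A) = cst A by apply/ffunP => x; rewrite !ffunE.
have cst_inj : injective cst by move=> A A' /ffunP/(_ x0); rewrite !ffunE.
pose sigma (A : B) (q : gT) : 'M[C]_1 := 1%:M.
have ind := @induced_independent _ H _ _ to _ _ (fun s : {k : B & 'I_m} => tag s)
  (blockfun rho) Rd B cst (fun=> 1%N) sigma.
have {}ind : jointly_independent (fun A => @induced_fun _ H _ _ to _ _
    (fun s : {k : B & 'I_m} => tag s) (blockfun rho) (cst A) 1 (sigma A)).
  apply: ind => [A A' /in_orbitP [q]|A c hc l k]; first by rewrite ltrans_cst.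
  have := hc 1%g (ltrans_cst _ _).
  rewrite (big_pred1 A) => [|A']; last by rewrite (inj_eq cst_inj).
  by rewrite !big_ord1 !ord1 mxE eqxx mulr1.
have deg A : #|induced_index to (fun s : {k : B & 'I_m} => tag s) (cst A) 1| = D.
  rewrite (card_induced_index to (fun=> m)) muln1 -card_in_orbit prod_nat_const.
  suff -> : #|[pred k | in_orbit to (cst A) k]| = 1%N by rewrite mul1n.
  rewrite -(card1 (cst A)); apply: eq_card => k; rewrite !inE.
  by apply/in_orbitP/eqP => [[q <-]|->]; [|exists 1%g]; rewrite ltrans_cst.
have D_gt0 : (0 < D)%N by rewrite expn_gt0 m_gt0.
have : (#|B| <= irr_count R (wreath H to) D)%N.
  apply: (irr_count_ge (r := fun A => mxof (@induced_fun _ H _ _ to _ _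
    (fun s : {k : B & 'I_m} => tag s) (blockfun rho) (cst A) 1 (sigma A)))) => //.
  - move=> A; apply: (jointly_independent_irr ind); last by rewrite deg.
    apply: (induced_hom R0 R1 RM); split=> // p q _ _; by rewrite mulmx1.
  - by move=> A a b; exact: induced_cont.
  - by move=> A A' T; exact: (jointly_independent_inequiv ind).
  - exact: rigW.
by rewrite leqNgt cB.
Qed.

End Main.

Theorem theorem1 (R : realType) (H : topologicalGroupType)
    (gT : finGroupType) (X : finType) (to : {action gT &-> X}) :
  ((0 < #|X|)%N -> (rigid R (wreath H to) <-> rigid R H)) /\
  (rigid R H ->
    rigid R (wreath H to) /\
    dirichlet_eq (zeta R (wreath H to))
      (\sum_(P in orbit_partitions to)
        dirichlet_mul
          (dirichlet_mul
            (dirichlet_monom1 #|[set: gT] : stability to P|%g)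
            (zeta R (discrete_topology [subg stability to P])))
          (\sum_(P' in orbit_partitions to | refines P P')
            (\big[dirichlet_mul/dirichlet_one]_(B in P')
              dirichlet_subst #|B| (zeta R H)) *~ moebius to P P'))).
Proof.
split=> [X_gt0|rigH].
  by split; [exact: rigid_base | exact: rigid_wreath].
split; first exact: rigid_wreath.
(* The coefficient of index [n.+1] is the last one visible in truncation [n]. *)
move=> [|n] // _; have /dmxP := dmx_zeta_wreath to n rigH.
by apply; rewrite /= ltnS leqnn.
Qed.
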